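(* Let $\Lambda=\begin{pmatrix}A&N\\ M&B\end{pmatrix}_{\phi,\psi}$ be an arbitrary finite-dimensional Morita context algebra over a field $k$, let $X$ be a support $\tau$-tilting $A$-module and $Y$ a support $\tau$-tilting $B$-module. If $$Y\otimes_BM\in\operatorname{Fac}_AX\qquad\text{and}\qquad X\otimes_AN\in\operatorname{Fac}_BY,$$ then $F_AX\oplus F_BY$ is a support $\tau$-tilting $\Lambda$-module and $$\operatorname{Fac}_\Lambda(F_AX\oplus F_BY)=\mathcal T_{X,Y}:=\{W\in\operatorname{mod}\Lambda\mid We\in\operatorname{Fac}_AX,\ Wf\in\operatorname{Fac}_BY\}.$$
   Context: **Conventions.** $k$ is a field, all algebras are finite-dimensional $k$-algebras (not assumed basic), and $\operatorname{mod}C$ is the category of finitely generated right $C$-modules. $\tau$-rigid and support $\tau$-tilting modules and pairs are represented by basic objects (no repeated isomorphic indecomposable summands), and the input modules $X,Y$ are taken basic; repeated isomorphic summands in a displayed direct sum representing such an object are deleted. **Morita contexts.** $A,B$ are finite-dimensional algebras, ${}_AN_B$, ${}_BM_A$ finite-dimensional bimodules, $\phi:N\otimes_BM\to A$ and $\psi:M\otimes_AN\to B$ bimodule maps with $\phi(n\otimes m)n'=n\psi(m\otimes n')$ and $m\phi(n\otimes m')=\psi(m\otimes n)m'$. $\Lambda$ is the algebra of matrices $\begin{pmatrix}a&n\\ m&b\end{pmatrix}$ with matrix multiplication using $\phi,\psi$ for the products $N\times M\to A$, $M\times N\to B$; $e,f$ are the diagonal idempotents of $A$ and $B$. $F_A=-\otimes_Ae\Lambda:\operatorname{mod}A\to\operatorname{mod}\Lambda$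 and $F_B=-\otimes_Bf\Lambda:\operatorname{mod}B\to\operatorname{mod}\Lambda$. **$\tau$-tilting theory.** For a finite-dimensional algebra $C$, $\tau_C$ is the Auslander–Reiten translation and $|T|$ the number of isomorphism classes of indecomposable summands of $T$. $T$ is $\tau$-rigid if $\operatorname{Hom}_C(T,\tau_CT)=0$. $T$ is support $\tau$-tilting if it is $\tau$-rigid and there is a projective $P$ with $\operatorname{Hom}_C(P,T)=0$ and $|T|+|P|=|C|$. $\operatorname{Fac}_CT$ is the class of factor modules of finite direct sums of copies of $T$. *)

(* Defs.v *)
From HB Require Import structures.
From mathcomp Require Import all_boot all_order all_algebra all_field.

Set Implicit Arguments.
Unset Strict Implicit.
Unset Printing Implicit Defensive.

Import GRing.Theory.
Local Open Scope ring_scope.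

Section Linear.
Variable k : fieldType.

Lemma linfunE (V W : vectType k) (f : V -> W) :
  linear f -> linfun f =1 f.
Proof.
move=> fl x.
pose F : {linear V -> W} := HB.pack f (GRing.isLinear.Build k V W *:%R f fl).
by rewrite -[f]/(F : _ -> _) lfunE.
Qed.

Lemma lin0 (V W : vectType k) (f : V -> W) : linear f -> f 0 = 0.
Proof. by move=> fl; rewrite -(linfunE fl) linear0. Qed.
Lemma linD (V W : vectType k) (f : V -> W) : linear f -> {morph f : x y / x + y}.
Proof. by move=> fl x y; rewrite -!(linfunE fl) linearD. Qed.
Lemma linB (V W : vectType k) (f : V -> W) : linear f -> {morph f : x y / x - y}.
Proof. by move=> fl x y; rewrite -!(linfunE fl) linearB. Qed.
Lemma linZ (V W : vectType k) (f : V -> W) a : linear f -> {morph f : x / a *: x}.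
Proof. by move=> fl x; rewrite -!(linfunE fl) linearZ. Qed.
Lemma linS (V W : vectType k) (f : V -> W) I r (P : pred I) (F : I -> V) :
  linear f -> f (\sum_(i <- r | P i) F i) = \sum_(i <- r | P i) f (F i).
Proof.
move=> fl; rewrite -(linfunE fl) linear_sum.
by apply: eq_bigr => i _; exact: linfunE.
Qed.

(* Quotient spaces, realised on a complement. *)
Section Quotient.
Variables (V : vectType k) (U : {vspace V}).

Definition quot : vectType k := subvs_of (U^C)%VS.
Definition qproj : V -> quot := vsproj (U^C)%VS \o daddv_pi (U^C)%VS U.

Lemma qproj_linear : linear qproj.
Proof. by move=> a x y; rewrite /qproj /= !linearP. Qed.

Lemma vsval_qproj x : vsval (qproj x) = daddv_pi (U^C)%VS U x.
Proof. by rewrite /qproj /= vsprojK ?memv_pi. Qed.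

Lemma capCv : (U^C :&: U = 0)%VS.
Proof. by rewrite capvC capv_compl. Qed.

Lemma qprojK (q : quot) : qproj (vsval q) = q.
Proof.
apply: val_inj; rewrite /= vsval_qproj.
by apply: daddv_pi_id; [exact: capCv | exact: subvsP].
Qed.

Lemma qproj_eq0 x : (qproj x == 0) = (x \in U).
Proof.
have xUC : (x \in U^C + U)%VS by rewrite addvC addv_complf memvf.
have Ex := daddv_pi_add capCv xUC.
have Ix : (daddv_pi U (U^C)%VS x \in U) by exact: memv_pi.
rewrite -(inj_eq val_inj) /= vsval_qproj; apply/eqP/idP => [E | xU].
  by rewrite -Ex E add0r.
have : daddv_pi (U^C)%VS U x \in (U^C :&: U)%VS.
  rewrite memv_cap memv_pi /=.
  by rewrite -[X in X \in U](addrK (daddv_pi U (U^C)%VS x)) Ex rpredB.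
by rewrite capCv memv0 => /eqP.
Qed.

Lemma qproj_val x : x - vsval (qproj x) \in U.
Proof. by rewrite -qproj_eq0 (linB qproj_linear) qprojK subrr. Qed.

End Quotient.
End Linear.

Section Modules.
Variable k : fieldType.

Definition right_action (A : falgType k) (V : vectType k)
    (act : V -> A -> V) : Prop :=
  [/\ forall a, linear (act^~ a), forall x, linear (act x),
      forall x, act x 1 = x
    & forall x a b, act x (a * b) = act (act x a) b].

Definition left_action (A : falgType k) (V : vectType k)
    (act : A -> V -> V) : Prop :=
  [/\ forall a, linear (act a), forall x, linear (act^~ x),
      forall x, act 1 x = x
    & forall x a b, act (a * b) x = act a (act b x)].

(* Over a finite-dimensional algebra, the finitely generated modules are those
   carried by a finite-dimensional space. *)
Record rmod (A : falgType k) := RMod {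
  rmod_sort :> vectType k;
  ract : rmod_sort -> A -> rmod_sort;
  ractP : right_action ract }.

Record lmod (A : falgType k) := LMod {
  lmod_sort :> vectType k;
  lact : A -> lmod_sort -> lmod_sort;
  lactP : left_action lact }.

Record bimod (A B : falgType k) := BiMod {
  bimod_sort :> vectType k;
  blact : A -> bimod_sort -> bimod_sort;
  bract : bimod_sort -> B -> bimod_sort;
  blactP : left_action blact;
  bractP : right_action bract;
  bactA : forall a x b, bract (blact a x) b = blact a (bract x b) }.

Canonical bimod_l A B (N : bimod A B) : lmod A := LMod (blactP N).
Canonical bimod_r A B (N : bimod A B) : rmod B := RMod (bractP N).

Section Theory.
Variable A : falgType k.
Implicit Types T U V W P : rmod A.

Lemma ract_linl V a : linear (fun x : V => ract x a). Proof. by case: (ractP V). Qed.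
Lemma ract_linr V (x : V) : linear (ract x). Proof. by case: (ractP V). Qed.
Lemma ract1 V (x : V) : ract x 1 = x. Proof. by case: (ractP V). Qed.
Lemma ractM V (x : V) a b : ract x (a * b) = ract (ract x a) b.
Proof. by case: (ractP V). Qed.
Lemma lact_linr (L : lmod A) a : linear (@lact A L a). Proof. by case: (lactP L). Qed.
Lemma lact_linl (L : lmod A) (x : L) : linear (fun a => lact a x).
Proof. by case: (lactP L). Qed.
Lemma lact1 (L : lmod A) (x : L) : lact 1 x = x. Proof. by case: (lactP L). Qed.
Lemma lactM (L : lmod A) (x : L) a b : lact (a * b) x = lact a (lact b x).
Proof. by case: (lactP L). Qed.

Fact mulr_ract : right_action (fun x a : A => x * a).
Proof.
split=> [a c x y|x c a b|x|x a b]; last exact: mulrA; last exact: mulr1.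
  by rewrite mulrDl scalerAl.
by rewrite mulrDr scalerAr.
Qed.

Fact mulr_lact : left_action (fun a x : A => a * x).
Proof.
split=> [a c x y|x c a b|x|x a b]; last by rewrite mulrA.
- by rewrite mulrDr scalerAr.
- by rewrite mulrDl scalerAl.
exact: mul1r.
Qed.

Definition regular_r : rmod A := RMod mulr_ract.

Fact regular_bimod_subproof (a x b : A) : a * x * b = a * (x * b).
Proof. by rewrite mulrA. Qed.
Definition regular_bimod : bimod A A :=
  BiMod mulr_lact mulr_ract regular_bimod_subproof.

Definition rhom U V (g : 'Hom(U, V)) : Prop :=
  forall x a, g (ract x a) = ract (g x) a.

Definition lhom (L L' : lmod A) (g : 'Hom(L, L')) : Prop :=
  forall a x, g (lact a x) = lact a (g x).

Definition riso U V : Prop :=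
  exists2 g : 'Hom(U, V), rhom g & lker g = 0%VS /\ limg g = fullv.

Definition submodule U (S : {vspace U}) : Prop :=
  forall x a, x \in S -> ract x a \in S.

Fact dsum_subproof U V :
  right_action (fun (x : (U * V)%type) (a : A) => (ract x.1 a, ract x.2 a)).
Proof.
split=> [a c [x x'] [y y']|[x x'] c a b|[x x']|[x x'] a b] /=.
- by rewrite !ract_linl.
- by rewrite !ract_linr.
- by rewrite !ract1.
by rewrite !ractM.
Qed.
Definition dsum U V : rmod A := RMod (dsum_subproof U V).

Fact dpow_subproof U n :
  right_action (fun (x : {ffun 'I_n -> U}) (a : A) => [ffun i => ract (x i) a]).
Proof.
split=> [a c x y|x c a b|x|x a b]; apply/ffunP => i; rewrite !ffunE.
- exact: ract_linl.
- exact: ract_linr.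
- exact: ract1.
exact: ractM.
Qed.
Definition dpow U n : rmod A := RMod (dpow_subproof U n).

Definition Fac T W : Prop :=
  exists n, exists2 g : 'Hom(dpow T n, W), rhom g & limg g = fullv.

Definition zero_module U : Prop := forall x : U, x = 0.

Definition indecomposable U : Prop :=
  ~ zero_module U /\
  forall V W, riso U (dsum V W) -> zero_module V \/ zero_module W.

Definition summand U T : Prop := exists V, riso T (dsum U V).

(* [card_indec T n] says that |T| = n. *)
Definition card_indec T (n : nat) : Prop :=
  exists s : 'I_n -> rmod A,
    [/\ forall i, indecomposable (s i) /\ summand (s i) T,
        forall i j, riso (s i) (s j) -> i = j
      & forall U, indecomposable U -> summand U T -> exists i, riso U (s i)].

Definition basic T : Prop :=
  forall U V, indecomposable U -> ~ riso T (dsum (dsum U U) V).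

(* U is obtained from T by deleting repeated indecomposable summands. *)
Definition basic_version T U : Prop :=
  basic U /\ forall V, indecomposable V -> (summand V U <-> summand V T).

Definition projective P : Prop :=
  forall U V (g : 'Hom(U, V)) (h : 'Hom(P, V)),
    rhom g -> rhom h -> limg g = fullv ->
    exists2 h' : 'Hom(P, U), rhom h' & (g \o h')%VF = h.

Definition superfluous U (S : {vspace U}) : Prop :=
  forall S' : {vspace U}, submodule S' -> (S' + S)%VS = fullv -> S' = fullv.

(* A minimal projective presentation P1 -> P0 -> T -> 0: both P0 -> T and
   P1 -> ker (P0 -> T) are projective covers. *)
Record min_presentation T := MinPresentation {
  pres1 : rmod A;
  pres0 : rmod A;
  pres_d : 'Hom(pres1, pres0);
  pres_e : 'Hom(pres0, T);
  pres1_proj : projective pres1;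
  pres0_proj : projective pres0;
  pres_d_hom : rhom pres_d;
  pres_e_hom : rhom pres_e;
  pres_e_surj : limg pres_e = fullv;
  pres_exact : limg pres_d = lker pres_e;
  pres_e_min : superfluous (lker pres_e);
  pres_d_min : superfluous (lker pres_d) }.


Definition homs_defect U (a : A) (g : 'Hom(U, A)) : 'Hom(U, A) :=
  ((g \o linfun (fun x : U => ract x a)) - (amulr a \o g))%VF.

(* The space of A-linear maps U -> A, see [mem_homs]. *)
Definition homs U : {vspace 'Hom(U, A)} :=
  (\bigcap_(i < \dim {:A}) lker (linfun (homs_defect (U := U) (vbasis {:A})`_i)))%VS.

Lemma homs_defectE U a g x :
  homs_defect (U := U) a g x = g (ract x a) - g x * a.
Proof.
by rewrite /homs_defect add_lfunE opp_lfunE !comp_lfunE (linfunE (@ract_linl U a)) lfunE.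
Qed.

Lemma homs_defect_linear U a : linear (homs_defect (U := U) a).
Proof.
move=> c g h; apply/lfunP => x.
rewrite !(homs_defectE, add_lfunE, scale_lfunE) mulrDl scalerBr -scalerAl.
by rewrite opprD addrACA.
Qed.

Lemma mem_homs U (g : 'Hom(U, A)) :
  g \in homs U <-> rhom (U := U) (V := regular_r) g.
Proof.
split=> [gU x a | gh].
  change (g (ract x a) = g x * a).
  rewrite (coord_vbasis (memvf a)) (linS _ _ _ (ract_linr x)) linear_sum mulr_sumr.
  apply: eq_bigr => i _.
  rewrite (linZ _ (ract_linr x)) linearZ /= -scalerAr.
  congr (_ *: _); apply/eqP; rewrite -subr_eq0 -homs_defectE.
  have := subvP (bigcapv_inf i (erefl true) (subvv _)) _ gU.
  rewrite memv_ker linfunE; last exact: homs_defect_linear.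
  by move/eqP->; rewrite lfunE.
rewrite memvE; apply/subv_bigcapP => i _; rewrite -memvE memv_ker.
rewrite linfunE; last exact: homs_defect_linear.
by apply/eqP/lfunP => x; rewrite homs_defectE gh lfunE; exact: subrr.
Qed.

Lemma homs_amull U (c : A) (g : 'Hom(U, A)) :
  g \in homs U -> (amull c \o g)%VF \in homs U.
Proof.
move=> /mem_homs gh; apply/mem_homs => x a.
by rewrite !comp_lfunE !lfunE gh; exact: mulrA.
Qed.

Lemma homs_comp U V (g : 'Hom(U, V)) (h : 'Hom(V, A)) :
  rhom g -> h \in homs V -> (h \o g)%VF \in homs U.
Proof.
move=> gh /mem_homs hh; apply/mem_homs => x a.
by rewrite !comp_lfunE gh hh.
Qed.

(* Hom_A(U, A) as a left A-module. *)
Fact homs_lmod_subproof U :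
  left_action (fun (c : A) (h : subvs_of (homs U)) =>
    vsproj (homs U) (amull c \o vsval h)%VF).
Proof.
split=> [c d h h'|h d c c'|h|h c d]; apply: val_inj => /=.
- rewrite !vsprojK ?homs_amull ?rpredD ?rpredZ ?subvsP //.
  by rewrite comp_lfunDr comp_lfunZr.
- rewrite !vsprojK ?homs_amull ?subvsP //.
  by rewrite linearP comp_lfunDl comp_lfunZl.
- rewrite vsprojK ?homs_amull ?subvsP //.
  by apply/lfunP => x; rewrite comp_lfunE lfunE /= mul1r.
rewrite !vsprojK ?homs_amull ?subvsP //.
by apply/lfunP => x; rewrite !comp_lfunE !lfunE /= mulrA.
Qed.
Definition homs_lmod U : lmod A := LMod (homs_lmod_subproof U).

(* Hom_A(g, A) *)
Definition homs_map U V (g : 'Hom(U, V)) : 'Hom(homs_lmod V, homs_lmod U) :=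
  linfun (fun h : homs_lmod V => vsproj (homs U) (vsval h \o g)%VF).

Lemma homs_mapE U V (g : 'Hom(U, V)) (h : homs_lmod V) :
  rhom g -> vsval (homs_map g h) = (vsval h \o g)%VF.
Proof.
move=> gh; rewrite linfunE ?vsprojK //.
  by apply: homs_comp => //; exact: subvsP.
move=> a x y; apply: val_inj => /=.
rewrite !vsprojK ?homs_comp ?rpredD ?rpredZ ?subvsP //.
by rewrite comp_lfunDl comp_lfunZl.
Qed.

Lemma homs_map_lhom U V (g : 'Hom(U, V)) : rhom g -> lhom (homs_map g).
Proof.
move=> gh c h; apply: val_inj; rewrite /= homs_mapE //=.
rewrite !vsprojK ?homs_amull ?subvsP //.
by rewrite homs_mapE // comp_lfunA.
Qed.

Fact lcoker_subproof (L L' : lmod A) (g : 'Hom(L, L')) : lhom g ->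
  left_action (fun a (q : quot (limg g)) => qproj (limg g) (lact a (vsval q))).
Proof.
move=> gh; split=> [a c q r|q c a b|q|q a b].
- by rewrite linearP lact_linr qproj_linear.
- by rewrite lact_linl qproj_linear.
- by rewrite lact1 qprojK.
rewrite lactM; apply/eqP; rewrite -subr_eq0 -(linB (@qproj_linear _ _ _)) qproj_eq0.
rewrite -(linB (@lact_linr L' a)).
have /memv_imgP[x _ ->] := qproj_val (limg g) (lact b (vsval q)).
by rewrite -gh memv_img // memvf.
Qed.
Definition lcoker (L L' : lmod A) (g : 'Hom(L, L')) (gh : lhom g) : lmod A :=
  LMod (lcoker_subproof gh).

Fact ldual_subproof (L : lmod A) :
  right_action (fun (xi : 'Hom(L, k^o)) (a : A) =>
    (xi \o linfun (fun x : L => lact a x))%VF).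
Proof.
split=> [a c x y|x c a b|x|x a b]; apply/lfunP => v.
- by rewrite comp_lfunDl comp_lfunZl.
- rewrite add_lfunE scale_lfunE !comp_lfunE !(linfunE (@lact_linr L _)).
  by rewrite lact_linl linearP.
- by rewrite !comp_lfunE !(linfunE (@lact_linr L _)) lact1.
by rewrite !comp_lfunE !(linfunE (@lact_linr L _)) lactM.
Qed.
Definition ldual (L : lmod A) : rmod A := RMod (ldual_subproof L).

Definition transpose T (p : min_presentation T) : lmod A :=
  lcoker (homs_map_lhom (@pres_d_hom _ p)).

(* tau = D Tr *)
Definition tau T (p : min_presentation T) : rmod A := ldual (transpose p).

(* tau p depends on the minimal presentation p, which exists and is unique,
   only up to isomorphism. *)
Definition tau_rigid T : Prop :=
  exists p : min_presentation T,
    forall g : 'Hom(T, tau p), rhom g -> g = 0.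

Definition support_tau_tilting T : Prop :=
  tau_rigid T /\
  exists P : rmod A,
    [/\ projective P,
        forall g : 'Hom(P, T), rhom g -> g = 0
      & exists t p, [/\ card_indec T t, card_indec P p
                      & card_indec regular_r (t + p)]].

End Theory.

Section Tensor.
Variables (A : falgType k) (X : rmod A) (N : lmod A).

(* X (x)_k N is realised by matrices of coordinates. *)
Definition ktens (x : X) (n : N) : 'M[k]_(\dim {:X}, \dim {:N}) :=
  \matrix_(i, j) (coord (vbasis {:X}) i x * coord (vbasis {:N}) j n).

Definition tens_rel : {vspace 'M[k]_(\dim {:X}, \dim {:N})} :=
  (\sum_(i < \dim {:X}) \sum_(l < \dim {:A}) \sum_(j < \dim {:N})
     <[ktens (ract (vbasis {:X})`_i (vbasis {:A})`_l) (vbasis {:N})`_j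
       - ktens (vbasis {:X})`_i (lact (vbasis {:A})`_l (vbasis {:N})`_j)]>)%VS.

Definition tens : vectType k := quot tens_rel.

Definition pure (x : X) (n : N) : tens := qproj tens_rel (ktens x n).

(* The map w |-> beta(w) induced by a balanced bilinear map, see [tliftE]. *)
Definition tlift (Z : vectType k) (beta : X -> N -> Z) (w : tens) : Z :=
  \sum_i \sum_j (vsval w) i j *: beta (vbasis {:X})`_i (vbasis {:N})`_j.

Definition bilin (Z : vectType k) (beta : X -> N -> Z) : Prop :=
  (forall n, linear (beta^~ n)) /\ (forall x, linear (beta x)).

Definition balanced (Z : vectType k) (beta : X -> N -> Z) : Prop :=
  bilin beta /\ forall x a n, beta (ract x a) n = beta x (lact a n).

Lemma bilin_sum (Z : vectType k) (beta : X -> N -> Z) x n : bilin beta ->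
  beta x n = \sum_i \sum_j (ktens x n) i j *:
     beta (vbasis {:X})`_i (vbasis {:N})`_j.
Proof.
move=> [bl br]; rewrite {1}(coord_vbasis (memvf x)) (linS _ _ _ (bl n)).
apply: eq_bigr => i _; rewrite (linZ _ (bl n)).
rewrite {1}(coord_vbasis (memvf n)) (linS _ _ _ (br _)) scaler_sumr.
by apply: eq_bigr => j _; rewrite (linZ _ (br _)) scalerA mxE.
Qed.

Lemma ktens_bilin : bilin ktens.
Proof.
split=> y c u v; apply/matrixP=> i j; rewrite !mxE linearP.
  by rewrite mulrDl mulrA.
by rewrite mulrDr mulrCA.
Qed.

Lemma pure_bilin : bilin pure.
Proof.
by have [kl kr] := ktens_bilin; split=> y c u v; rewrite /pure ?kl ?kr qproj_linear.
Qed.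

Lemma tens_rel_mem x a n : ktens (ract x a) n - ktens x (lact a n) \in tens_rel.
Proof.
have [kl kr] := ktens_bilin.
rewrite (coord_vbasis (memvf x)) (linS _ _ _ (ract_linl a)).
rewrite !(linS _ _ _ (kl _)) -sumrB rpred_sum // => i _.
rewrite (linZ _ (ract_linl a)) !(linZ _ (kl _)) -scalerBr rpredZ //.
rewrite (coord_vbasis (memvf a)) (linS _ _ _ (ract_linr _)) (linS _ _ _ (lact_linl n)).
rewrite (linS _ _ _ (kl _)) (linS _ _ _ (kr _)) -sumrB rpred_sum // => l _.
rewrite (linZ _ (ract_linr _)) (linZ _ (lact_linl n)) (linZ _ (kl _)) (linZ _ (kr _)).
rewrite -scalerBr rpredZ //.
rewrite (coord_vbasis (memvf n)) (linS _ _ _ (@lact_linr _ N _)).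
rewrite !(linS _ _ _ (kr _)) -sumrB rpred_sum // => j _.
rewrite (linZ _ (@lact_linr _ N _)) !(linZ _ (kr _)) -scalerBr rpredZ //.
apply: subvP (memv_line _).
by rewrite (sumv_sup i) // (sumv_sup l) // (sumv_sup j).
Qed.

Lemma pure_balanced : balanced pure.
Proof.
split=> [|x a n]; first exact: pure_bilin.
by apply/eqP; rewrite -subr_eq0 -(linB (@qproj_linear _ _ _)) qproj_eq0 tens_rel_mem.
Qed.

Lemma tlift_linear (Z : vectType k) (beta : X -> N -> Z) : linear (tlift beta).
Proof.
move=> c u v; rewrite /tlift scaler_sumr -big_split; apply: eq_bigr => i _ /=.
rewrite scaler_sumr -big_split; apply: eq_bigr => j _ /=.
by rewrite !mxE scalerDl scalerA.
Qed.

Lemma tliftE (Z : vectType k) (beta : X -> N -> Z) x n :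
  balanced beta -> tlift beta (pure x n) = beta x n.
Proof.
move=> [bb bA].
pose F (M : 'M[k]_(\dim {:X}, \dim {:N})) : Z :=
  \sum_i \sum_j M i j *: beta (vbasis {:X})`_i (vbasis {:N})`_j.
have Fl : linear F.
  move=> c u v; rewrite /F scaler_sumr -big_split; apply: eq_bigr => i _ /=.
  rewrite scaler_sumr -big_split; apply: eq_bigr => j _ /=.
  by rewrite !mxE scalerDl scalerA.
have FE y m : F (ktens y m) = beta y m by rewrite (bilin_sum _ _ bb).
rewrite -(FE x n); apply/eqP; rewrite eq_sym -subr_eq0 -[tlift _ _]/(F _) -(linB Fl).
have : (tens_rel <= lker (linfun F))%VS.
  apply/subv_sumP => i _; apply/subv_sumP => l _; apply/subv_sumP => j _.
  by rewrite -memvE memv_ker (linfunE Fl) (linB Fl) !FE bA subrr.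
by move=> /subvP/(_ _ (qproj_val _ (ktens x n))); rewrite memv_ker (linfunE Fl).
Qed.

Lemma tens_ext (Z : vectType k) (f g : tens -> Z) :
  linear f -> linear g -> (forall x n, f (pure x n) = g (pure x n)) -> f =1 g.
Proof.
move=> fl gl fg w.
have -> : w = \sum_i \sum_j (vsval w) i j *: pure (vbasis {:X})`_i (vbasis {:N})`_j.
  rewrite -{1}[w]qprojK {1}[vsval w]matrix_sum_delta (linS _ _ _ (@qproj_linear _ _ _)).
  apply: eq_bigr => i _; rewrite (linS _ _ _ (@qproj_linear _ _ _)).
  apply: eq_bigr => j _; rewrite (linZ _ (@qproj_linear _ _ _)); congr (_ *: qproj _ _).
  apply/matrixP => i' j'; rewrite !mxE.
  by rewrite !coord_free ?(basis_free (vbasisP _)) // -natrM mulnb !(eq_sym i') !(eq_sym j').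
rewrite !(linS _ _ _ fl, linS _ _ _ gl); apply: eq_bigr => i _.
rewrite !(linS _ _ _ fl, linS _ _ _ gl); apply: eq_bigr => j _.
by rewrite (linZ _ fl) (linZ _ gl) fg.
Qed.

End Tensor.

Section TensorModules.

Section Right.
Variables (A B : falgType k) (X : rmod A) (N : bimod A B).
Local Notation T := (tens X (bimod_l N)).

Definition tens_ract (w : T) (b : B) : T :=
  tlift (fun (x : X) (n : N) => pure x (bract n b)) w.

Lemma tens_ract_balanced b :
  balanced (fun (x : X) (n : N) => pure x (bract n b)).
Proof.
have [[pl pr] pA] := pure_balanced X (bimod_l N).
split; first split=> [n|x] c u v.
- exact: pl.
- by rewrite (ract_linl (V := bimod_r N)) pr.
by move=> x a n; rewrite pA /= (bactA a n b).
Qed.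

Lemma tens_ractE (x : X) (n : N) b :
  tens_ract (pure x n) b = pure x (bract n b).
Proof. by rewrite /tens_ract tliftE //; exact: tens_ract_balanced. Qed.

Fact tens_ractP : right_action tens_ract.
Proof.
have [[pl pr] pA] := pure_balanced X (bimod_l N).
have lin1 b : linear (tens_ract^~ b) by exact: tlift_linear.
have lincomb (c : k) (f g : T -> T) : linear f -> linear g ->
    linear (fun w => c *: f w + g w).
  move=> fl gl d u v; rewrite fl gl !scalerDr !scalerA mulrC.
  by rewrite addrACA.
split=> [b|w c a b|w|w a b]; first exact: lin1.
- move: w; apply: tens_ext; [exact: lin1 | exact: lincomb |] => x n.
  by rewrite !tens_ractE (ract_linr (V := bimod_r N)) pr.
- move: w; apply: tens_ext; [exact: lin1 | by [] |] => x n.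
  by rewrite tens_ractE (ract1 (V := bimod_r N)).
move: w; apply: tens_ext; [exact: lin1 | by move=> d u v; rewrite !lin1 |] => x n.
by rewrite !tens_ractE (ractM (V := bimod_r N)).
Qed.

Definition tens_rmod : rmod B := RMod tens_ractP.
End Right.

Section Left.
Variables (A B : falgType k) (N : bimod A B) (L : lmod B).
Local Notation T := (tens (bimod_r N) L).

Definition tens_lact (a : A) (w : T) : T :=
  tlift (fun (n : N) (l : L) => pure (blact a n) l) w.

Lemma tens_lact_balanced a :
  balanced (fun (n : N) (l : L) => pure (blact a n) l).
Proof.
have [[pl pr] pA] := pure_balanced (bimod_r N) L.
split; first split=> [n|x] c u v.
- by rewrite (lact_linr (L := bimod_l N)) pl.
- exact: pr.
by move=> x b n; rewrite -pA /= (bactA a x b).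
Qed.

Lemma tens_lactE a (n : N) (l : L) :
  tens_lact a (pure n l) = pure (blact a n) l.
Proof. by rewrite /tens_lact tliftE //; exact: tens_lact_balanced. Qed.

Fact tens_lactP : left_action tens_lact.
Proof.
have [[pl pr] pA] := pure_balanced (bimod_r N) L.
have lin1 b : linear (tens_lact b) by exact: tlift_linear.
have lincomb (c : k) (f g : T -> T) : linear f -> linear g ->
    linear (fun w => c *: f w + g w).
  move=> fl gl d u v; rewrite fl gl !scalerDr !scalerA mulrC.
  by rewrite addrACA.
split=> [b|w c a b|w|w a b]; first exact: lin1.
- move: w; apply: tens_ext; [exact: lin1 | exact: lincomb |] => x n.
  by rewrite !tens_lactE (lact_linl (L := bimod_l N)) pl.
- move: w; apply: tens_ext; [exact: lin1 | by [] |] => x n.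
  by rewrite tens_lactE (lact1 (L := bimod_l N)).
move: w; apply: tens_ext; [exact: lin1 | by move=> d u v; rewrite !lin1 |] => x n.
by rewrite !tens_lactE (lactM (L := bimod_l N)).
Qed.
End Left.

Section Bi.
Variables (A B C : falgType k) (N : bimod A B) (M : bimod B C).

Fact tens_bactA (a : A) (w : tens (bimod_r N) (bimod_l M)) (c : C) :
  tens_ract (tens_lact a w) c = tens_lact a (tens_ract w c).
Proof.
have linr b : linear (fun w : tens (bimod_r N) (bimod_l M) => tens_ract w b).
  exact: tlift_linear.
have linl b : linear (@tens_lact _ _ N (bimod_l M) b) by exact: tlift_linear.
move: w; apply: tens_ext; try by move=> d u v; rewrite !(linr, linl).
by move=> n m; rewrite tens_lactE !tens_ractE tens_lactE.
Qed.

Definition tens_bimod : bimod A C :=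
  BiMod (@tens_lactP _ _ N (bimod_l M)) (@tens_ractP _ _ (bimod_r N) M) tens_bactA.
End Bi.

Definition bimod_hom (A B : falgType k) (N N' : bimod A B) (g : 'Hom(N, N')) : Prop :=
  (forall a x, g (blact a x) = blact a (g x)) /\
  (forall x b, g (bract x b) = bract (g x) b).

End TensorModules.

(* For a multiplicative linear map i : A -> L with i 1 = e, the A-L-bimodule eL
   and, for a right L-module W, the right A-module We. *)
Section Corner.
Variables (A L : falgType k) (i : A -> L).
Hypotheses (i_lin : linear i) (iM : {morph i : x y / x * y}).

Definition ideal_space : {vspace L} := limg (amull (i 1)).

Lemma ideal_mem (x : L) : x \in ideal_space <-> i 1 * x = x.
Proof.
split=> [/memv_imgP[y _ ->]|<-]; first by rewrite lfunE /= mulrA -iM mulr1.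
by apply/memv_imgP; exists x; rewrite ?memvf // lfunE.
Qed.

Lemma ideal_memL (a : A) (x : L) : i a * x \in ideal_space.
Proof. by apply/ideal_mem; rewrite mulrA -iM mul1r. Qed.

Lemma ideal_memR (x : L) (b : L) : x \in ideal_space -> x * b \in ideal_space.
Proof. by move=> /ideal_mem ex; apply/ideal_mem; rewrite mulrA ex. Qed.

Fact corner_ideal_lact : left_action (fun (a : A) (x : subvs_of ideal_space) =>
  vsproj ideal_space (i a * vsval x)).
Proof.
split=> [c d x y|x d b c|x|x b c]; apply: val_inj => /=.
- by rewrite !vsprojK ?ideal_memL // mulrDr scalerAr.
- by rewrite !vsprojK ?ideal_memL // i_lin mulrDl scalerAl.
- by rewrite vsprojK ?ideal_memL //; exact/ideal_mem/subvsP.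
by rewrite !vsprojK ?ideal_memL // iM mulrA.
Qed.

Fact corner_ideal_ract : right_action (fun (x : subvs_of ideal_space) (b : L) =>
  vsproj ideal_space (vsval x * b)).
Proof.
split=> [b c x y|x c a b|x|x a b]; apply: val_inj => /=.
- rewrite !vsprojK ?ideal_memR ?rpredD ?rpredZ ?subvsP //.
  by rewrite mulrDl scalerAl.
- by rewrite !vsprojK ?ideal_memR ?subvsP // mulrDr scalerAr.
- by rewrite vsprojK ?ideal_memR ?subvsP // mulr1.
by rewrite !vsprojK ?ideal_memR ?subvsP // mulrA.
Qed.

Fact corner_ideal_subproof (a : A) (x : subvs_of ideal_space) (b : L) :
  vsproj ideal_space (vsval (vsproj ideal_space (i a * vsval x)) * b) =
  vsproj ideal_space (i a * vsval (vsproj ideal_space (vsval x * b))).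
Proof. by congr vsproj; rewrite !vsprojK ?ideal_memL ?ideal_memR ?subvsP // mulrA. Qed.

Definition corner_ideal : bimod A L :=
  BiMod corner_ideal_lact corner_ideal_ract corner_ideal_subproof.

Variable W : rmod L.

Definition corner_space : {vspace W} := limg (linfun (fun w : W => ract w (i 1))).

Lemma corner_mem (w : W) : w \in corner_space <-> ract w (i 1) = w.
Proof.
have El := linfunE (@ract_linl _ W (i 1)).
split=> [/memv_imgP[y _ ->]|<-]; first by rewrite El -ractM -iM mulr1.
by apply/memv_imgP; exists w; rewrite ?memvf // El.
Qed.

Lemma corner_mem_ract (w : W) (a : A) : ract w (i a) \in corner_space.
Proof. by apply/corner_mem; rewrite -ractM -iM mulr1. Qed.

Fact corner_subproof : right_action (fun (w : subvs_of corner_space) (a : A) =>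
  vsproj corner_space (ract (vsval w) (i a))).
Proof.
split=> [b c x y|x c a b|x|x a b]; apply: val_inj => /=.
- by rewrite !vsprojK ?corner_mem_ract // ract_linl.
- by rewrite !vsprojK ?corner_mem_ract // i_lin ract_linr.
- by rewrite vsprojK ?corner_mem_ract //; exact/corner_mem/subvsP.
by rewrite !vsprojK ?corner_mem_ract // iM ractM.
Qed.

Definition corner : rmod A := RMod corner_subproof.

End Corner.

Record morita_context (A B : falgType k) := MoritaContext {
  mcN : bimod A B;
  mcM : bimod B A;
  mc_phi : 'Hom(tens_bimod mcN mcM, regular_bimod A);
  mc_psi : 'Hom(tens_bimod mcM mcN, regular_bimod B);
  mc_phi_hom : bimod_hom mc_phi;
  mc_psi_hom : bimod_hom mc_psi;
  mc_phiA : forall (n : mcN) (m : mcM) (n' : mcN),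
    blact (mc_phi (pure n m)) n' = bract n (mc_psi (pure m n'));
  mc_psiA : forall (m : mcM) (n : mcN) (m' : mcM),
    bract m (mc_phi (pure n m')) = blact (mc_psi (pure m n)) m' }.

(* ((a, n), (m, b)) stands for the matrix with rows (a, n) and (m, b). *)
Definition morita_alg (A B : falgType k) (C : morita_context A B) : Type :=
  ((A * mcN C) * (mcM C * B))%type.
End Modules.

Section MoritaAlgebra.
Variables (k : fieldType) (A B : falgType k) (C : morita_context A B).
Local Notation N := (mcN C).
Local Notation M := (mcM C).
Local Notation L := (morita_alg C).

HB.instance Definition _ := Vector.on L.

Definition morita_one : L := ((1, 0), (0, 1)).

Definition morita_mul (x y : L) : L :=
  let: ((a, n), (m, b)) := x in
  let: ((a', n'), (m', b')) := y in
  ((a * a' + mc_phi C (pure n m'), blact a n' + bract n b'),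
   (bract m a' + blact b m', mc_psi C (pure m n') + b * b')).


Let purePhi := pure_balanced (bimod_r N) (bimod_l M).
Let purePsi := pure_balanced (bimod_r M) (bimod_l N).

Let phiDl (n n' : N) (m : M) :
  mc_phi C (pure (n + n') m) = mc_phi C (pure n m) + mc_phi C (pure n' m).
Proof. by have [[pl _] _] := purePhi; rewrite (linD (pl m)) linearD. Qed.
Let phiDr (n : N) (m m' : M) :
  mc_phi C (pure n (m + m')) = mc_phi C (pure n m) + mc_phi C (pure n m').
Proof. by have [[_ pr] _] := purePhi; rewrite (linD (pr n)) linearD. Qed.
Let phiZl c (n : N) (m : M) : mc_phi C (pure (c *: n) m) = c *: mc_phi C (pure n m).
Proof. by have [[pl _] _] := purePhi; rewrite (linZ _ (pl m)) linearZ. Qed.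
Let phiZr c (n : N) (m : M) : mc_phi C (pure n (c *: m)) = c *: mc_phi C (pure n m).
Proof. by have [[_ pr] _] := purePhi; rewrite (linZ _ (pr n)) linearZ. Qed.
Let phi0l (m : M) : mc_phi C (pure (0 : N) m) = 0.
Proof. by rewrite -[0 : N](scale0r 0) phiZl scale0r. Qed.
Let phi0r (n : N) : mc_phi C (pure n (0 : M)) = 0.
Proof. by rewrite -[0 : M](scale0r 0) phiZr scale0r. Qed.
Let phiL a (n : N) (m : M) : mc_phi C (pure (blact a n) m) = a * mc_phi C (pure n m).
Proof.
by case: (mc_phi_hom C) => h _; rewrite -[RHS](h a (pure n m)) /= (tens_lactE a n m).
Qed.
Let phiR (n : N) (m : M) a : mc_phi C (pure n (bract m a)) = mc_phi C (pure n m) * a.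
Proof.
by case: (mc_phi_hom C) => _ h; rewrite -[RHS](h (pure n m) a) /= (tens_ractE n m a).
Qed.
Let phiB (n : N) b (m : M) : mc_phi C (pure (bract n b) m) = mc_phi C (pure n (blact b m)).
Proof. by case: purePhi => _ /(_ n b m) /= ->. Qed.

Let psiDl (m m' : M) (n : N) :
  mc_psi C (pure (m + m') n) = mc_psi C (pure m n) + mc_psi C (pure m' n).
Proof. by have [[pl _] _] := purePsi; rewrite (linD (pl n)) linearD. Qed.
Let psiDr (m : M) (n n' : N) :
  mc_psi C (pure m (n + n')) = mc_psi C (pure m n) + mc_psi C (pure m n').
Proof. by have [[_ pr] _] := purePsi; rewrite (linD (pr m)) linearD. Qed.
Let psiZl c (m : M) (n : N) : mc_psi C (pure (c *: m) n) = c *: mc_psi C (pure m n).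
Proof. by have [[pl _] _] := purePsi; rewrite (linZ _ (pl n)) linearZ. Qed.
Let psiZr c (m : M) (n : N) : mc_psi C (pure m (c *: n)) = c *: mc_psi C (pure m n).
Proof. by have [[_ pr] _] := purePsi; rewrite (linZ _ (pr m)) linearZ. Qed.
Let psi0l (n : N) : mc_psi C (pure (0 : M) n) = 0.
Proof. by rewrite -[0 : M](scale0r 0) psiZl scale0r. Qed.
Let psi0r (m : M) : mc_psi C (pure m (0 : N)) = 0.
Proof. by rewrite -[0 : N](scale0r 0) psiZr scale0r. Qed.
Let psiL b (m : M) (n : N) : mc_psi C (pure (blact b m) n) = b * mc_psi C (pure m n).
Proof.
by case: (mc_psi_hom C) => h _; rewrite -[RHS](h b (pure m n)) /= (tens_lactE b m n).
Qed.
Let psiR (m : M) (n : N) b : mc_psi C (pure m (bract n b)) = mc_psi C (pure m n) * b.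
Proof.
by case: (mc_psi_hom C) => _ h; rewrite -[RHS](h (pure m n) b) /= (tens_ractE m n b).
Qed.
Let psiA (m : M) a (n : N) : mc_psi C (pure (bract m a) n) = mc_psi C (pure m (blact a n)).
Proof. by case: purePsi => _ /(_ m a n) /= ->. Qed.

Section BimodTheory.
Variables (P Q : falgType k) (V : bimod P Q).
Let blD a (x y : V) : blact a (x + y) = blact a x + blact a y.
Proof. exact: (linD (@lact_linr _ _ (bimod_l V) a)). Qed.
Let blDa a b (x : V) : blact (a + b) x = blact a x + blact b x.
Proof. exact: (linD (@lact_linl _ _ (bimod_l V) x)). Qed.
Let blZ a c (x : V) : blact a (c *: x) = c *: blact a x.
Proof. exact: (linZ _ (@lact_linr _ _ (bimod_l V) a)). Qed.
Let blZa a c (x : V) : blact (c *: a) x = c *: blact a x.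
Proof. exact: (linZ _ (@lact_linl _ _ (bimod_l V) x)). Qed.
Let bl0 a : blact a 0 = 0 :> V.
Proof. exact: (lin0 (@lact_linr _ _ (bimod_l V) a)). Qed.
Let bl0a (x : V) : blact 0 x = 0.
Proof. exact: (lin0 (@lact_linl _ _ (bimod_l V) x)). Qed.
Let bl1 (x : V) : blact 1 x = x.
Proof. exact: (lact1 (L := bimod_l V)). Qed.
Let blM (x : V) a b : blact (a * b) x = blact a (blact b x).
Proof. exact: (lactM (L := bimod_l V)). Qed.
Let brD a (x y : V) : bract (x + y) a = bract x a + bract y a.
Proof. exact: (linD (@ract_linl _ _ (bimod_r V) a)). Qed.
Let brDa a b (x : V) : bract x (a + b) = bract x a + bract x b.
Proof. exact: (linD (@ract_linr _ _ (bimod_r V) x)). Qed.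
Let brZ a c (x : V) : bract (c *: x) a = c *: bract x a.
Proof. exact: (linZ _ (@ract_linl _ _ (bimod_r V) a)). Qed.
Let brZa a c (x : V) : bract x (c *: a) = c *: bract x a.
Proof. exact: (linZ _ (@ract_linr _ _ (bimod_r V) x)). Qed.
Let br0 a : bract 0 a = 0 :> V.
Proof. exact: (lin0 (@ract_linl _ _ (bimod_r V) a)). Qed.
Let br0a (x : V) : bract x 0 = 0.
Proof. exact: (lin0 (@ract_linr _ _ (bimod_r V) x)). Qed.
Let br1 (x : V) : bract x 1 = x.
Proof. exact: (ract1 (V := bimod_r V)). Qed.
Let brM (x : V) a b : bract x (a * b) = bract (bract x a) b.
Proof. exact: (ractM (V := bimod_r V)). Qed.

Definition bactD := (blD, blDa, brD, brDa).
Definition bactZ := (blZ, blZa, brZ, brZa).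
Definition bact0 := (bl0, bl0a, br0, br0a).
Definition bact1 := (bl1, br1).
Definition bactM := (blM, brM).
End BimodTheory.

Let mcD := (phiDl, phiDr, psiDl, psiDr).
Let mcZ := (phiZl, phiZr, psiZl, psiZr).
Let mc0 := (phi0l, phi0r, psi0l, psi0r).
Let mcM' := (phiL, phiR, psiL, psiR, phiB, psiA).

Lemma morita_eq (a a' : A) (n n' : N) (m m' : M) (b b' : B) :
  a = a' -> n = n' -> m = m' -> b = b' ->
  ((a, n), (m, b)) = ((a', n'), (m', b')) :> L.
Proof. by move=> -> -> -> ->. Qed.

Fact morita_mulA : associative morita_mul.
Proof.
move=> [[a n] [m b]] [[a' n'] [m' b']] [[a'' n''] [m'' b'']] /=.
apply: morita_eq.
- by rewrite !mcD !mcM' mulrDl mulrDr !mulrA !addrA; congr (_ + _); rewrite addrAC.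
- by rewrite !bactD !bactM !mc_phiA !bactA !addrA; congr (_ + _); rewrite addrAC.
- by rewrite !bactD !bactM !mc_psiA !bactA !addrA; congr (_ + _); rewrite addrAC.
by rewrite !mcD !mcM' mulrDl mulrDr !mulrA !addrA; congr (_ + _); rewrite addrAC.
Qed.

Fact morita_mul1l : left_id morita_one morita_mul.
Proof.
move=> [[a n] [m b]]; apply: morita_eq;
by rewrite ?mc0 ?bact0 ?bact1 ?mul1r ?addr0 ?add0r.
Qed.

Fact morita_mul1r : right_id morita_one morita_mul.
Proof.
move=> [[a n] [m b]]; apply: morita_eq;
by rewrite ?mc0 ?bact0 ?bact1 ?mulr1 ?addr0 ?add0r.
Qed.

Fact morita_mulDl : left_distributive morita_mul +%R.
Proof.
move=> [[a n] [m b]] [[a' n'] [m' b']] [[a'' n''] [m'' b'']] /=.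
by apply: morita_eq; rewrite ?mcD ?bactD ?mulrDl addrACA.
Qed.

Fact morita_mulDr : right_distributive morita_mul +%R.
Proof.
move=> [[a n] [m b]] [[a' n'] [m' b']] [[a'' n''] [m'' b'']] /=.
by apply: morita_eq; rewrite ?mcD ?bactD ?mulrDr addrACA.
Qed.

Fact morita_one_neq0 : morita_one != 0.
Proof.
apply/eqP => /(congr1 (fun x : L => x.1.1)) E.
by case/eqP: (oner_neq0 A); exact: E.
Qed.

HB.instance Definition _ := GRing.Zmodule_isNzRing.Build L
  morita_mulA morita_mul1l morita_mul1r morita_mulDl morita_mulDr morita_one_neq0.

Fact morita_scaleAl (c : k) (x y : L) : c *: (x * y) = (c *: x) * y.
Proof.
case: x y => [[a n] [m b]] [[a' n'] [m' b']].
by apply: morita_eq; rewrite ?mcZ ?bactZ -?scalerAl -scalerDr.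
Qed.

HB.instance Definition _ := GRing.Lmodule_isLalgebra.Build k L morita_scaleAl.

Fact morita_scaleAr (c : k) (x y : L) : c *: (x * y) = x * (c *: y).
Proof.
case: x y => [[a n] [m b]] [[a' n'] [m' b']].
by apply: morita_eq; rewrite ?mcZ ?bactZ -?scalerAr -scalerDr.
Qed.

HB.instance Definition _ := GRing.Lalgebra_isAlgebra.Build k L morita_scaleAr.
HB.instance Definition _ := Algebra_isFalgebra.Build k L.

(* The diagonal embeddings; their values at 1 are the idempotents e and f. *)
Definition morita_inA (a : A) : L := ((a, 0), (0, 0)).
Definition morita_inB (b : B) : L := ((0, 0), (0, b)).

Fact morita_inA_lin : linear morita_inA.
Proof. by move=> c a a'; apply: morita_eq => //=; rewrite scaler0 addr0. Qed.
Fact morita_inB_lin : linear morita_inB.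
Proof. by move=> c b b'; apply: morita_eq => //=; rewrite scaler0 addr0. Qed.
Fact morita_inAM : {morph morita_inA : x y / x * y}.
Proof. by move=> a a'; apply: morita_eq; rewrite ?mc0 ?bact0 ?mulr0 ?addr0. Qed.
Fact morita_inBM : {morph morita_inB : x y / x * y}.
Proof. by move=> b b'; apply: morita_eq; rewrite ?mc0 ?bact0 ?mulr0 ?add0r. Qed.

Definition e_ideal : bimod A L := corner_ideal morita_inA_lin morita_inAM.
Definition f_ideal : bimod B L := corner_ideal morita_inB_lin morita_inBM.

Definition F_A (X : rmod A) : rmod L := tens_rmod X e_ideal.
Definition F_B (Y : rmod B) : rmod L := tens_rmod Y f_ideal.

Definition corner_e (W : rmod L) : rmod A := corner morita_inA_lin morita_inAM W.
Definition corner_f (W : rmod L) : rmod B := corner morita_inB_lin morita_inBM W.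

(* The class T_{X,Y}. *)
Definition glued_class (X : rmod A) (Y : rmod B) (W : rmod L) : Prop :=
  Fac X (corner_e W) /\ Fac Y (corner_f W).

End MoritaAlgebra.

(* Main.v *)
(* A module T is tau-rigid if and only if Ext^1(T, Fac T) = 0: by a dual basis
   argument Hom(W, tau T) is dual to the cokernel of Hom(P0, W) -> Hom(P1, W), and
   for a minimal presentation this cokernel vanishes if and only if
   Ext^1(T, Fac W) = 0.  The functors F_A, F_B are left adjoint to the exact
   functors W |-> We, Wf, and the hypotheses say that Te is in Fac X and Tf is in
   Fac Y for T = F_A X + F_B Y; so Ext^1(T, Fac T) = 0, as well as the description
   of Fac T, follow by adjunction.

   The summands coming from A and from B may be isomorphic over Lambda, so the count
   |T| + |Q| = |Lambda| (for Q = F_A P + F_B P') is not obtained by adding the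
   counts for X and Y.  Instead, a presentation is recorded by the function
   W |-> dim Hom(P0, W) - dim Hom(P1, W), its g-vector.  On Fac T it agrees with
   dim Hom(T, -), and the functions dim Hom(T_i, -), for pairwise non-isomorphic
   indecomposable T_i, are independent on the modules generated by the T_i.
   Hence the g-vectors of the summands of a tau-rigid pair (T, Q) are independent
   in the span of the dim Hom(R, -) with R indecomposable projective, and the pair
   is support tau-tilting if and only if they span.  Spanning passes from the
   pairs (X, P) and (Y, P') to (T, Q), because F_A and F_B preserve
   indecomposability and minimal presentations. *)

Require Import Defs.
From HB Require Import structures.
From mathcomp Require Import all_boot all_order all_algebra all_field.
From mathcomp Require Import zify.
From Stdlib Require Import Classical ClassicalEpsilon.

Set Implicit Arguments.
Unset Strict Implicit.
Unset Printing Implicit Defensive.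

Import GRing.Theory Num.Theory.
Local Open Scope ring_scope.

(** F_A and F_B need not be exact, and the embeddings of A and B in Lambda do not preserve the unit.
    All transfers therefore run through the functors W |-> We, Wf and through the unit x |-> x (x) e
    of the adjunction, kept as a map into the whole induced module that is semilinear along A ->
    Lambda. The g-vectors take rational values because k may have any characteristic, and their
    independence is checked at T_i and a proper submodule of it because End(T_i)/rad may be larger
    than k, so that no normalisation of dim Hom(T_i, -) is available. *)

Lemma ex_min (P : nat -> Prop) :
  (exists n, P n) -> exists n, P n /\ forall m, P m -> (n <= m)%N.
Proof.
case=> n; elim/ltn_ind: n => n IH Pn.
have [[m [ltmn Pm]]|noless] := classic (exists m, (m < n)%N /\ P m).
  exact: IH Pm.
exists n; split=> // m Pm; rewrite leqNgt; apply/negP => ltmn.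
by apply: noless; exists m.
Qed.

Lemma ex_max (P : nat -> Prop) b :
  (exists n, P n) -> (forall n, P n -> (n <= b)%N) ->
  exists n, P n /\ forall m, P m -> (m <= n)%N.
Proof.
move=> [n0 Pn0] Pb.
have [|n [[m [Pm ->]] nmin]] := @ex_min (fun n => exists m, P m /\ n = (b - m)%N).
  by exists (b - n0)%N, n0.
exists m; split=> // l Pl; have := nmin _ (ex_intro _ l (conj Pl erefl)).
by rewrite leq_sub2lE ?Pb.
Qed.

(** * Linear algebra *)

Section LinearAlgebra.
Variable k : fieldType.
Implicit Types U V W : vectType k.

(** A subspace of maximal dimension among those contained in [P] exhausts [P], since a further
    vector of [P] would enlarge it. This turns conditions on linear maps, such as [rhom] or not
    being bijective, into subspaces with a dimension. *)
Lemma ex_vspace V (P : V -> Prop) :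
    P 0 -> (forall a x y, P x -> P y -> P (a *: x + y)) ->
  {S : {vspace V} | forall x, x \in S <-> P x}.
Proof.
move=> P0 Plin; apply: constructive_indefinite_description.
pose Q n := exists S : {vspace V}, (forall x, x \in S -> P x) /\ \dim S = n.
have [|n [S QS]|n [[S [SP dS]] nmax]] := @ex_max Q (\dim {:V}).
- by exists 0%N, 0%VS; split=> [x|]; rewrite ?dimv0 // memv0 => /eqP->.
- by case: QS => _ <-; rewrite dimvS ?subvf.
exists S => x; split; first exact: SP.
move=> Px; apply: contraT => xS.
have /nmax : Q (\dim (<[x]> + S)%VS).
  exists (<[x]> + S)%VS; split=> // y /memv_addP[_ /vlineP[a ->] [s sS ->]].
  by apply: Plin => //; exact: SP.
rewrite -dS leqNgt => /negP[]; rewrite (ltn_leqif (dimv_leqif_sup _)) ?addvSr //.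
by apply: contra xS => /subvP; apply; exact: subvP (addvSl _ _) _ (memv_line _).
Qed.

Lemma lker_trivP V W (f : 'Hom(V, W)) :
  (forall x, f x = 0 -> x = 0) <-> lker f = 0%VS.
Proof.
split=> [f0 | kf x fx]; first apply/eqP.
  rewrite -subv0; apply/subvP => x; rewrite memv_ker memv0.
  by move=> /eqP/f0/eqP.
by apply/eqP; rewrite -memv0 -kf memv_ker fx.
Qed.

Lemma limg_fullP V W (f : 'Hom(V, W)) :
  (forall y, exists x, y = f x) <-> limg f = fullv.
Proof.
split=> [fs | lf y].
  by apply/vspaceP => y; have [x ->] := fs y; rewrite memv_img ?memvf.
have : y \in limg f by rewrite lf memvf.
by case/memv_imgP => x _ ->; exists x.
Qed.

Definition lbij V W (f : 'Hom(V, W)) := lker f = 0%VS /\ limg f = fullv.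

Lemma lbij_inv V W (f : 'Hom(V, W)) : lbij f ->
  cancel f (f^-1)%VF /\ cancel (f^-1)%VF f.
Proof.
move=> [kf lf]; split; first by apply: lker0_lfunK; rewrite kf.
by move=> y; apply: limg_lfunVK; rewrite lf memvf.
Qed.

Lemma lbij_of_cancel V W (f : 'Hom(V, W)) (g : W -> V) :
  cancel f g -> cancel g f -> lbij f.
Proof.
move=> fK gK; split.
  by apply/lker_trivP => x fx; rewrite -(fK x) fx -(fK 0) linear0.
by apply/limg_fullP => y; exists (g y).
Qed.

Lemma lbij_comp U V W (f : 'Hom(V, W)) (g : 'Hom(U, V)) :
  lbij f -> lbij g -> lbij (f \o g)%VF.
Proof.
move=> /lbij_inv[fK fVK] /lbij_inv[gK gVK].
apply: (@lbij_of_cancel _ _ _ (g^-1 \o f^-1)%VF) => x; rewrite !comp_lfunE.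
  by rewrite fK gK.
by rewrite gVK fVK.
Qed.

Lemma lbij_endo_inj V (f : 'Hom(V, V)) : lker f = 0%VS -> lbij f.
Proof.
move=> kf; split=> //; apply/eqP.
by rewrite eqEdim subvf /= limg_dim_eq // kf capv0.
Qed.

Lemma lbij_endo_surj V (f : 'Hom(V, V)) : limg f = fullv -> lbij f.
Proof.
move=> lf; split=> //; apply/eqP; rewrite -dimv_eq0.
have := limg_ker_dim f fullv; rewrite lf capfv => /eqP.
by rewrite -[X in _ == X]add0n eqn_add2r.
Qed.

Lemma dimv_inj V W (f : V -> W) (S : {vspace V}) (S' : {vspace W}) :
    linear f -> (forall x, x \in S -> f x \in S') ->
    (forall x, x \in S -> f x = 0 -> x = 0) -> (\dim S <= \dim S')%N.
Proof.
move=> fl fS f0; rewrite -(@limg_dim_eq _ _ _ (linfun f) S).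
  apply: dimvS; apply/subvP => _ /memv_imgP[x xS ->].
  by rewrite (linfunE fl) fS.
apply/eqP; rewrite -subv0; apply/subvP => x; rewrite memv_cap memv_ker memv0.
by rewrite (linfunE fl) => /andP[xS /eqP/(f0 _ xS)->].
Qed.

End LinearAlgebra.

(** * Modules, direct sums, submodules and quotients *)

Section ModuleBasics.
Variables (k : fieldType) (A : falgType k).
Implicit Types T U V W P : rmod A.

Lemma rhom_id U : rhom (\1%VF : 'Hom(U, U)).
Proof. by move=> x a; rewrite !lfunE. Qed.

Lemma rhom_comp U V W (f : 'Hom(V, W)) (g : 'Hom(U, V)) :
  rhom f -> rhom g -> rhom (f \o g)%VF.
Proof. by move=> fh gh x a; rewrite !comp_lfunE gh fh. Qed.

Lemma rhom0 U V : rhom (0 : 'Hom(U, V)).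
Proof. by move=> x a; rewrite !lfunE /= (lin0 (ract_linl a)). Qed.

Lemma rhomP U V a (f g : 'Hom(U, V)) : rhom f -> rhom g -> rhom (a *: f + g).
Proof.
move=> fh gh x b; rewrite !add_lfunE !scale_lfunE fh gh.
by rewrite (linD (ract_linl b)) (linZ _ (ract_linl b)).
Qed.

Lemma rhomD U V (f g : 'Hom(U, V)) : rhom f -> rhom g -> rhom (f + g).
Proof. by move=> fh gh; rewrite -[f]scale1r; exact: rhomP. Qed.

Lemma rhomB U V (f g : 'Hom(U, V)) : rhom f -> rhom g -> rhom (f - g).
Proof. by move=> fh gh; rewrite addrC -[- g]scaleN1r; exact: rhomP. Qed.

Lemma rhom_sum U V I (r : seq I) (Q : pred I) (F : I -> 'Hom(U, V)) :
  (forall i, Q i -> rhom (F i)) -> rhom (\sum_(i <- r | Q i) F i).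
Proof. move=> Fh; elim/big_rec: _ => [|i f /Fh]; [exact: rhom0 | exact: rhomD]. Qed.

Definition hom_space U V : {vspace 'Hom(U, V)} :=
  sval (ex_vspace (@rhom0 U V) (@rhomP U V)).

Lemma hom_spaceP U V (f : 'Hom(U, V)) : f \in hom_space U V <-> rhom f.
Proof. exact: svalP (ex_vspace (@rhom0 U V) (@rhomP U V)) f. Qed.

Lemma rhom_inv U V (f : 'Hom(U, V)) : rhom f -> lbij f -> rhom (f^-1)%VF.
Proof.
move=> fh /lbij_inv[fK fVK] x a.
by rewrite -{1}[x]fVK -fh fK.
Qed.

Lemma riso_sym U V : riso U V -> riso V U.
Proof.
case=> f fh fb; exists (f^-1)%VF; first exact: rhom_inv.
by have [fK fVK] := lbij_inv fb; apply: lbij_of_cancel fVK fK.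
Qed.

Lemma riso_trans V U W : riso U V -> riso V W -> riso U W.
Proof.
case=> f fh fb [g gh gb]; exists (g \o f)%VF; first exact: rhom_comp.
exact: lbij_comp.
Qed.

Lemma riso_refl U : riso U U.
Proof.
exists \1%VF; first exact: rhom_id.
by apply: (@lbij_of_cancel _ _ _ _ id) => x; rewrite lfunE.
Qed.

(** A split embedding: a direct summand whose complement is left unnamed, so that it composes more
    easily than [summand]. *)
Definition retract U V :=
  exists i : 'Hom(U, V), exists2 r : 'Hom(V, U), rhom i /\ rhom r & cancel i r.

Lemma retract_riso U V : riso U V -> retract U V.
Proof.
case=> f fh fb; exists f, (f^-1)%VF; first by split=> //; exact: rhom_inv.
by have [] := lbij_inv fb.
Qed.

Lemma retract_refl U : retract U U.
Proof. exact: retract_riso (riso_refl U). Qed.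

Lemma retract_trans V U W : retract U V -> retract V W -> retract U W.
Proof.
move=> [i [r [ih rh] ir]] [j [s [jh sh] js]].
exists (j \o i)%VF, (r \o s)%VF; first by split; exact: rhom_comp.
by move=> x; rewrite !comp_lfunE /= js ir.
Qed.

Section DirectSum.
Variables U V : rmod A.

Definition in1 : 'Hom(U, dsum U V) := linfun (fun x : U => (x, 0) : dsum U V).
Definition in2 : 'Hom(V, dsum U V) := linfun (fun x : V => (0, x) : dsum U V).
Definition pr1 : 'Hom(dsum U V, U) := linfun (fun x : dsum U V => x.1 : U).
Definition pr2 : 'Hom(dsum U V, V) := linfun (fun x : dsum U V => x.2 : V).

Lemma in1E x : in1 x = (x, 0).
Proof.
apply: (linfunE (V := U)) => a y z.
by change ((a *: y + z, 0 : V) = (a *: y + z, a *: 0 + 0)); rewrite scaler0 addr0.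
Qed.
Lemma in2E x : in2 x = (0, x).
Proof.
apply: (linfunE (V := V)) => a y z.
by change ((0 : U, a *: y + z) = (a *: 0 + 0, a *: y + z)); rewrite scaler0 addr0.
Qed.
Lemma pr1E x : pr1 x = x.1. Proof. exact: (linfunE (V := dsum U V)). Qed.
Lemma pr2E x : pr2 x = x.2. Proof. exact: (linfunE (V := dsum U V)). Qed.

Lemma in1_hom : rhom in1.
Proof. by move=> x a; rewrite !in1E /= (lin0 (ract_linl a)). Qed.
Lemma in2_hom : rhom in2.
Proof. by move=> x a; rewrite !in2E /= (lin0 (ract_linl a)). Qed.
Lemma pr1_hom : rhom pr1. Proof. by move=> x a; rewrite !pr1E. Qed.
Lemma pr2_hom : rhom pr2. Proof. by move=> x a; rewrite !pr2E. Qed.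

Lemma dsum_split (x : dsum U V) : x = in1 x.1 + in2 x.2.
Proof. by rewrite in1E in2E; case: x => a b /=; congr pair; rewrite ?addr0 ?add0r. Qed.

Definition dsum_pair W (f : 'Hom(W, U)) (g : 'Hom(W, V)) : 'Hom(W, dsum U V) :=
  linfun (fun w : W => (f w, g w) : dsum U V).
Lemma dsum_pairE W (f : 'Hom(W, U)) (g : 'Hom(W, V)) w :
  dsum_pair f g w = (f w, g w).
Proof.
apply: (linfunE (V := W)) => a y z.
by change ((f (a *: y + z), g (a *: y + z)) = (a *: f y + f z, a *: g y + g z));
  rewrite !linearP.
Qed.
Lemma dsum_pair_hom W (f : 'Hom(W, U)) (g : 'Hom(W, V)) :
  rhom f -> rhom g -> rhom (dsum_pair f g).
Proof. by move=> fh gh w a; rewrite !dsum_pairE fh gh. Qed.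

Definition copair W (f : 'Hom(U, W)) (g : 'Hom(V, W)) : 'Hom(dsum U V, W) :=
  ((f \o pr1) + (g \o pr2))%VF.
Lemma copairE W (f : 'Hom(U, W)) (g : 'Hom(V, W)) x : copair f g x = f x.1 + g x.2.
Proof. by rewrite add_lfunE !comp_lfunE /= pr1E pr2E. Qed.
Lemma copair_hom W (f : 'Hom(U, W)) (g : 'Hom(V, W)) :
  rhom f -> rhom g -> rhom (copair f g).
Proof.
by move=> fh gh; apply: rhomD; apply: rhom_comp => //;
  [exact: pr1_hom | exact: pr2_hom].
Qed.

Lemma retract_dsum1 : retract U (dsum U V).
Proof.
by exists in1, pr1 => [|x]; rewrite ?pr1E ?in1E //; split; [exact: in1_hom|exact: pr1_hom].
Qed.
Lemma retract_dsum2 : retract V (dsum U V).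
Proof.
by exists in2, pr2 => [|x]; rewrite ?pr2E ?in2E //; split; [exact: in2_hom|exact: pr2_hom].
Qed.
End DirectSum.

Section Power.
Variables (U : rmod A) (n : nat).
Definition dpow_in (i : 'I_n) : 'Hom(U, dpow U n) :=
  linfun (fun x : U => [ffun j => if j == i then x else 0] : dpow U n).
Definition dpow_pr (i : 'I_n) : 'Hom(dpow U n, U) :=
  linfun (fun x : dpow U n => x i : U).

Lemma dpow_inE i x : dpow_in i x = [ffun j => if j == i then x else 0].
Proof.
apply: (linfunE (V := U)) => a y z; apply/ffunP=> j; rewrite !ffunE.
by case: eqP => _; rewrite ?scaler0 ?addr0.
Qed.
Lemma dpow_prE i x : dpow_pr i x = x i.
Proof. by apply: (linfunE (V := dpow U n)) => a y z; rewrite !ffunE. Qed.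
Lemma dpow_in_hom i : rhom (dpow_in i).
Proof.
move=> x a; rewrite !dpow_inE; apply/ffunP=> j; rewrite !ffunE.
by case: eqP => // _; rewrite (lin0 (ract_linl a)).
Qed.
Lemma dpow_pr_hom i : rhom (dpow_pr i).
Proof. by move=> x a; rewrite !dpow_prE ffunE. Qed.
Lemma dpow_split (x : dpow U n) : x = \sum_i dpow_in i (x i).
Proof.
apply/ffunP => j; rewrite sum_ffunE (bigD1 j) //= dpow_inE ffunE eqxx big1 ?addr0 // => i.
by move=> /negPf nij; rewrite dpow_inE ffunE eq_sym nij.
Qed.

Definition dpow_copair W (f : 'I_n -> 'Hom(U, W)) : 'Hom(dpow U n, W) :=
  (\sum_i (f i \o dpow_pr i))%VF.
Lemma dpow_copairE W (f : 'I_n -> 'Hom(U, W)) x :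
  dpow_copair f x = \sum_i f i (x i).
Proof. by rewrite sum_lfunE; apply: eq_bigr => i _; rewrite comp_lfunE /= dpow_prE. Qed.
Lemma dpow_copair_hom W (f : 'I_n -> 'Hom(U, W)) :
  (forall i, rhom (f i)) -> rhom (dpow_copair f).
Proof.
move=> fh; apply: rhom_sum => i _; apply: rhom_comp => //; exact: dpow_pr_hom.
Qed.
End Power.

Section Sub.
Variables (U : rmod A) (S : {vspace U}) (HS : submodule S).

Fact submod_subproof : right_action (fun (x : subvs_of S) (a : A) =>
  vsproj S (ract (vsval x) a)).
Proof.
have m (x : subvs_of S) a : ract (vsval x) a \in S by apply: HS; exact: subvsP.
split=> [b c x y|x c a b|x|x a b]; apply: val_inj => /=.
- by rewrite !vsprojK ?m ?HS ?rpredD ?rpredZ ?subvsP // ract_linl.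
- by rewrite !vsprojK ?m // ract_linr.
- by rewrite vsprojK ?m // ract1.
by rewrite !vsprojK ?ractM ?HS ?m //; exact: subvsP.
Qed.
Definition submod : rmod A := RMod submod_subproof.

Definition sub_in : 'Hom(submod, U) := linfun (vsval : submod -> U).
Lemma sub_inE x : sub_in x = vsval x. Proof. by apply: linfunE => a y z; rewrite linearP.
  Qed.
Lemma sub_in_hom : rhom sub_in.
Proof.
by move=> x a; rewrite !sub_inE /= vsprojK //; apply: HS; exact: subvsP.
Qed.
Lemma sub_in_inj x : sub_in x = 0 -> x = 0.
Proof. by rewrite sub_inE => e; exact: val_inj. Qed.
Lemma sub_in_eq : injective sub_in.
Proof. by move=> x y; rewrite !sub_inE; exact: val_inj. Qed.
Lemma sub_in_mem x : sub_in x \in S.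
Proof. by rewrite sub_inE; exact: subvsP. Qed.
Lemma limg_sub_in : limg sub_in = S.
Proof.
apply/vspaceP => x; apply/memv_imgP/idP => [[y _ ->]|xS]; first exact: sub_in_mem.
by exists (vsproj S x); rewrite ?memvf // sub_inE vsprojK.
Qed.

Definition to_sub W (f : 'Hom(W, U)) : 'Hom(W, submod) :=
  linfun (fun w : W => vsproj S (f w) : submod).
Lemma to_subE W (f : 'Hom(W, U)) w : f w \in S -> sub_in (to_sub f w) = f w.
Proof.
move=> fS; rewrite sub_inE linfunE ?vsprojK //.
by move=> a y z; rewrite linearP (linearP (vsproj S)).
Qed.
Lemma to_sub_hom W (f : 'Hom(W, U)) :
  rhom f -> (forall w, f w \in S) -> rhom (to_sub f).
Proof.
move=> fh fS w a; apply: sub_in_eq.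
by rewrite sub_in_hom !to_subE // fh.
Qed.

Fact quotmod_subproof : right_action (fun (x : quot S) (a : A) =>
  qproj S (ract (vsval x) a)).
Proof.
split=> [a c q r|q c a b|q|q a b].
- by rewrite linearP ract_linl qproj_linear.
- by rewrite ract_linr qproj_linear.
- by rewrite ract1 qprojK.
rewrite ractM; apply/eqP; rewrite -subr_eq0 -(linB (@qproj_linear _ _ _)) qproj_eq0.
by rewrite -(linB (ract_linl _)) HS // qproj_val.
Qed.
Definition quotmod : rmod A := RMod quotmod_subproof.

Definition quot_pr : 'Hom(U, quotmod) := linfun (qproj S : U -> quotmod).
Lemma quot_prE x : quot_pr x = qproj S x. Proof. by apply: linfunE; exact: qproj_linear.
  Qed.
Lemma quot_pr_hom : rhom quot_pr.
Proof.
move=> x a; rewrite !quot_prE /=; apply/eqP.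
rewrite -subr_eq0 -(linB (@qproj_linear _ _ _)) qproj_eq0.
by rewrite -(linB (ract_linl _)) HS // qproj_val.
Qed.
Lemma quot_pr_eq0 x : (quot_pr x == 0) = (x \in S).
Proof. by rewrite quot_prE qproj_eq0. Qed.
Lemma quot_pr_surj y : exists x, y = quot_pr x.
Proof. by exists (vsval y); rewrite quot_prE qprojK. Qed.
End Sub.

Lemma submodule_ker U V (f : 'Hom(U, V)) : rhom f -> submodule (lker f).
Proof.
by move=> fh x a; rewrite !memv_ker fh => /eqP->; rewrite (lin0 (ract_linl a)).
Qed.
Lemma submodule_img U V (f : 'Hom(U, V)) (S : {vspace U}) :
  rhom f -> submodule S -> submodule (f @: S)%VS.
Proof. by move=> fh HS _ a /memv_imgP[x xS ->]; rewrite -fh memv_img // HS. Qed.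
Lemma submodule_full U : submodule (fullv : {vspace U}).
Proof. by move=> *; exact: memvf. Qed.
Lemma submodule_limg U V (f : 'Hom(U, V)) : rhom f -> submodule (limg f).
Proof. by move=> fh; apply: submodule_img => //; exact: submodule_full. Qed.
(** The complement is the kernel of [r], reached by x |-> x - i (r x). *)
Lemma split_riso U V (i : 'Hom(U, V)) (r : 'Hom(V, U)) :
  forall (ih : rhom i) (rh : rhom r), cancel i r ->
  riso V (dsum U (submod (submodule_ker rh))).
Proof.
move=> ih rh ir.
have kh : rhom (\1 - (i \o r))%VF.
  by apply: rhomB; [exact: rhom_id|exact: rhom_comp].
have kE x : (\1 - (i \o r))%VF x = x - i (r x).
  by rewrite add_lfunE opp_lfunE comp_lfunE /= id_lfunE.
have km x : (\1 - (i \o r))%VF x \in lker r.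
  by rewrite memv_ker kE linearB /= ir subrr.
pose t := to_sub (submodule_ker rh) (\1 - (i \o r))%VF.
have tE x : sub_in _ (t x) = x - i (r x) by rewrite to_subE // kE.
have fE x : dsum_pair r t x = (r x, t x) by exact: dsum_pairE.
exists (dsum_pair r t); first by apply: dsum_pair_hom => //; exact: to_sub_hom.
apply: (@lbij_of_cancel _ _ _ _ (fun y => i y.1 + sub_in _ y.2)) => [x|[x y]].
  by rewrite fE /= tE addrC subrK.
rewrite fE /=; have ry : r (sub_in (submodule_ker rh) y) = 0.
  by apply/eqP; rewrite -memv_ker sub_in_mem.
have rE : r (i x + sub_in (submodule_ker rh) y) = x by rewrite linearD /= ir ry addr0.
rewrite rE; congr pair; apply: (@sub_in_eq _ _ (submodule_ker rh)).
by rewrite tE rE addrAC subrr add0r.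
Qed.

Lemma summandP U T : summand U T <-> retract U T.
Proof.
split=> [[V /riso_sym/retract_riso]|[i [r [ih rh] ir]]].
  exact: retract_trans (retract_dsum1 U V).
by exists (submod (submodule_ker rh)); exact: split_riso.
Qed.

End ModuleBasics.

(** * The Krull-Schmidt theorem *)

Section KrullSchmidt.
Variables (k : fieldType) (A : falgType k).
Implicit Types R T U V W P : rmod A.

Definition fpow U (f : 'Hom(U, U)) n : 'Hom(U, U) := iter n (fun g => f \o g)%VF \1%VF.

Lemma fpowE U (f : 'Hom(U, U)) n x : fpow f n x = iter n f x.
Proof. by elim: n => [|n IH] /=; rewrite ?id_lfunE // comp_lfunE /= IH. Qed.

Lemma fpow_hom U (f : 'Hom(U, U)) n : rhom f -> rhom (fpow f n).
Proof. by move=> fh; elim: n => [|n IH] /=; [exact: rhom_id|exact: rhom_comp]. Qed.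

Lemma idem_retract U (p : 'Hom(U, U)) (ph : rhom p) :
  (forall x, p (p x) = p x) -> retract (submod (submodule_limg ph)) U.
Proof.
move=> pp; have m x : p x \in limg p by rewrite memv_img ?memvf.
exists (sub_in _), (to_sub _ p) => [|x].
  by split; [exact: sub_in_hom | exact: to_sub_hom].
apply: sub_in_eq; rewrite to_subE //.
by have /memv_imgP[y _ ->] := sub_in_mem x.
Qed.

(* p is the projection onto the stable image of f along its stable kernel. *)
Lemma fitting U (f : 'Hom(U, U)) : rhom f ->
  exists n, exists p : 'Hom(U, U),
    [/\ rhom p, forall x, p (p x) = p x, limg p = limg (fpow f n.+1)
      & forall x, p x = 0 -> fpow f n.+1 x = 0].
Proof.
move=> fh.
(* The exponent is kept positive so that a factor [f] can later be split off the stable power. *)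
have [|_ [[n ->] nmin]] := @ex_min (fun d => exists n, d = \dim (limg (fpow f n.+1))).
  by exists (\dim (limg (fpow f 1))), 0%N.
set F := fpow f n.+1; have Fh : rhom F by exact: fpow_hom.
have FF : (F @: limg F)%VS = limg F.
  apply/eqP; rewrite eqEdim limgS ?subvf //=.
  apply: leq_trans (nmin _ (ex_intro _ (n.+1 + n)%N erefl)) _; apply: dimvS.
  apply/subvP => _ /memv_imgP[x _ ->].
  by rewrite fpowE -addnS iterD -!fpowE -!/F !memv_img ?memvf.
have m x : F x \in limg F by rewrite memv_img ?memvf.
(* [F] maps its image onto itself, so it restricts to an automorphism [q] there; the projection
   sought is [q^-1] after [F]. *)
pose I := submod (submodule_limg Fh).
pose q : 'Hom(I, I) := to_sub _ (F \o sub_in (submodule_limg Fh))%VF.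
have qE x : sub_in _ (q x) = F (sub_in _ x) by rewrite to_subE comp_lfunE.
have qh : rhom q.
  apply: to_sub_hom => [|x]; last by rewrite comp_lfunE.
  by apply: rhom_comp => //; exact: sub_in_hom.
have qb : lbij q.
  apply: lbij_endo_surj; apply/limg_fullP => y.
  have : sub_in _ y \in (F @: limg F)%VS by rewrite FF sub_in_mem.
  case/memv_imgP => x xF e; exists (to_sub (submodule_limg Fh) \1%VF x).
  by apply: sub_in_eq; rewrite qE to_subE id_lfunE.
have [qK qVK] := lbij_inv qb.
exists n, (sub_in _ \o (q^-1 \o to_sub (submodule_limg Fh) F))%VF.
have tE x : sub_in _ (to_sub (submodule_limg Fh) F x) = F x by rewrite to_subE.
have pI (z : I) : to_sub (submodule_limg Fh) F (sub_in _ z) = q z.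
  by apply: sub_in_eq; rewrite tE qE.
split=> [|x||x].
- apply: rhom_comp; first exact: sub_in_hom.
  by apply: rhom_comp; [exact: rhom_inv|exact: to_sub_hom].
- by rewrite !comp_lfunE pI qK.
- apply/vspaceP => y; apply/memv_imgP/idP => [[x _ ->]|yF].
    by rewrite comp_lfunE sub_in_mem.
  exists y; rewrite ?memvf //.
  have -> : y = sub_in _ (to_sub (submodule_limg Fh) \1%VF y) by rewrite to_subE id_lfunE.
  by rewrite !comp_lfunE pI qK.
rewrite [X in X = _ -> _]comp_lfunE [X in sub_in _ X]comp_lfunE => /sub_in_inj/(congr1
  q); rewrite qVK linear0 => e.
by rewrite -/F -tE e linear0.
Qed.

Lemma indecomposable_nz U : indecomposable U -> exists x : U, x <> 0.
Proof. by case=> nz _; apply/not_all_ex_not. Qed.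

(** An idempotent splits [U] into its image and its kernel, one of which is zero. *)
Lemma indecomposable_idem U (p : 'Hom(U, U)) : indecomposable U ->
  rhom p -> (forall x, p (p x) = p x) -> (forall x, p x = 0) \/ (forall x, p x = x).
Proof.
move=> [_ Ui] ph pp; have m x : p x \in limg p by rewrite memv_img ?memvf.
have Hs := submodule_limg ph.
have rh : rhom (to_sub Hs p) by exact: to_sub_hom.
have pK : cancel (sub_in Hs) (to_sub Hs p).
  move=> x; apply: sub_in_eq; rewrite to_subE //.
  by have /memv_imgP[y _ ->] := sub_in_mem x.
case: (Ui _ _ (split_riso (@sub_in_hom _ _ _ _ Hs) rh pK)) => [z0|z0]; [left|right] => x.
  by rewrite -(to_subE Hs (m x)) [to_sub _ _ _]z0 linear0.
have xk : x - p x \in lker (to_sub Hs p).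
  by rewrite memv_ker; apply/eqP; apply: sub_in_eq; rewrite linear0; rewrite to_subE //
    linearB /= pp subrr.
have := z0 (to_sub (submodule_ker rh) (\1 - p)%VF x).
have E y : (\1 - p)%VF y = y - p y by rewrite add_lfunE opp_lfunE id_lfunE.
move/(congr1 (sub_in _)); rewrite to_subE E // linear0.
by move/eqP; rewrite subr_eq0 => /eqP.
Qed.

Lemma idem_indecomposable U : ~ zero_module U ->
  (forall p : 'Hom(U, U), rhom p -> (forall x, p (p x) = p x) ->
    (forall x, p x = 0) \/ (forall x, p x = x)) -> indecomposable U.
Proof.
move=> nz idem; split=> // V W [g gh gb].
have [gK gVK] := lbij_inv gb.
pose p := (g^-1 \o (in1 V W \o (pr1 V W \o g)))%VF.
have gp x : g (p x) = in1 V W (g x).1 by rewrite !comp_lfunE gVK pr1E.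
have [||p0|p1] := idem p.
- apply: rhom_comp; first exact: rhom_inv.
  by apply: rhom_comp; [exact: in1_hom|apply: rhom_comp => //; exact: pr1_hom].
- by move=> x; rewrite -[LHS]gK -[RHS]gK !gp !in1E.
- left=> v; have := gp (g^-1%VF (v, 0)).
  by rewrite p0 linear0 gVK in1E /= => /(congr1 fst).
right=> w; have := gp (g^-1%VF (0, w)).
by rewrite p1 gVK in1E /= => /(congr1 snd).
Qed.

Lemma indec_fitting U (f : 'Hom(U, U)) : indecomposable U -> rhom f ->
  lbij f \/ exists n, forall x, iter n f x = 0.
Proof.
move=> Ui fh; have [n [p [ph pp lp kp]]] := fitting fh.
case: (indecomposable_idem Ui ph pp) => p01; [right|left].
  by exists n.+1 => x; rewrite -fpowE kp.
apply: lbij_endo_surj; apply/limg_fullP => y.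
have : y \in limg p by rewrite -[y]p01 memv_img ?memvf.
rewrite lp => /memv_imgP[x _ ->]; exists (fpow f n x).
by rewrite !fpowE.
Qed.

(** After division by the sum, f + g becomes the identity. If f is then nilpotent, it fixes the
    kernel of g pointwise, so this kernel is zero. For [U] = [V] this is the locality of the
    endomorphism ring. *)
Lemma indec_local U V (f g : 'Hom(U, V)) : indecomposable U -> rhom f -> rhom g ->
  lbij (f + g) -> lbij f \/ lbij g.
Proof.
move=> Ui fh gh sb; have [sK sVK] := lbij_inv sb.
set s := f + g in sb sK sVK; have sh : rhom s by exact: rhomD.
have sVh := rhom_inv sh sb.
have sVb : lbij (s^-1)%VF by exact: lbij_of_cancel sVK sK.
have fE (h : 'Hom(U, V)) : h = (s \o (s^-1 \o h))%VF.
  by apply/lfunP => x; rewrite !comp_lfunE sVK.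
have [fb|[n fn]] := indec_fitting Ui (rhom_comp sVh fh).
  by left; rewrite (fE f); exact: lbij_comp.
right; rewrite (fE g); apply: lbij_comp => //; apply: lbij_endo_inj.
apply/lker_trivP => x gx.
have fx : (s^-1 \o f)%VF x = x.
  move: gx; rewrite !comp_lfunE /= => gx.
  by rewrite -[RHS]sK [s x]add_lfunE linearD /= gx addr0.
by rewrite -(fn x); elim: {fn}n => //= n IH; rewrite -IH fx.
Qed.

Lemma indec_local_sum I (r : seq I) U V (F : I -> 'Hom(U, V)) : indecomposable U ->
  (forall i, rhom (F i)) -> lbij (\sum_(i <- r) F i) -> exists i, lbij (F i).
Proof.
move=> Ui Fh; elim: r => [|i r IH]; last first.
  rewrite big_cons => /(indec_local Ui (Fh i) _)[|fb|/IH//]; last by exists i.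
  exact: rhom_sum.
rewrite big_nil => -[k0 _]; have [x []] := indecomposable_nz Ui.
by apply: (proj2 (lker_trivP _) k0); rewrite zero_lfunE.
Qed.

(** With h = f g, the endomorphism g h^-1 f of [V] is idempotent and nonzero, hence the identity,
    and g h^-1 is a two-sided inverse of f. *)
Lemma indec_comp U V W (g : 'Hom(U, V)) (f : 'Hom(V, W)) :
  indecomposable V -> ~ zero_module U -> rhom f -> rhom g ->
  lbij (f \o g)%VF -> lbij f /\ lbij g.
Proof.
move=> Vi Unz fh gh hb; have [hK hVK] := lbij_inv hb.
set h := (f \o g)%VF in hb hK hVK; have hh : rhom h by exact: rhom_comp.
pose p := (g \o (h^-1 \o f))%VF.
have pE x : p x = g (h^-1%VF (f x)) by rewrite !comp_lfunE.
have hE x : f (g x) = h x by rewrite comp_lfunE.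
have [||p0|p1] := indecomposable_idem (p := p) Vi.
- by apply: rhom_comp => //; apply: rhom_comp => //; exact: rhom_inv.
- by move=> x; rewrite !pE hE hVK.
- case: Unz => x; have := p0 (g x); rewrite pE hE hK => gx.
  by rewrite -[x]hK -hE gx !linear0.
have [gV fV] : cancel f (g \o h^-1)%VF /\ cancel (g \o h^-1)%VF f.
  by split=> x; rewrite comp_lfunE /= -?pE ?hE.
split; first exact: lbij_of_cancel gV fV.
apply: (@lbij_of_cancel _ _ _ _ (h^-1 \o f)%VF) => x; rewrite comp_lfunE /= ?hE //.
by rewrite -pE.
Qed.

Lemma retract_of_lbij U V W (i : 'Hom(U, V)) (r : 'Hom(V, W)) :
  rhom i -> rhom r -> lbij (r \o i)%VF -> retract U V.
Proof.
move=> ih rh hb; have [hK hVK] := lbij_inv hb.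
exists i, ((r \o i)^-1 \o r)%VF.
  by split=> //; apply: rhom_comp => //; apply: rhom_inv => //; exact: rhom_comp.
by move=> x; rewrite comp_lfunE /= -[r (i x)]comp_lfunE hK.
Qed.

Lemma lbij_id U : lbij (\1%VF : 'Hom(U, U)).
Proof. by apply: (@lbij_of_cancel _ _ _ _ id) => x; rewrite lfunE. Qed.

Lemma retract_indec_riso U V : ~ zero_module U -> indecomposable V ->
  retract U V -> riso U V.
Proof.
move=> Unz Vi [i [r [ih rh] ir]].
have E : (r \o i)%VF = \1%VF by apply/lfunP => x; rewrite comp_lfunE id_lfunE ir.
have [_ ib] : lbij r /\ lbij i by apply: indec_comp => //; rewrite E; exact: lbij_id.
by exists i.
Qed.

(** The identity of [R] is the sum of its components through [V] and through [W], so one of them is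
    bijective by locality. *)
Lemma retract_exchange R V W : indecomposable R -> retract R (dsum V W) ->
  retract R V \/ retract R W.
Proof.
move=> Ri [i [r [ih rh] ir]].
pose F1 := ((r \o in1 V W) \o (pr1 V W \o i))%VF.
pose F2 := ((r \o in2 V W) \o (pr2 V W \o i))%VF.
have E : F1 + F2 = \1%VF.
  apply/lfunP => x; rewrite add_lfunE !comp_lfunE id_lfunE /= pr1E pr2E.
  by rewrite -[RHS]ir [in RHS](dsum_split (i x)) linearD.
have h1 : rhom (pr1 V W \o i)%VF by apply: rhom_comp => //; exact: pr1_hom.
have h2 : rhom (pr2 V W \o i)%VF by apply: rhom_comp => //; exact: pr2_hom.
have h3 : rhom (r \o in1 V W)%VF by apply: rhom_comp => //; exact: in1_hom.
have h4 : rhom (r \o in2 V W)%VF by apply: rhom_comp => //; exact: in2_hom.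
have := lbij_id R; rewrite -E => /(indec_local Ri (rhom_comp h3 h1) (rhom_comp h4 h2)).
by case=> /retract_of_lbij; [left|right]; auto.
Qed.

Lemma retract_dpow R V n : indecomposable R -> retract R (dpow V n) -> retract R V.
Proof.
move=> Ri [i [r [ih rh] ir]].
pose F j := ((r \o dpow_in V j) \o (dpow_pr V j \o i))%VF.
have E : \sum_j F j = \1%VF.
  apply/lfunP => x; rewrite sum_lfunE id_lfunE -[RHS]ir [i x in RHS]dpow_split linear_sum.
  by apply: eq_bigr => j _; rewrite !comp_lfunE /= dpow_prE.
have h1 j : rhom (dpow_pr V j \o i)%VF by apply: rhom_comp => //; exact: dpow_pr_hom.
have h2 j : rhom (r \o dpow_in V j)%VF by apply: rhom_comp => //; exact: dpow_in_hom.
have [||j Fb] := @indec_local_sum _ (index_enum _) _ _ F Ri.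
- by move=> j; exact: rhom_comp.
- by rewrite E; exact: lbij_id.
exact: retract_of_lbij Fb.
Qed.

Lemma riso_dim U V : riso U V -> \dim {:U} = \dim {:V}.
Proof. by case=> f _ [kf lf]; rewrite -lf limg_dim_eq // kf capv0. Qed.

Lemma zero_moduleP U : zero_module U <-> \dim {:U} = 0%N.
Proof.
split=> [U0|/eqP]; last first.
  by rewrite dimv_eq0 => /eqP U0 x; apply/eqP; rewrite -memv0 -U0 memvf.
by apply/eqP; rewrite dimv_eq0 -subv0; apply/subvP => x _; rewrite (U0 x) mem0v.
Qed.

Lemma dim_dsum V W : \dim {:dsum V W} = (\dim {:V} + \dim {:W})%N.
Proof. by rewrite !dimvf. Qed.

(** The existence half of Krull-Schmidt as an induction principle: a module neither zero nor
    indecomposable splits into two of smaller dimension. *)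
Lemma krull_schmidt_ind (Phi : rmod A -> Prop) :
    (forall U V, riso U V -> Phi U -> Phi V) ->
    (forall U, zero_module U -> Phi U) ->
    (forall U, indecomposable U -> Phi U) ->
    (forall V W, Phi V -> Phi W -> Phi (dsum V W)) ->
  forall U, Phi U.
Proof.
move=> Piso P0 Pi Pd U; move: {2}(\dim {:U}).+1 (ltnSn (\dim {:U})) => n.
elim: n U => // n IH U; rewrite ltnS => dU.
have [U0|Unz] := classic (zero_module U); first exact: P0.
have [Ui|nUi] := classic (indecomposable U); first exact: Pi.
have [V [W [iso [Vnz Wnz]]]] :
    exists V W, riso U (dsum V W) /\ ~ zero_module V /\ ~ zero_module W.
  apply: NNPP => no; apply: nUi; split=> // V W iso; apply: NNPP => /not_or_and VW.
  by apply: no; exists V, W.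
have := riso_dim iso; rewrite dim_dsum => dE.
apply: Piso (riso_sym iso) _; apply: Pd; apply: IH.
  apply: leq_trans dU; rewrite dE -[X in (X < _)%N]addn0 ltn_add2l lt0n.
  by apply/eqP => /zero_moduleP.
apply: leq_trans dU; rewrite dE -[X in (X < _)%N]add0n ltn_add2r lt0n.
by apply/eqP => /zero_moduleP.
Qed.

End KrullSchmidt.

(** * Fac, Ext-projectives and projective covers *)

Section Generation.
Variables (k : fieldType) (A : falgType k).
Implicit Types R T U V W P Q : rmod A.

(** Repetitions are allowed, so that lists for [V] and [W] concatenate to one for [dsum V W]. *)
Definition covers T n (s : 'I_n -> rmod A) :=
  (forall i, indecomposable (s i) /\ retract (s i) T) /\
  (forall U, indecomposable U -> retract U T -> exists i, riso U (s i)).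

Lemma covers_ex T : exists n (s : 'I_n -> rmod A), covers T s.
Proof.
move: T; apply: krull_schmidt_ind => [U V UV|U U0|U Ui|V W].
- case=> n [s [si sc]]; exists n, s; split=> [i|R Ri RV].
    have [Si SU] := si i; split=> //; apply: retract_trans SU (retract_riso UV).
  by apply: sc => //; exact: retract_trans RV (retract_riso (riso_sym UV)).
- have f0 : 'I_0 -> rmod A by case.
  exists 0%N, f0; split=> [[]//|R [Rnz _] [i [r _ ir]]].
  by case: Rnz => x; rewrite -[x]ir (U0 (i x)) linear0.
- exists 1%N, (fun=> U); split=> [_|R Ri RU]; first by split=> //; exact: retract_refl.
  by exists ord0; apply: retract_indec_riso => //; case: Ri.
move=> [m [s [si sc]]] [n [t [ti tc]]].
exists (m + n)%N, (fun i => match split i with inl a => s a | inr b => t b end).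
split=> [i|R Ri /(retract_exchange Ri)[/(sc _ Ri)[a Ra]|/(tc _ Ri)[b Rb]]].
- case: (split i) => [a|b]; [have [] := si a|have [] := ti b] => -? RV; split=> //.
    exact: retract_trans RV (retract_dsum1 _ _).
  exact: retract_trans RV (retract_dsum2 _ _).
- by exists (unsplit (inl a)); rewrite unsplitK.
by exists (unsplit (inr b)); rewrite unsplitK.
Qed.

(* A covering list of minimal length has no repetitions. *)
Lemma card_indec_ex T : exists n, card_indec T n.
Proof.
have [n [[s [si sc]] nmin]] := ex_min (covers_ex T).
exists n, s; split=> [i|i j|U Ui /summandP UT]; last exact: sc.
  by have [? /summandP] := si i.
case: (eqVneq i j) => // nij ij.
case: n s si sc nmin i j nij ij => [|n] s si sc nmin i j nij ij; first by case: i {nij ij}.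
have /nmin : exists s' : 'I_n -> rmod A, covers T s'.
  (* Entry [j] is dropped; entry [i] still represents its isomorphism class. *)
  exists (fun l => s (lift j l)); split=> [l|U Ui UT]; first exact: si.
  have [l Ul] := sc U Ui UT.
  have [lj|] := eqVneq l j; last first.
    by rewrite eq_sym => /unlift_some[l' El _]; exists l'; rewrite -El.
  have Ui' : riso U (s i) by rewrite lj in Ul; exact: riso_trans Ul (riso_sym ij).
  by move: nij; rewrite eq_sym => /unlift_some[l' El _]; exists l'; rewrite -El.
by rewrite ltnn.
Qed.

(** The trace of [U] in [V] along [E]; a basis of [E] already yields the sum of all images. *)
Definition imgs U V (E : {vspace 'Hom(U, V)}) : {vspace V} :=
  (\sum_(i < \dim E) limg (vbasis E)`_i)%VS.

Lemma imgs_sup U V (E : {vspace 'Hom(U, V)}) f : f \in E -> (limg f <= imgs E)%VS.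
Proof.
move=> fE; apply/subvP => _ /memv_imgP[x _ ->].
rewrite (coord_vbasis fE) sum_lfunE rpred_sum // => i _.
rewrite scale_lfunE rpredZ //; apply: subvP (sumv_sup i _ (subvv _)) _ _ => //.
by rewrite memv_img ?memvf.
Qed.

Lemma imgs_sub U V (E : {vspace 'Hom(U, V)}) (S : {vspace V}) :
  (forall f, f \in E -> (limg f <= S)%VS) -> (imgs E <= S)%VS.
Proof.
move=> ES; apply/subv_sumP => i _; apply: ES; apply: vbasis_mem.
by apply: mem_nth; rewrite size_tuple.
Qed.

(** A basis of Hom(T, W) assembles into a map from a finite power of [T] whose image is the trace of
    [T] in [W]. Testing against subspaces [S] then replaces the choice of powers in the closure
    properties of [Fac]. *)
Lemma FacP T W : Fac T W <->
  forall S : {vspace W},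
    (forall f : 'Hom(T, W), rhom f -> (limg f <= S)%VS) -> S = fullv.
Proof.
split=> [[n [g gh /limg_fullP gs]] S HS|HS].
  apply/vspaceP => w; rewrite memvf; have [x ->] := gs w.
  rewrite (dpow_split x) linear_sum rpred_sum // => i _ /=.
  have /HS/subvP : rhom (g \o dpow_in T i)%VF by apply: rhom_comp => //; exact: dpow_in_hom.
  by apply; rewrite -[g _]comp_lfunE memv_img ?memvf.
pose E := hom_space T W; pose F (i : 'I_(\dim E)) := (vbasis E)`_i.
have Fh i : rhom (F i).
  by apply/hom_spaceP/vbasis_mem/mem_nth; rewrite size_tuple.
exists (\dim E), (dpow_copair F); first exact: dpow_copair_hom.
have <- := HS (imgs E) _; last by move=> f fh; apply/imgs_sup/hom_spaceP.
apply/eqP; rewrite eqEsubv; apply/andP; split.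
  apply/subvP => _ /memv_imgP[x _ ->]; rewrite dpow_copairE rpred_sum // => i _.
  have FE : F i \in E by exact/hom_spaceP.
  by apply: (subvP (imgs_sup FE)); rewrite memv_img ?memvf.
apply/subv_sumP => i _; apply/subvP => _ /memv_imgP[x _ ->].
apply/memv_imgP; exists (dpow_in T i x); rewrite ?memvf // dpow_copairE (bigD1 i) //=.
rewrite dpow_inE ffunE eqxx big1 ?addr0 // => j /negPf nij.
by rewrite ffunE nij linear0.
Qed.

Lemma Fac_limg T V W (f : 'Hom(V, W)) (S : {vspace W}) : Fac T V -> rhom f ->
  (forall g : 'Hom(T, W), rhom g -> (limg g <= S)%VS) -> (limg f <= S)%VS.
Proof.
move=> /FacP TV fh HS.
have E : (f @^-1: S)%VS = fullv.
  apply: TV => g gh; apply/subvP => _ /memv_imgP[x _ ->]; rewrite -memv_preim.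
  have /subvP := HS _ (rhom_comp fh gh); apply.
  by rewrite -[f _]comp_lfunE memv_img ?memvf.
apply/subvP => _ /memv_imgP[x _ ->].
by rewrite memv_preim E memvf.
Qed.

Lemma Fac_surj T V W (f : 'Hom(V, W)) : Fac T V -> rhom f -> limg f = fullv -> Fac T W.
Proof.
move=> TV fh fs; apply/FacP => S HS; apply/eqP.
by rewrite eqEsubv subvf -fs (Fac_limg TV).
Qed.

Lemma Fac_trans V T W : Fac T V -> Fac V W -> Fac T W.
Proof.
move=> TV /FacP VW; apply/FacP => S HS; apply: VW => f fh.
exact: Fac_limg TV fh HS.
Qed.

Lemma Fac_retract T U : retract U T -> Fac T U.
Proof.
move=> [i [r [ih rh] ir]]; apply/FacP => S /(_ r rh)/subvP rS.
by apply/vspaceP => x; rewrite memvf rS // -[x]ir memv_img ?memvf.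
Qed.

Lemma Fac_dsum T V W : Fac T V -> Fac T W -> Fac T (dsum V W).
Proof.
move=> TV TW; apply/FacP => S HS; apply/vspaceP => x; rewrite memvf (dsum_split x).
have S1 := Fac_limg TV (@in1_hom _ _ V W) HS.
have S2 := Fac_limg TW (@in2_hom _ _ V W) HS.
by apply: rpredD; [apply: (subvP S1) | apply: (subvP S2)]; rewrite memv_img ?memvf.
Qed.

(* U is Ext-projective relative to Fac W: Ext^1(U, Fac W) = 0. *)
Definition ext_projective U W := forall (K E V : rmod A) (i : 'Hom(K, E)) (p : 'Hom(E,
  V)) (f : 'Hom(U, V)),
  rhom i -> rhom p -> rhom f -> lker i = 0%VS -> limg i = lker p -> limg p = fullv ->
  Fac W K -> exists2 g : 'Hom(U, E), rhom g & (p \o g)%VF = f.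

Lemma ext_projective_sub U W W' : (forall V, Fac W' V -> Fac W V) ->
  ext_projective U W -> ext_projective U W'.
Proof. by move=> WW UW K E V i p f ih ph fh ki ip ps /WW; exact: UW. Qed.

Lemma ext_projective_retract U V W : retract U V ->
  ext_projective V W -> ext_projective U W.
Proof.
move=> [j [r [jh rh] jr]] VW K E X i p f ih ph fh ki ip ps WK.
have [g gh pg] := VW _ _ _ i p (f \o r)%VF ih ph (rhom_comp fh rh) ki ip ps WK.
exists (g \o j)%VF; first exact: rhom_comp.
by rewrite comp_lfunA pg; apply/lfunP => x; rewrite !comp_lfunE /= jr.
Qed.

Lemma ext_projective_dsum U V W : ext_projective U W -> ext_projective V W ->
  ext_projective (dsum U V) W.
Proof.
move=> UW VW K E X i p f ih ph fh ki ip ps WK.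
have [g gh pg] := UW _ _ _ i p (f \o in1 U V)%VF ih ph (rhom_comp fh (@in1_hom _ _ _ _))
  ki ip ps WK.
have [g' gh' pg'] := VW _ _ _ i p (f \o in2 U V)%VF ih ph (rhom_comp fh (@in2_hom _ _ _
  _)) ki ip ps WK.
exists (copair g g'); first exact: copair_hom.
apply/lfunP => x; rewrite comp_lfunE /= copairE linearD /= -!comp_lfunE pg pg'.
by rewrite [in RHS](dsum_split x) linearD !comp_lfunE.
Qed.

Lemma ext_projective_zero U W : zero_module U -> ext_projective U W.
Proof.
move=> U0 K E V i p f *; exists 0; first exact: rhom0.
by apply/lfunP => x; rewrite (U0 x) !linear0.
Qed.

Lemma projective_retract P Q : retract P Q -> projective Q -> projective P.
Proof.
move=> [j [r [jh rh] jr]] Qp U V g h gh hh gs.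
have [h' h'h gh'] := Qp U V g (h \o r)%VF gh (rhom_comp hh rh) gs.
exists (h' \o j)%VF; first exact: rhom_comp.
by rewrite comp_lfunA gh'; apply/lfunP => x; rewrite !comp_lfunE /= jr.
Qed.

Lemma projective_dsum P Q : projective P -> projective Q -> projective (dsum P Q).
Proof.
move=> Pp Qp U V g h gh hh gs.
have [f1 f1h gf1] := Pp U V g (h \o in1 P Q)%VF gh (rhom_comp hh (@in1_hom _ _ _ _)) gs.
have [f2 f2h gf2] := Qp U V g (h \o in2 P Q)%VF gh (rhom_comp hh (@in2_hom _ _ _ _)) gs.
exists (copair f1 f2); first exact: copair_hom.
apply/lfunP => x; rewrite comp_lfunE /= copairE linearD /= -!comp_lfunE gf1 gf2.
by rewrite [in RHS](dsum_split x) linearD !comp_lfunE.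
Qed.

Definition act_at V (v : V) : 'Hom(regular_r A, V) := linfun (fun a : regular_r A => ract
  v a).
Lemma act_atE V (v : V) a : act_at v a = ract v a.
Proof. by apply: (linfunE (V := regular_r A)); exact: ract_linr. Qed.
Lemma act_at_hom V (v : V) : rhom (act_at v).
Proof. by move=> a b; rewrite !act_atE ractM. Qed.

Lemma free_projective n : projective (dpow (regular_r A) n).
Proof.
move=> U V g h gh hh /limg_fullP gs.
have /choice[u uE] (i : 'I_n) : exists u : U, h (dpow_in (regular_r A) i (1 : A)) = g u
  by exact: gs.
exists (dpow_copair (fun i => act_at (u i))); first by apply: dpow_copair_hom => i;
  exact: act_at_hom.
apply/lfunP => x; rewrite comp_lfunE dpow_copairE [in RHS](dpow_split x) !linear_sum.
apply: eq_bigr => i _ /=; rewrite act_atE gh -uE -hh -dpow_in_hom.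
by congr (h (dpow_in _ _ _)); exact: mul1r.
Qed.

Lemma free_cover V : exists n, exists2 g : 'Hom(dpow (regular_r A) n, V), rhom g & limg g
  = fullv.
Proof.
exists (\dim {:V}), (dpow_copair (fun i => act_at (vbasis {:V})`_i)).
  by apply: dpow_copair_hom => i; exact: act_at_hom.
apply/limg_fullP => v.
exists ([ffun i => (coord (vbasis {:V}) i v)%:A] : dpow (regular_r A) (\dim {:V})).
rewrite dpow_copairE {1}(coord_vbasis (memvf v)); apply: eq_bigr => i _.
by rewrite ffunE act_atE (linZ _ (ract_linr _)) ract1.
Qed.

Lemma projective_free P : projective P -> exists n, retract P (dpow (regular_r A) n).
Proof.
move=> Pp; have [n [g gh gs]] := free_cover P.
have [h hh gE] := Pp _ _ g \1%VF gh (@rhom_id _ _ P) gs.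
exists n, h, g => // x; have /lfunP/(_ x) := gE.
by rewrite comp_lfunE id_lfunE.
Qed.

Lemma dim_submod U (S : {vspace U}) (HS : submodule S) :
  \dim {:submod HS} = \dim S.
Proof. by rewrite dimvf. Qed.

(** Take a surjection from a projective of least dimension. If S + ker e is everything, projectivity
    yields an endomorphism [h] of [P] over [V] with values in [S]. By Fitting its stable image is a
    summand of [P] inside [S] that still maps onto [V], so minimality makes [S] full. *)
Lemma projective_cover V : exists P (e : 'Hom(P, V)),
  [/\ projective P, rhom e, limg e = fullv & superfluous (lker e)].
Proof.
pose Q d := exists P (e : 'Hom(P, V)),
  [/\ projective P, rhom e, limg e = fullv & \dim {:P} = d].
have [|_ [[P [e [Pp eh es <-]]] dmin]] := @ex_min Q.
  have [n [g gh gs]] := free_cover V.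
  by exists (\dim {:dpow (regular_r A) n}), (dpow (regular_r A) n), g; split=> //; exact:
    free_projective.
exists P, e; split=> // S HS SK.
have jh : rhom (e \o sub_in HS)%VF by apply: rhom_comp => //; exact: sub_in_hom.
have js : limg (e \o sub_in HS)%VF = fullv.
  apply/limg_fullP => y; have /limg_fullP/(_ y)[x ->] := es.
  have : x \in (S + lker e)%VS by rewrite SK memvf.
  case/memv_addP => s sS [z]; rewrite memv_ker => /eqP ez ->.
  exists (to_sub HS \1%VF s); rewrite comp_lfunE to_subE id_lfunE //.
  by rewrite linearD /= ez addr0.
have [h' h'h eh'] := Pp _ _ _ e jh eh js.
pose h := (sub_in HS \o h')%VF.
have hh : rhom h by apply: rhom_comp => //; exact: sub_in_hom.
have ehE x : e (h x) = e x by rewrite -[in RHS]eh' !comp_lfunE.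
have [n [p [ph pp lp kp]]] := fitting hh.
have eF m x : e (fpow h m x) = e x by rewrite fpowE; elim: m => //= m <-.
have hS x : h x \in S by rewrite comp_lfunE sub_in_mem.
have ret := idem_retract ph pp.
have : Q (\dim {:submod (submodule_limg ph)}).
  exists (submod (submodule_limg ph)), (e \o sub_in _)%VF; split=> //.
  - exact: projective_retract ret Pp.
  - by apply: rhom_comp => //; exact: sub_in_hom.
  apply/limg_fullP => y; have /limg_fullP/(_ y)[x ->] := es.
  have m : fpow h n.+1 x \in limg p by rewrite lp memv_img ?memvf.
  exists (to_sub (submodule_limg ph) (fpow h n.+1) x).
  by rewrite comp_lfunE to_subE // eF.
move=> /dmin; rewrite dim_submod lp => dP.
apply/eqP; rewrite eqEdim subvf (leq_trans dP) // dimvS //.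
by apply/subvP => _ /memv_imgP[x _ ->]; rewrite fpowE /= hS.
Qed.

Lemma min_presentation_ex T : inhabited (min_presentation T).
Proof.
have [P0 [e [P0p eh es emin]]] := projective_cover T.
have [P1 [d [P1p dh ds dmin]]] := projective_cover (submod (submodule_ker eh)).
have kE : lker (sub_in (submodule_ker eh) \o d)%VF = lker d.
  apply/vspaceP => x; rewrite !memv_ker comp_lfunE.
  by apply/eqP/eqP => [/sub_in_inj//|->]; rewrite linear0.
constructor; apply: (@MinPresentation _ _ T P1 P0 (sub_in _ \o d)%VF e) => //.
- by apply: rhom_comp => //; exact: sub_in_hom.
- by rewrite limg_comp ds limg_sub_in.
by rewrite kE.
Qed.

End Generation.

(** * Minimal presentations and the Auslander-Reiten translation *)

Section Presentations.
Variables (k : fieldType) (A : falgType k).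
Implicit Types R T U V W P Q : rmod A.

Lemma factor_surj U V W (e : 'Hom(U, V)) (f : 'Hom(U, W)) : rhom e -> rhom f ->
  limg e = fullv -> (forall x, e x = 0 -> f x = 0) -> exists2 g : 'Hom(V, W), rhom g & (g
    \o e)%VF = f.
Proof.
move=> eh fh es ef; have eK v : e (e^-1%VF v) = v by apply: limg_lfunVK; rewrite es memvf.
have fB x y : e x = e y -> f x = f y.
  move=> exy; apply/eqP; rewrite -subr_eq0 -linearB; apply/eqP/ef.
  by rewrite linearB /= exy subrr.
have gE x : f (e^-1%VF (e x)) = f x by apply: fB; rewrite eK.
exists (f \o e^-1)%VF; last by apply/lfunP => x; rewrite comp_lfunE comp_lfunE gE.
by move=> v a; rewrite !comp_lfunE -fh; apply: fB; rewrite eh !eK.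
Qed.

Lemma factor_inj U V W (i : 'Hom(V, W)) (f : 'Hom(U, W)) : rhom i -> rhom f ->
  lker i = 0%VS -> (limg f <= limg i)%VS -> exists2 g : 'Hom(U, V), rhom g & (i \o g)%VF
    = f.
Proof.
move=> ih fh ki fi; have iK x : i (i^-1%VF (f x)) = f x.
  by apply: limg_lfunVK; apply: (subvP fi); rewrite memv_img ?memvf.
exists (i^-1 \o f)%VF; last by apply/lfunP => x; rewrite !comp_lfunE iK.
move=> v a; rewrite !comp_lfunE; apply/eqP; rewrite -subr_eq0.
by apply/eqP/(proj2 (lker_trivP i) ki); rewrite linearB /= ih !iK fh subrr.
Qed.

Definition extends_along P1 P0 (d : 'Hom(P1, P0)) W := forall a : 'Hom(P1, W), rhom a ->
  exists2 b : 'Hom(P0, W), rhom b & (b \o d)%VF = a.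

(** A map P1 -> W lifts to a power of [V]; each component extends along [d], and the extension is
    mapped back to [W]. *)
Lemma extends_along_Fac P1 P0 (d : 'Hom(P1, P0)) V W : projective P1 ->
  Fac V W -> extends_along d V -> extends_along d W.
Proof.
move=> P1p [n [g gh gs]] dV a ah.
have [a' a'h ga'] := P1p _ _ g a gh ah gs.
have /choice[b bE] (i : 'I_n) : exists b : 'Hom(P0, V), rhom b /\ (b \o d)%VF = (dpow_pr
  V i \o a')%VF.
  have [|b bh bE] := dV (dpow_pr V i \o a')%VF; last by exists b.
  by apply: rhom_comp => //; exact: dpow_pr_hom.
exists (g \o \sum_i (dpow_in V i \o b i))%VF.
  apply: rhom_comp => //; apply: rhom_sum => i _; apply: rhom_comp; first exact:
    dpow_in_hom.
  by case: (bE i).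
rewrite -ga'; apply/lfunP => x; rewrite !comp_lfunE sum_lfunE [in RHS](dpow_split (a' x)).
congr (g _); apply: eq_bigr => i _; rewrite comp_lfunE /=; congr (dpow_in _ _ _).
by case: (bE i) => _ /lfunP/(_ x); rewrite !comp_lfunE dpow_prE.
Qed.

Lemma pres_de T (p : min_presentation T) x : pres_e p (pres_d p x) = 0.
Proof. by apply/eqP; rewrite -memv_ker -pres_exact memv_img ?memvf. Qed.

(** Lift [f] to [b] : P0 -> E. Composed with [d] it takes values in [K]; extending this map along
    [d] to [c] and subtracting, b - i c vanishes on the image of [d] and descends to [T]. *)
Lemma extends_ext_projective T (p : min_presentation T) W :
  extends_along (pres_d p) W -> ext_projective T W.
Proof.
move=> pW K E V i q f ih qh fh ki iq qs WK.
have [b bh qb] := pres0_proj qh (rhom_comp fh (@pres_e_hom _ _ _ p)) qs.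
have qbE x : q (b x) = f (pres_e p x) by rewrite -!comp_lfunE qb.
have dh := @pres_d_hom _ _ _ p.
have [||a ah iaE] := @factor_inj _ _ _ i (b \o pres_d p)%VF ih _ ki.
- exact: rhom_comp.
- apply/subvP => _ /memv_imgP[x _ ->].
  by rewrite iq memv_ker comp_lfunE qbE pres_de linear0.
have [c ch cE] := extends_along_Fac (@pres1_proj _ _ _ p) WK pW ah.
have [||g gh gE] := @factor_surj _ _ _ (pres_e p) (b - (i \o c)%VF) (@pres_e_hom _ _ _ p)
  _ (pres_e_surj p).
- by apply: rhomB => //; exact: rhom_comp.
- move=> x /eqP; rewrite -memv_ker -pres_exact => /memv_imgP[y _ ->].
  rewrite add_lfunE opp_lfunE comp_lfunE -[c _]comp_lfunE cE -[i (a y)]comp_lfunE iaE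
    comp_lfunE.
  by rewrite subrr.
exists g => //; apply/lfunP => t; have /limg_fullP/(_ t)[x ->] := pres_e_surj p.
rewrite comp_lfunE -[g _]comp_lfunE gE add_lfunE opp_lfunE comp_lfunE linearB /= qbE.
have /eqP-> : q (i (c x)) == 0 by rewrite -memv_ker -iq memv_img ?memvf.
by rewrite subr0.
Qed.

(* Splitting the pushout of 0 -> ker e -> P0 -> T -> 0 along the map induced by a
   shows that a factors through d up to a map into a (ker d), which is smaller
   than the image of a because ker d is superfluous. *)
Lemma ext_projective_step T (p : min_presentation T) W (a : 'Hom(pres1 p, W)) :
  ext_projective T W -> rhom a ->
  exists2 c : 'Hom(pres0 p, W), rhom c &
    (limg (a - (c \o pres_d p)%VF) <= a @: lker (pres_d p))%VS.
Proof.
set d := pres_d p; set e := pres_e p => TW ah.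
have dh : rhom d := @pres_d_hom _ _ _ p; have eh : rhom e := @pres_e_hom _ _ _ p.
pose phi := dsum_pair a (- d).
have phh : rhom phi.
  by apply: dsum_pair_hom => //; rewrite -[- d]add0r; apply: rhomB => //; exact: rhom0.
have phiE x : phi x = (a x, - d x) by rewrite dsum_pairE opp_lfunE.
(* [W] need not embed in [E]: the kernel of W -> E is the image of ker [d] under [a], and this is
   the source of the error term. *)
pose HN := submodule_limg phh; pose E := quotmod HN.
have prN x : quot_pr HN (phi x) = 0.
  by apply/eqP; rewrite quot_pr_eq0 memv_img ?memvf.
have qh : rhom (quot_pr HN) := @quot_pr_hom _ _ _ _ HN.
have qs : limg (quot_pr HN) = fullv by apply/limg_fullP; exact: quot_pr_surj.
have e2h : rhom (e \o pr2 W (pres0 p))%VF by apply: rhom_comp => //; exact: pr2_hom.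
have [|pE pEh pEE] := factor_surj qh e2h qs.
  move=> x /eqP; rewrite quot_pr_eq0 => /memv_imgP[y _ ->].
  by rewrite comp_lfunE pr2E phiE /= linearN /= pres_de oppr0.
have {pEE}pEE x : pE (quot_pr HN x) = e x.2 by rewrite -comp_lfunE pEE comp_lfunE pr2E.
pose j := (quot_pr HN \o in1 W (pres0 p))%VF.
have jh : rhom j by apply: rhom_comp => //; exact: in1_hom.
have jE w : j w = quot_pr HN (w, 0) by rewrite comp_lfunE in1E.
have addphi w x y : quot_pr HN (w, x + d y) = quot_pr HN (w + a y, x).
  rewrite -[LHS]addr0 -(prN y) -linearD /= phiE; congr (quot_pr HN _).
  by congr pair => /=; rewrite addrK.
have kpE : lker pE = limg j.
  apply/vspaceP => y; have [[w x] ->] := quot_pr_surj y.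
  rewrite memv_ker pEE /=; apply/idP/idP => [|/memv_imgP[w' _]].
    rewrite -memv_ker -pres_exact => /memv_imgP[z _ ->].
    by rewrite -[pres_d p z]add0r addphi -jE memv_img ?memvf.
  by rewrite jE => /(congr1 pE); rewrite !pEE /= linear0 => ->.
pose Hj := submodule_limg jh.
have js : limg (to_sub Hj j) = fullv.
  apply/limg_fullP => y; have := sub_in_mem y => /memv_imgP[w _ yE].
  by exists w; apply: sub_in_eq; rewrite to_subE // memv_img ?memvf.
have jsh : rhom (to_sub Hj j) by apply: to_sub_hom => // w; rewrite memv_img ?memvf.
have WK : Fac W (submod Hj).
  exact: Fac_surj (Fac_retract (retract_refl W)) jsh js.
have pEs : limg pE = fullv.
  apply/limg_fullP => t; have /limg_fullP/(_ t)[x ->] := pres_e_surj p.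
  by exists (quot_pr HN (0, x)); rewrite pEE.
have [||s sh sE] := TW _ _ _ (sub_in Hj) pE \1%VF (@sub_in_hom _ _ _ _ Hj) pEh (@rhom_id
  _ _ T) _ _ pEs WK.
- by apply/lker_trivP => x; exact: sub_in_inj.
- by rewrite limg_sub_in kpE.
have {}sE t : pE (s t) = t by have /lfunP/(_ t) := sE; rewrite comp_lfunE id_lfunE.
(* The splitting [s] corrects P0 -> E to a map with values in the image of [W], which lifts to [c]
   because P0 is projective. *)
pose delta := ((quot_pr HN \o in2 W (pres0 p)) - (s \o e))%VF.
have deE x : delta x = quot_pr HN (0, x) - s (e x).
  by rewrite add_lfunE opp_lfunE !comp_lfunE in2E.
have deh : rhom delta.
  by apply: rhomB; apply: rhom_comp => //; exact: in2_hom.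
have dej x : delta x \in limg j.
  by rewrite -kpE memv_ker deE linearB /= pEE sE subrr.
have [c ch cE] := pres0_proj jsh (@to_sub_hom _ _ _ _ Hj _ _ deh dej) js.
have {}cE x : j (c x) = delta x.
  have /lfunP/(_ x)/(congr1 (sub_in Hj)) := cE.
  by rewrite comp_lfunE !to_subE // memv_img ?memvf.
exists c => //; apply/subvP => _ /memv_imgP[x _ ->].
rewrite add_lfunE opp_lfunE comp_lfunE.
have : j (a x - c (d x)) = 0.
  rewrite linearB /= cE deE pres_de linear0 subr0 jE -[d x]add0r addphi add0r.
  by rewrite subrr.
move/eqP; rewrite jE quot_pr_eq0 => /memv_imgP[y _]; rewrite phiE => -[-> /eqP].
rewrite eq_sym oppr_eq0 -memv_ker => yk.
by rewrite memv_img.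
Qed.

Lemma ext_projective_extends T (p : min_presentation T) W :
  ext_projective T W -> extends_along (pres_d p) W.
Proof.
move=> TW a; have [n] := ubnP (\dim (limg a)); elim: n a => // n IH a; rewrite ltnS => da
  ah.
have [a0|anz] := eqVneq (limg a) 0%VS.
  exists 0; first exact: rhom0.
  apply/lfunP => x; rewrite comp_lfunE !lfunE; apply/esym/eqP.
  by rewrite -memv0 -a0 memv_img ?memvf.
have [c ch ca] := ext_projective_step TW ah.
have dh := @pres_d_hom _ _ _ p.
have [||b bh bE] := IH (a - (c \o pres_d p)%VF).
- apply: leq_trans da; apply: leq_ltn_trans (dimvS ca) _.
  rewrite (ltn_leqif (dimv_leqif_sup (limgS a (subvf _)))).
  (* If [a] already attains its whole image on ker [d], then ker [a] + ker [d] is all of P1, and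
     superfluity of ker [d] gives a = 0. *)
  apply: contra anz => ka; have full : lker a = fullv.
    apply: (pres_d_min (m := p)); first exact: submodule_ker.
    apply/vspaceP => x; rewrite memvf.
    have /memv_imgP[z zk az] : a x \in (a @: lker (pres_d p))%VS.
      by apply: (subvP ka); rewrite memv_img ?memvf.
    rewrite -[x](subrK z) memv_add // memv_ker linearB /= az subrr //.
  rewrite -subv0; apply/subvP => _ /memv_imgP[x _ ->].
  by have := memvf x; rewrite -full memv_ker => /eqP->; rewrite mem0v.
- by apply: rhomB => //; exact: rhom_comp.
exists (b + c); first exact: rhomD.
by rewrite comp_lfunDl bE subrK.
Qed.

Lemma dual_basis P : projective P -> exists n (x : 'I_n -> P) (xi : 'I_n -> homs_lmod P),
  forall y, y = \sum_i ract (x i) (vsval (xi i) y).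
Proof.
move=> /projective_free[n [h [g [hh gh] hK]]].
have xih i : (dpow_pr (regular_r A) i \o h)%VF \in homs P.
  by apply/mem_homs; apply: rhom_comp => //; exact: dpow_pr_hom.
exists n, (fun i => g (dpow_in (regular_r A) i (1 : A))), (fun i => vsproj (homs P)
  (dpow_pr (regular_r A) i \o h)%VF).
move=> y; rewrite -{1}[y]hK {1}[h y]dpow_split linear_sum; apply: eq_bigr => i _.
rewrite -gh -dpow_in_hom; congr (g (dpow_in _ _ _)).
by rewrite vsprojK ?xih // comp_lfunE dpow_prE; apply/esym/mul1r.
Qed.

Lemma lcoker_pr (L L' : lmod A) (g : 'Hom(L, L')) (gh : lhom g) a (x : L') :
  lact a (qproj (limg g) x : lcoker gh) = qproj (limg g) (lact a x).
Proof.
apply/esym/eqP; rewrite -subr_eq0 -(linB (@qproj_linear _ _ _)) qproj_eq0.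
rewrite -(linB (@lact_linr _ _ L' a)).
have /memv_imgP[y _ ->] := qproj_val (limg g) x.
by rewrite -gh memv_img // memvf.
Qed.

Section Tau.
Variables (T : rmod A) (p : min_presentation T) (W : rmod A).
Local Notation d := (pres_d p).
Let dh : rhom d := @pres_d_hom _ _ _ p.
Local Notation P1s := (homs_lmod (pres1 p)).
Local Notation P0s := (homs_lmod (pres0 p)).

Definition tr_pr (xi : P1s) : transpose p := qproj (limg (homs_map d)) xi.

Lemma tr_pr_linear : linear tr_pr. Proof. exact: qproj_linear. Qed.

Lemma tr_prM a (xi : P1s) : tr_pr (lact a xi) = lact a (tr_pr xi).
Proof. by rewrite /tr_pr (lcoker_pr (homs_map_lhom dh)). Qed.

Lemma tr_pr0 (eta : P0s) : tr_pr (homs_map d eta) = 0.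
Proof. by apply/eqP; rewrite qproj_eq0 memv_img ?memvf. Qed.

Lemma homs_lactE P (c : A) (h : homs_lmod P) x : vsval (lact c h) x = c * vsval h x.
Proof.
by rewrite /= vsprojK ?homs_amull ?subvsP // comp_lfunE lfunE.
Qed.

(** Expand z in a dual basis of P1, and extend the map x |-> w z(x) from P1 to [W] along [d]. A dual
    basis of P0 then turns g w at the class of z into a sum of values of [g] at classes from the
    image of Hom(d, A), which are zero in Tr T. *)
Lemma extends_tau : extends_along d W -> forall g : 'Hom(W, tau p), rhom g -> g = 0.
Proof.
move=> dW g gh.
have [m [x [xi xE]]] := dual_basis (@pres1_proj _ _ _ p).
have [n [y [eta yE]]] := dual_basis (@pres0_proj _ _ _ p).
have gM w c (z : P1s) : (g (ract w c) : 'Hom(transpose p, k^o)) (tr_pr z) =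
    (g w : 'Hom(transpose p, k^o)) (tr_pr (lact c z)).
  rewrite gh tr_prM [LHS]comp_lfunE linfunE //; exact: (@lact_linr _ _ (transpose p)).
apply/lfunP => w; rewrite zero_lfunE; apply/lfunP => q; rewrite zero_lfunE.
rewrite -(qprojK q) -[qproj _ _]/(tr_pr (vsval q)); move: (vsval q) => z {q}.
have zE (z' : P1s) : z' = \sum_i lact (vsval z' (x i)) (xi i).
  apply: val_inj => /=; apply/lfunP => u; rewrite {1}(xE u) linear_sum.
  have /mem_homs zh : vsval z' \in homs (pres1 p) by exact: subvsP.
  rewrite raddf_sum sum_lfunE; apply: eq_bigr => i _.
  by rewrite homs_lactE; exact: zh.
have /mem_homs zh : vsval z \in homs (pres1 p) by exact: subvsP.
have [b bh bE] := dW (act_at w \o vsval z)%VF (rhom_comp (@act_at_hom _ _ _ w) zh).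
have {}bE i : ract w (vsval z (x i)) = \sum_j ract (b (y j)) (vsval (eta j) (d (x i))).
  have /lfunP/(_ (x i)) := bE; rewrite !comp_lfunE act_atE => <-.
  by rewrite {1}(yE (d (x i))) linear_sum; apply: eq_bigr => j _; exact: bh.
rewrite (zE z) (linS _ _ _ tr_pr_linear) linear_sum /=.
transitivity (\sum_i \sum_j (g (b (y j)) : 'Hom(transpose p, k^o))
     (tr_pr (lact (vsval (homs_map d (eta j)) (x i)) (xi i)))).
  apply: eq_bigr => i _; rewrite -gM bE linear_sum sum_lfunE; apply: eq_bigr => j _.
  by rewrite gM homs_mapE // comp_lfunE.
rewrite exchange_big big1 // => j _.
rewrite -linear_sum -(linS _ _ _ tr_pr_linear) -zE tr_pr0.
by rewrite linear0.
Qed.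

(* The functional annihilating the maps that factor through d, precomposed with
   W (x) Hom(P1, A) -> Hom(P1, W), is a map W -> tau T. *)
Lemma tau_extends : (forall g : 'Hom(W, tau p), rhom g -> g = 0) -> extends_along d W.
Proof.
move=> W0 a ah.
pose pre := linfun (fun b : 'Hom(pres0 p, W) => (b \o d)%VF).
have preE b : pre b = (b \o d)%VF.
  by apply: (linfunE (W := 'Hom(pres1 p, W))) => c u v; rewrite comp_lfunDl comp_lfunZl.
pose S := (pre @: hom_space (pres0 p) W)%VS.
have [/memv_imgP[b /hom_spaceP bh aE]|aS] := boolP (a \in S).
  by exists b => //; rewrite aE preE.
(* Some coordinate of the quotient by [S] separates [a] from [S]. *)
have [lam lamS lama] : exists2 lam : 'Hom(pres1 p, W) -> k^o,
    linear lam /\ (forall f, f \in S -> lam f = 0) & lam a <> 0.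
  pose co i (f : 'Hom(pres1 p, W)) : k^o := coord (vbasis {:quot S}) i (qproj S f).
  have [i ci] : exists i, co i a <> 0.
    apply: not_all_not_ex => c0; case/negP: aS; rewrite -qproj_eq0.
    rewrite (coord_vbasis (memvf (qproj S a))) big1 // => i _.
    by have /NNPP := c0 i; rewrite /co => ->; rewrite scale0r.
  exists (co i) => //; split=> [c u v|f]; rewrite /co; first by rewrite qproj_linear
    linearP.
  by rewrite -qproj_eq0 => /eqP->; rewrite linear0.
case: lamS => laml lamS.
pose pr w (z : P1s) : 'Hom(pres1 p, W) := (act_at w \o vsval z)%VF.
have prh w z : rhom (pr w z).
  by apply: rhom_comp (@act_at_hom _ _ _ w) _; apply/mem_homs; exact: subvsP.
have prE w z x : pr w z x = ract w (vsval z x) by rewrite comp_lfunE act_atE.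
have pr_linr w : linear (pr w).
  move=> c u v; apply/lfunP => x; rewrite add_lfunE scale_lfunE !prE -ract_linr.
  by rewrite add_lfunE scale_lfunE.
have pr_linl z : linear (pr^~ z).
  by move=> c u v; apply/lfunP => x; rewrite add_lfunE scale_lfunE !prE ract_linl.
have pr0 w (z : P1s) : z \in limg (homs_map d) -> lam (pr w z) = 0.
  case/memv_imgP => eta _ ->; apply: lamS; apply/memv_imgP.
  exists (act_at w \o vsval eta)%VF; last first.
    by rewrite preE -comp_lfunA /pr homs_mapE.
  apply/hom_spaceP; apply: rhom_comp (@act_at_hom _ _ _ w) _; apply/mem_homs; exact: subvsP.
pose G w (q : transpose p) : k^o := lam (pr w (vsval q)).
have Glin w : linear (G w) by move=> c u v; rewrite /G linearP pr_linr laml.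
have Gpr w z : G w (tr_pr z) = lam (pr w z).
  have /(pr0 w) := qproj_val (limg (homs_map d)) z.
  rewrite (linB (pr_linr w)) (linB laml) => /eqP.
  by rewrite subr_eq0 => /eqP.
pose g := linfun (fun w => linfun (G w) : 'Hom(transpose p, k^o)) : 'Hom(W, tau p).
have gE w q : (g w : 'Hom(transpose p, k^o)) q = G w q.
  rewrite /g (linfunE (W := 'Hom(transpose p, k^o))) ?linfunE //.
  move=> c u v; apply/lfunP => x; rewrite add_lfunE scale_lfunE !linfunE //.
  by rewrite /G pr_linl laml.
have /W0 g0 : rhom g.
  move=> w c; apply/lfunP => q; rewrite gE [RHS]comp_lfunE (linfunE (@lact_linr _ _
    (transpose p) c)).
  rewrite gE -(qprojK q) -[qproj _ _]/(tr_pr (vsval q)) -tr_prM !Gpr; congr lam.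
  apply/lfunP => x; rewrite !prE homs_lactE ractM //.
case: lama; have [m [x [xi xE]]] := dual_basis (@pres1_proj _ _ _ p).
(* The dual basis writes [a] as a sum of maps [pr w z], on each of which [lam] is a value of [g]. *)
have -> : a = \sum_i pr (a (x i)) (xi i).
  apply/lfunP => u; rewrite sum_lfunE {1}(xE u) linear_sum; apply: eq_bigr => i _.
  by rewrite prE; exact: ah.
rewrite (linS _ _ _ laml) big1 // => i _.
by rewrite -Gpr -gE g0 !zero_lfunE.
Qed.
End Tau.

Lemma tau_rigidP T : tau_rigid T <-> ext_projective T T.
Proof.
split=> [[p /tau_extends]|TT]; first exact: extends_ext_projective.
have [p] := min_presentation_ex T; exists p.
exact/extends_tau/ext_projective_extends.
Qed.
End Presentations.

(** * Independence of the functions dim Hom(T, -) *)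

Section HomDimensions.
Variables (k : fieldType) (A : falgType k).
Implicit Types R T U V W P Q E : rmod A.

Definition hom_dim U W := \dim (hom_space U W).

Lemma hom_dim_surj U V W (p : 'Hom(U, V)) : rhom p -> limg p = fullv ->
  (hom_dim V W <= hom_dim U W)%N.
Proof.
move=> ph ps; apply: (dimv_inj (f := fun g : 'Hom(V, W) => (g \o p)%VF)) => [c u v|g
  /hom_spaceP gh|g _ gp].
- by rewrite comp_lfunDl comp_lfunZl.
- by apply/hom_spaceP; exact: rhom_comp.
apply/lfunP => y; have /limg_fullP/(_ y)[x ->] := ps.
by rewrite -comp_lfunE gp !zero_lfunE.
Qed.

Lemma hom_dim_riso U V W : riso U V -> hom_dim U W = hom_dim V W.
Proof.
move=> UV; apply/eqP; rewrite eqn_leq; apply/andP; split.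
  by have [g gh [_ gs]] := riso_sym UV; exact: hom_dim_surj gs.
by have [g gh [_ gs]] := UV; exact: hom_dim_surj gs.
Qed.

(** Rank-nullity for restriction along [i]: its image is all of Hom(U, W) by extendability, and its
    kernel is Hom(V, W) embedded through [p]. *)
Lemma hom_dim_exact U E V W (i : 'Hom(U, E)) (p : 'Hom(E, V)) :
  rhom i -> rhom p -> limg i = lker p -> limg p = fullv -> extends_along i W ->
  hom_dim E W = (hom_dim V W + hom_dim U W)%N.
Proof.
move=> ih ph ip ps iW.
have pi x : p (i x) = 0 by apply/eqP; rewrite -memv_ker -ip memv_img ?memvf.
pose pre := linfun (fun b : 'Hom(E, W) => (b \o i)%VF).
have preE b : pre b = (b \o i)%VF.
  by apply: (linfunE (W := 'Hom(U, W))) => c u v; rewrite comp_lfunDl comp_lfunZl.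
have <- : \dim (pre @: hom_space E W) = hom_dim U W.
  congr (\dim _); apply/vspaceP => a; apply/memv_imgP/idP => [[b /hom_spaceP bh
    ->]|/hom_spaceP/iW[b bh <-]].
    by apply/hom_spaceP; rewrite preE; exact: rhom_comp.
  by exists b; rewrite ?preE //; apply/hom_spaceP.
rewrite /hom_dim -[LHS](limg_ker_dim pre); congr (_ + _)%N.
have fact h : h \in (hom_space E W :&: lker pre)%VS -> exists2 g : 'Hom(V, W), rhom g &
  (g \o p)%VF = h.
  rewrite memv_cap memv_ker => /andP[/hom_spaceP hh /eqP h0].
  apply: (factor_surj ph hh ps) => x /eqP; rewrite -memv_ker -ip => /memv_imgP[y _ ->].
  by rewrite -comp_lfunE -preE h0 zero_lfunE.
have pK v : p (p^-1%VF v) = v by apply: limg_lfunVK; rewrite ps memvf.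
apply/eqP; rewrite eqn_leq; apply/andP; split.
  apply: (dimv_inj (f := fun h : 'Hom(E, W) => (h \o p^-1)%VF)) => [c u v|h|h].
  - by rewrite comp_lfunDl comp_lfunZl.
  - case/fact => g gh <-; apply/hom_spaceP.
    suff -> : ((g \o p) \o p^-1)%VF = g by [].
    by apply/lfunP => v; rewrite !comp_lfunE pK.
  case/fact => g gh <- g0; suff -> : g = 0 by rewrite comp_lfun0l.
  rewrite -g0; apply/lfunP => v; by rewrite !comp_lfunE pK.
apply: (dimv_inj (f := fun g : 'Hom(V, W) => (g \o p)%VF)) => [c u v|g /hom_spaceP gh|g _
  gp].
- by rewrite comp_lfunDl comp_lfunZl.
- rewrite memv_cap memv_ker; apply/andP; split; first by apply/hom_spaceP; exact: rhom_comp.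
  rewrite preE; apply/eqP/lfunP => x.
  by rewrite !comp_lfunE pi zero_lfunE linear0.
by apply/lfunP => y; rewrite -[y]pK -comp_lfunE gp !zero_lfunE.
Qed.

Lemma hom_dim_dsum U V W : hom_dim (dsum U V) W = (hom_dim U W + hom_dim V W)%N.
Proof.
rewrite addnC; apply: (hom_dim_exact (i := in1 U V) (p := pr2 U V)).
- exact: in1_hom.
- exact: pr2_hom.
- apply/vspaceP => x; rewrite memv_ker pr2E; apply/memv_imgP/eqP => [[y _ ->]|x2].
    by rewrite in1E.
  by exists x.1; rewrite ?memvf // in1E -x2; case: x {x2}.
- by apply/limg_fullP => y; exists (0, y); rewrite pr2E.
move=> a ah; exists (a \o pr1 U V)%VF; first by apply: rhom_comp => //; exact: pr1_hom.
by apply/lfunP => x; rewrite !comp_lfunE /= pr1E in1E.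
Qed.

Lemma hom_dim_eq0 U W : (forall f : 'Hom(U, W), rhom f -> f = 0) -> hom_dim U W = 0%N.
Proof.
move=> UW; apply/eqP; rewrite dimv_eq0 -subv0; apply/subvP => f /hom_spaceP/UW->.
exact: mem0v.
Qed.

(** Realising Hom(U, S) inside Hom(U, V) lets dimensions be compared by inclusion. *)
Lemma hom_dim_submod U V (S : {vspace V}) (HS : submodule S) :
  exists E : {vspace 'Hom(U, V)},
    (forall f, f \in E <-> rhom f /\ (limg f <= S)%VS) /\ hom_dim U (submod HS) = \dim E.
Proof.
pose post := linfun (fun g : 'Hom(U, submod HS) => (sub_in HS \o g)%VF).
have postE g : post g = (sub_in HS \o g)%VF.
  by apply: (linfunE (W := 'Hom(U, V))) => c u v; rewrite comp_lfunDr comp_lfunZr.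
exists (post @: hom_space U (submod HS))%VS; split=> [f|]; last first.
  rewrite limg_dim_eq //; apply/eqP; rewrite -subv0; apply/subvP => g.
  rewrite memv_cap memv_ker memv0 postE => /andP[_ /eqP g0]; apply/eqP/lfunP => x.
  by rewrite zero_lfunE; apply: sub_in_inj; rewrite -comp_lfunE g0 zero_lfunE.
split=> [/memv_imgP[g /hom_spaceP gh ->]|[fh /subvP fS]].
  rewrite postE; split; first by apply: rhom_comp => //; exact: sub_in_hom.
  by apply/subvP => _ /memv_imgP[x _ ->]; rewrite comp_lfunE sub_in_mem.
have {}fS x : f x \in S by rewrite fS // memv_img ?memvf.
apply/memv_imgP; exists (to_sub HS f).
  by apply/hom_spaceP; exact: to_sub_hom.
by apply/lfunP => x; rewrite postE comp_lfunE to_subE.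
Qed.

(** Closure under sums is [indec_local]. *)
Lemma rad_space_ex U V : indecomposable U ->
  {S : {vspace 'Hom(U, V)} | forall f, f \in S <-> rhom f /\ ~ lbij f}.
Proof.
move=> Ui; have nb0 : ~ lbij (0 : 'Hom(U, V)).
  case=> k0 _; have [x []] := indecomposable_nz Ui.
  by apply: (proj2 (lker_trivP _) k0); rewrite zero_lfunE.
apply: ex_vspace; first by split=> //; exact: rhom0.
move=> a f g [fh nf] [gh ng]; split; first exact: rhomP.
have afh : rhom (a *: f) by rewrite -[a *: f]addr0; apply: rhomP => //; exact: rhom0.
case/(indec_local Ui afh gh) => // ab; have [a0|a0] := eqVneq a 0.
  by apply: nb0; move: ab; rewrite a0 scale0r.
apply: nf; have [K VK] := lbij_inv ab.
apply: (@lbij_of_cancel _ _ _ f (fun y => ((a *: f)^-1)%VF (a *: y))) => x.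
  by rewrite -[a *: f x]scale_lfunE K.
by apply: (scalerI a0); rewrite -[LHS]scale_lfunE VK.
Qed.

Definition rad_space U V (Ui : indecomposable U) := sval (rad_space_ex V Ui).
Lemma rad_spaceP U V (Ui : indecomposable U) (f : 'Hom(U, V)) :
  f \in rad_space V Ui <-> rhom f /\ ~ lbij f.
Proof. exact: (svalP (rad_space_ex V Ui)). Qed.

Section Independence.
Variables (r : nat) (T : 'I_r -> rmod A).
Hypothesis Ti : forall i, indecomposable (T i).
Hypothesis Tinj : forall i j, riso (T i) (T j) -> i = j.

(** Only the sources indexed by [I] count, so that [I] can be taken to be the support of a
    relation. *)
Definition rad_img (I : pred 'I_r) i : {vspace T i} :=
  (\sum_(l | I l) imgs (rad_space (T i) (Ti l)))%VS.

Lemma rad_img_sup (I : pred 'I_r) i l (f : 'Hom(T l, T i)) :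
  I l -> rhom f -> ~ lbij f -> (limg f <= rad_img I i)%VS.
Proof.
move=> Il fh nf; apply: subv_trans (sumv_sup l Il (subvv _)).
by apply: imgs_sup; apply/rad_spaceP.
Qed.

Lemma rad_img_sub (I : pred 'I_r) i (S : {vspace T i}) :
  (forall l (f : 'Hom(T l, T i)), I l -> rhom f -> ~ lbij f -> (limg f <= S)%VS) ->
  (rad_img I i <= S)%VS.
Proof.
move=> HS; apply/subv_sumP => l Il; apply: imgs_sub => f /rad_spaceP[fh nf].
exact: HS.
Qed.

(* Nakayama: let S be a maximal proper subfunctor of l |-> T_l (l in I) and v not
   in S_j.  Then T_l = S_l + Hom(T_j, T_l) v for all l, so if v is in the radical
   image of T_j then (1 - rho) v is in S_j for some radical rho, a contradiction. *)
Lemma rad_img_proper (I : pred 'I_r) i0 : I i0 -> exists2 i, I i & rad_img I i <> fullv.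
Proof.
move=> Ii0; apply: NNPP => no.
have Jfull i : I i -> rad_img I i = fullv.
  by move=> Ii; apply: NNPP => ?; apply: no; exists i.
pose closed_fam (S : forall j, {vspace T j}) := forall j l (f : 'Hom(T j, T l)),
  I j -> I l -> rhom f -> (f @: S j <= S l)%VS.
pose Q n := exists S, [/\ closed_fam S, exists2 j, I j & S j <> fullv
  & (\sum_j \dim (S j))%N = n].
have [||n [[S [Scl [j Ij Sj] Sn]] nmax]] := @ex_max Q (\sum_j \dim {:T j})%N.
- exists 0%N, (fun j => 0%VS); split; first by move=> *; rewrite limg0 sub0v.
    exists i0 => // f0; have [x []] := indecomposable_nz (Ti i0).
    by apply/eqP; rewrite -memv0 f0 memvf.
  by rewrite big1 // => *; rewrite dimv0.
- by move=> n [S [_ _ <-]]; apply: leq_sum => l _; apply: dimvS (subvf _).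
have [v vS] : exists v, v \notin S j.
  apply: not_all_not_ex => vS; apply: Sj; apply/vspaceP => v; rewrite memvf.
  by apply/negPn/negP; exact: vS.
pose ev l := linfun (fun f : 'Hom(T j, T l) => f v).
have evE l f : ev l f = f v.
  by apply: (linfunE (V := 'Hom(T j, T l))) => c f1 f2; rewrite add_lfunE scale_lfunE.
pose S' l := (S l + ev l @: hom_space (T j) (T l))%VS.
have S'P l x : x \in S' l -> exists2 s, s \in S l & exists2 g, rhom g & x = s + g v.
  by case/memv_addP => s sS [_ /memv_imgP[g /hom_spaceP gh ->] ->]; exists s => //;
    exists g; rewrite // evE.
have S'I l s g : s \in S l -> rhom g -> s + g v \in S' l.
  by move=> sS gh; rewrite memv_add // -evE memv_img //; apply/hom_spaceP.
have S'cl : closed_fam S'.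
  move=> a b f Ia Ib fh; apply/subvP => _ /memv_imgP[_ /S'P[s sS [g gh ->]] ->].
  rewrite linearD /= -[f (g v)]comp_lfunE; apply: S'I; last exact: rhom_comp.
  by apply: (subvP (Scl _ _ _ Ia Ib fh)); rewrite memv_img.
have S'full l : I l -> S' l = fullv.
  move=> Il; apply: NNPP => nS'.
  have /nmax : Q (\sum_j \dim (S' j))%N by exists S'; split=> //; exists l.
  rewrite -Sn leqNgt => /negP; apply.
  rewrite (bigD1 j) //= [X in (_ < X)%N](bigD1 j) //= -addSn leq_add //.
    rewrite (ltn_leqif (dimv_leqif_sup (addvSl _ _))); apply: contra vS => /subvP; apply.
    by rewrite -[v]add0r -[X in _ + X]id_lfunE S'I ?mem0v //; exact: rhom_id.
  by apply: leq_sum => l' _; apply: dimvS (addvSl _ _).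
have JZ : (rad_img I j <= S j + ev j @: rad_space (T j) (Ti j))%VS.
  apply: rad_img_sub => l f Il fh nf; apply/subvP => _ /memv_imgP[y _ ->].
  have /S'P[s sS [g gh ->]] : y \in S' l by rewrite S'full ?memvf.
  rewrite linearD /= -[f (g v)]comp_lfunE memv_add //.
    by apply: (subvP (Scl _ _ _ Il Ij fh)); rewrite memv_img.
  rewrite -evE memv_img //; apply/rad_spaceP; split; first exact: rhom_comp.
  by move=> /(indec_comp (Ti l) (proj1 (Ti j)) fh gh)[].
have : v \in (S j + ev j @: rad_space (T j) (Ti j))%VS.
  by apply: (subvP JZ); rewrite Jfull ?memvf.
case/memv_addP => s sS [_ /memv_imgP[rho /rad_spaceP[rh nr] ->] vE].
rewrite evE in vE.
have ch : rhom (\1 - rho)%VF by apply: rhomB => //; exact: rhom_id.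
have /(indec_local (Ti j) rh ch)[//|cb] : lbij (rho + (\1 - rho))%VF.
  by rewrite addrC subrK; exact: lbij_id.
have [cK _] := lbij_inv cb.
have cv : (\1 - rho)%VF v = s.
  by rewrite add_lfunE opp_lfunE id_lfunE {1}vE addrK.
case/negP: vS; rewrite -[v]cK cv.
have cVh := rhom_inv ch cb.
by apply: (subvP (Scl _ _ _ Ij Ij cVh)); rewrite memv_img.
Qed.

(* Evaluate a relation supported on I at T_i and at its radical image: the two
   values of dim Hom(T_l, -) agree for l in I different from i, but not for l = i. *)
Lemma hom_dim_indep (c : 'I_r -> rat) :
    (forall W, (forall S : {vspace W},
        (forall i (f : 'Hom(T i, W)), rhom f -> (limg f <= S)%VS) -> S = fullv) ->
      \sum_i c i * (hom_dim (T i) W)%:R = 0) ->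
  forall i, c i = 0.
Proof.
move=> crel i0; apply/eqP; apply: contraT => ci0.
pose I : pred 'I_r := fun i => c i != 0.
have [i Ii /eqP Jn] := @rad_img_proper I i0 ci0.
have HJ : submodule (rad_img I i).
  move=> x a xJ; suff sub : (rad_img I i <= linfun (fun x => ract x a) @^-1: rad_img I
    i)%VS.
    by have := subvP sub _ xJ; rewrite -memv_preim (linfunE (ract_linl a)).
  apply: rad_img_sub => l f Il fh nf; apply/subvP => _ /memv_imgP[y _ ->].
  rewrite -memv_preim (linfunE (ract_linl a)) -fh.
  by apply: (subvP (rad_img_sup Il fh nf)); rewrite memv_img ?memvf.
have relT : \sum_l c l * (hom_dim (T l) (T i))%:R = 0.
  apply: crel => S /(_ i \1%VF (@rhom_id _ _ _)) TS; apply/eqP.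
  rewrite eqEsubv subvf; apply: subv_trans TS; apply/subvP => x _.
  by rewrite -[x]id_lfunE memv_img ?memvf.
have relJ : \sum_l c l * (hom_dim (T l) (submod HJ))%:R = 0.
  apply: crel => S HS; apply/eqP; rewrite eqEsubv subvf /=.
  have JS : (rad_img I i <= sub_in HJ @: S)%VS.
    apply: rad_img_sub => l f Il fh nf; have fJ x : f x \in rad_img I i.
      by apply: (subvP (rad_img_sup Il fh nf)); rewrite memv_img ?memvf.
    apply/subvP => _ /memv_imgP[y _ ->]; rewrite -(to_subE HJ (fJ y)) memv_img //.
    by apply: (subvP (HS _ _ (@to_sub_hom _ _ _ _ HJ _ _ fh fJ))); rewrite memv_img ?memvf.
  apply/subvP => x _; have xJ : sub_in HJ x \in (sub_in HJ @: S)%VS by apply/(subvP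
    JS)/sub_in_mem.
  by have /memv_imgP[s sS /sub_in_eq->] := xJ.
have : c i * ((hom_dim (T i) (T i))%:R - (hom_dim (T i) (submod HJ))%:R) = 0.
  have := congr2 (fun x y : rat => x - y) relT relJ.
  rewrite subrr -sumrB (bigD1 i) //= -mulrBr big1 ?addr0 //.
  move=> l nli; have [cl|Il] := eqVneq (c l) 0; first by rewrite cl !mul0r subrr.
  have [E [EP ->]] := hom_dim_submod (T l) HJ.
  suff -> : E = hom_space (T l) (T i) by rewrite subrr.
  apply/vspaceP => f; apply/idP/idP => [/EP[fh _]|/hom_spaceP fh]; first exact/hom_spaceP.
  apply/EP; split=> //; apply: rad_img_sup => // fb.
  by case/eqP: nli; apply: Tinj; exists f.
(* Equal dimensions would force the identity of [T i] to take its values in the radical image, which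
   is proper. *)
move/eqP; rewrite mulf_eq0 (negPf Ii) /= subr_eq0 eqr_nat.
have [E [EP ->]] := hom_dim_submod (T i) HJ => /eqP dE.
have EH : E = hom_space (T i) (T i).
  apply/eqP; rewrite eqEdim [X in (X <= _)%N]dE leqnn andbT.
  by apply/subvP => f /EP[fh _]; apply/hom_spaceP.
have /EP[_ J1] : \1%VF \in E by rewrite EH; apply/hom_spaceP; exact: rhom_id.
case/negP: Jn; rewrite eqEsubv subvf; apply: subv_trans J1; apply/subvP => x _.
by rewrite -[x]id_lfunE memv_img ?memvf.
Qed.

End Independence.
End HomDimensions.

(** * g-vectors *)

Section Span.
Variable D : Type.
Implicit Types g : D -> rat.

(** [D] will be the class of all modules, so independence and span are expressed by finite families
    of coefficients. *)
Definition lin_indep m (f : 'I_m -> D -> rat) :=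
  forall c : 'I_m -> rat, (forall d, \sum_i c i * f i d = 0) -> forall i, c i = 0.
Definition in_span m (f : 'I_m -> D -> rat) g :=
  exists c : 'I_m -> rat, forall d, g d = \sum_i c i * f i d.

Lemma in_span_mem m (f : 'I_m -> D -> rat) i : in_span f (f i).
Proof.
exists (fun j => (j == i)%:R) => d; rewrite (bigD1 i) //= eqxx mul1r big1 ?addr0 // => j.
by move=> /negPf->; rewrite mul0r.
Qed.

Lemma in_span_lin m (f : 'I_m -> D -> rat) a g g' : in_span f g -> in_span f g' ->
  in_span f (fun d => a * g d + g' d).
Proof.
move=> [c cE] [c' c'E]; exists (fun i => a * c i + c' i) => d.
rewrite cE c'E mulr_sumr -big_split; apply: eq_bigr => i _ /=.
by rewrite mulrDl mulrA.
Qed.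

Lemma in_span_ext m (f : 'I_m -> D -> rat) g g' : g =1 g' -> in_span f g -> in_span f g'.
Proof. by move=> E [c cE]; exists c => d; rewrite -E. Qed.

Lemma in_span0 m (f : 'I_m -> D -> rat) : in_span f (fun=> 0).
Proof. by exists (fun=> 0) => d; rewrite big1 // => i _; rewrite mul0r. Qed.

Lemma in_span_sum m n (f : 'I_m -> D -> rat) (v : 'I_n -> D -> rat) (c : 'I_n -> rat) :
  (forall j, in_span f (v j)) -> in_span f (fun d => \sum_j c j * v j d).
Proof.
elim: n v c => [|n IH] v c vf.
  by apply: in_span_ext (in_span0 f) => d; rewrite big_ord0.
apply: (@in_span_ext _ _ (fun d => c ord0 * v ord0 d + \sum_j c (lift ord0 j) * v (lift
  ord0 j) d)).
  by move=> d; rewrite big_ord_recl.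
by apply: in_span_lin => //; apply: (IH (fun j => v (lift ord0 j)) (fun j => c (lift ord0
  j))).
Qed.

Lemma in_span_trans m n (f : 'I_m -> D -> rat) (v : 'I_n -> D -> rat) g :
  in_span v g -> (forall j, in_span f (v j)) -> in_span f g.
Proof.
by move=> [c cE] /(in_span_sum c); apply: in_span_ext => d; rewrite cE.
Qed.

(** A row of the left kernel of the coefficient matrix is a relation between the [f i]. *)
Lemma indep_span_mx m n (f : 'I_m -> D -> rat) (v : 'I_n -> D -> rat) :
  lin_indep f -> (forall i, in_span v (f i)) ->
  exists2 M : 'M[rat]_(m, n), row_free M & forall i d, f i d = \sum_j M i j * v j d.
Proof.
move=> fi /choice[c cE]; exists (\matrix_(i, j) c i j); last first.
  by move=> i d; rewrite cE; apply: eq_bigr => j _; rewrite mxE.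
set M := \matrix_(i, j) _; rewrite -kermx_eq0; apply/eqP/matrixP => a i.
rewrite [RHS]mxE; apply: (fi (fun i => kermx M a i)) => d.
transitivity (\sum_j (kermx M *m M) a j * v j d); last first.
  by rewrite mulmx_ker big1 // => j _; rewrite mxE mul0r.
transitivity (\sum_i' \sum_j kermx M a i' * (M i' j * v j d)).
  by apply: eq_bigr => i' _; rewrite cE mulr_sumr; apply: eq_bigr => j _; rewrite [M _
    _]mxE.
rewrite exchange_big; apply: eq_bigr => j _ /=; rewrite [(_ *m _) _ _]mxE mulr_suml.
by apply: eq_bigr => i' _; rewrite mulrA.
Qed.

Lemma indep_span_leq m n (f : 'I_m -> D -> rat) (v : 'I_n -> D -> rat) :
  lin_indep f -> (forall i, in_span v (f i)) -> (m <= n)%N.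
Proof.
move=> fi /(indep_span_mx fi)[M Mf _].
by apply: leq_trans (rank_leq_col M); rewrite (eqP Mf).
Qed.

(** The coefficient matrix is square and row free, hence invertible. *)
Lemma indep_span_full n (f v : 'I_n -> D -> rat) :
  lin_indep f -> (forall i, in_span v (f i)) -> forall j, in_span f (v j).
Proof.
move=> fi /(indep_span_mx fi)[M]; rewrite row_free_unit => Mu ME j.
exists (fun i => invmx M j i) => d.
transitivity (\sum_l (invmx M *m M) j l * v l d).
  rewrite mulVmx // (bigD1 j) //= mxE eqxx mul1r big1 ?addr0 // => l.
  by rewrite mxE eq_sym => /negPf->; rewrite mul0r.
under [RHS]eq_bigr => i _ do rewrite ME mulr_sumr.
rewrite exchange_big; apply: eq_bigr => l _ /=; rewrite mxE mulr_suml.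
by apply: eq_bigr => i _; rewrite mulrA.
Qed.

Definition fam_cat m n (f : 'I_m -> D -> rat) (g : 'I_n -> D -> rat) (i : 'I_(m + n)) : D
  -> rat :=
  match split i with inl a => f a | inr b => g b end.

Lemma fam_cat_l m n (f : 'I_m -> D -> rat) (g : 'I_n -> D -> rat) i : fam_cat f g (lshift
  n i) = f i.
Proof. by rewrite /fam_cat -[lshift n i]/(unsplit (inl i)) unsplitK. Qed.
Lemma fam_cat_r m n (f : 'I_m -> D -> rat) (g : 'I_n -> D -> rat) i : fam_cat f g (rshift
  m i) = g i.
Proof. by rewrite /fam_cat -[rshift m i]/(unsplit (inr i)) unsplitK. Qed.

Lemma fam_cat_all m n (f : 'I_m -> D -> rat) (g : 'I_n -> D -> rat) (Q : (D -> rat) ->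
  Prop) :
  (forall i, Q (f i)) -> (forall j, Q (g j)) -> forall l, Q (fam_cat f g l).
Proof. by move=> Qf Qg l; rewrite /fam_cat; case: (split l). Qed.
End Span.

Section GVectors.
Variables (k : fieldType) (A : falgType k).
Implicit Types R T U V W P Q E : rmod A.

Definition hom_dimq U W : rat := (hom_dim U W)%:R.
(** An arbitrary choice; by [gvec_riso] the g-vector does not depend on it. *)
Definition minpres T : min_presentation T := epsilon (min_presentation_ex T) (fun=> True).
(* The g-vector of T, as the functional on dimension vectors that it defines. *)
Definition gvec T (p : min_presentation T) W : rat := hom_dimq (pres0 p) W - hom_dimq
  (pres1 p) W.

Lemma hom_dimq_indep r (T : 'I_r -> rmod A) : (forall i, indecomposable (T i)) ->
  (forall i j, riso (T i) (T j) -> i = j) -> lin_indep (fun i => hom_dimq (T i)).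
Proof. by move=> Ti Tinj c crel; apply: hom_dim_indep => // W _; exact: crel. Qed.

(** Every indecomposable projective is a summand of the regular module; the rest is additivity of
    dim Hom. *)
Lemma hom_dimq_proj_span r (s : 'I_r -> rmod A) P :
  (forall U, indecomposable U -> retract U (regular_r A) -> exists i, riso U (s i)) ->
  projective P -> in_span (fun i => hom_dimq (s i)) (hom_dimq P).
Proof.
move=> sc; move: P; apply: krull_schmidt_ind => [U V UV UP Vp|U U0 _|U Ui Up|V W VP WP VWp].
- apply: in_span_ext (UP _) => [W|].
    by rewrite /hom_dimq (hom_dim_riso W UV).
  exact: projective_retract (retract_riso UV) Vp.
- apply: in_span_ext (in_span0 _) => W; rewrite /hom_dimq hom_dim_eq0 // => f _.
  by apply/lfunP => x; rewrite (U0 x) !linear0.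
- have [n /(retract_dpow Ui)/(sc _ Ui)[i Us]] := projective_free Up.
  by apply: in_span_ext (in_span_mem _ i) => W; rewrite /hom_dimq (hom_dim_riso W Us).
apply: in_span_ext (in_span_lin 1 (VP _) (WP _)) => [X||].
- by rewrite mul1r /hom_dimq hom_dim_dsum natrD.
- exact: projective_retract (retract_dsum1 _ _) VWp.
exact: projective_retract (retract_dsum2 _ _) VWp.
Qed.

Lemma gvec_span r (s : 'I_r -> rmod A) T (p : min_presentation T) :
  (forall U, indecomposable U -> retract U (regular_r A) -> exists i, riso U (s i)) ->
  in_span (fun i => hom_dimq (s i)) (gvec p).
Proof.
move=> sc; have P0 := hom_dimq_proj_span sc (@pres0_proj _ _ _ p).
have P1 := hom_dimq_proj_span sc (@pres1_proj _ _ _ p).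
by apply: in_span_ext (in_span_lin (-1) P1 P0) => W; rewrite mulN1r addrC.
Qed.

Lemma gvec_hom_dim T (p : min_presentation T) W : ext_projective T W -> gvec p W =
  hom_dimq T W.
Proof.
move=> /(ext_projective_extends (p := p)) TW.
rewrite /gvec /hom_dimq (hom_dim_exact (@pres_d_hom _ _ _ p) (@pres_e_hom _ _ _ p)
  (pres_exact p) (pres_e_surj p) TW).
by rewrite natrD addrK.
Qed.

Lemma hom_dimq_proj0 P T W : projective P -> (forall f : 'Hom(P, T), rhom f -> f = 0) ->
  Fac T W -> hom_dimq P W = 0.
Proof.
move=> Pp PT [n [g gh gs]]; rewrite /hom_dimq hom_dim_eq0 // => f fh.
have [f' f'h <-] := Pp _ _ g f gh fh gs.
suff -> : f' = 0 by rewrite comp_lfun0r.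
apply/lfunP => x; rewrite zero_lfunE; apply/ffunP => i; rewrite ffunE -dpow_prE -comp_lfunE.
by rewrite (PT (dpow_pr T i \o f')%VF) ?zero_lfunE //; apply: rhom_comp => //; exact:
  dpow_pr_hom.
Qed.

(* On Fac T, the g-vector of s_l is dim Hom(s_l, -) and dim Hom(q_j, -) vanishes;
   this separates the coefficients of the s_l from those of the q_j. *)
Lemma gvec_indep T m n (s : 'I_m -> rmod A) (q : 'I_n -> rmod A)
    (p : forall i, min_presentation (s i)) :
  ext_projective T T -> (forall i, indecomposable (s i) /\ retract (s i) T) ->
  (forall i j, riso (s i) (s j) -> i = j) ->
  (forall j, indecomposable (q j) /\ projective (q j)) ->
  (forall i j, riso (q i) (q j) -> i = j) ->
  (forall j (f : 'Hom(q j, T)), rhom f -> f = 0) ->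
  lin_indep (fam_cat (fun i => gvec (p i)) (fun j => hom_dimq (q j))).
Proof.
move=> TT si sinj qi qinj qT c crel.
have rel W : \sum_i c (lshift n i) * gvec (p i) W + \sum_j c (rshift m j) * hom_dimq (q
  j) W = 0.
  rewrite -[RHS](crel W) big_split_ord; congr (_ + _); apply: eq_bigr => i _.
    by rewrite fam_cat_l.
  by rewrite fam_cat_r.
have c1 : forall i, c (lshift n i) = 0.
  apply: (@hom_dim_indep _ _ _ s) => [i|//|W sW]; first by case: (si i).
  have TW : Fac T W.
    apply/FacP => S HS; apply: sW => i f fh.
    exact: Fac_limg (Fac_retract (proj2 (si i))) fh HS.
  have := rel W; rewrite [X in _ + X]big1 ?addr0 => [relW|j _]; last first.
    by rewrite (hom_dimq_proj0 (proj2 (qi j)) (qT j) TW) mulr0.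
  rewrite -[RHS]relW; apply: eq_bigr => i _; rewrite gvec_hom_dim //.
  apply: ext_projective_sub (ext_projective_retract (proj2 (si i)) TT) => V.
  exact: Fac_trans.
have c2 : forall j, c (rshift m j) = 0.
  apply: (@hom_dimq_indep _ q) => [j|//|W]; first by case: (qi j).
  by have := rel W; rewrite big1 ?add0r // => i _; rewrite c1 mul0r.
by move=> l; rewrite -(splitK l); case: (split l).
Qed.

(** A lift exists by projectivity; its image and the kernel of [f'] together span [Q], so
    superfluity makes it surjective. The covers are onto their images only, so that the lemma serves
    both [pres_e] and [pres_d]. *)
Lemma cover_lift (P Q X Y : rmod A) (f : 'Hom(P, X)) (f' : 'Hom(Q, Y)) (h : 'Hom(X, Y)) :
  projective P -> rhom f -> rhom f' -> rhom h -> superfluous (lker f') ->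
  (h @: limg f)%VS = limg f' ->
  exists psi : 'Hom(P, Q), [/\ rhom psi, (f' \o psi)%VF = (h \o f)%VF & limg psi = fullv].
Proof.
move=> Pp fh f'h hh f'min hf.
have Hs := submodule_limg f'h.
have fm y : f' y \in limg f' by rewrite memv_img ?memvf.
have hm x : (h \o f)%VF x \in limg f' by rewrite -hf comp_lfunE !memv_img ?memvf.
have f's : limg (to_sub Hs f') = fullv.
  apply/limg_fullP => y; have := sub_in_mem y => /memv_imgP[z _ yE].
  by exists z; apply: sub_in_eq; rewrite to_subE.
have [psi psih psiE] := Pp _ _ _ _ (@to_sub_hom _ _ _ _ Hs _ _ f'h fm)
  (@to_sub_hom _ _ _ _ Hs _ _ (rhom_comp hh fh) hm) f's.
have {}psiE x : f' (psi x) = h (f x).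
  have /lfunP/(_ x)/(congr1 (sub_in Hs)) := psiE.
  by rewrite comp_lfunE !to_subE // comp_lfunE.
exists psi; split=> //; first by apply/lfunP => x; rewrite !comp_lfunE psiE.
apply: f'min; first exact: submodule_limg.
apply/vspaceP => y; rewrite memvf.
have /memv_imgP[_ /memv_imgP[x _ ->] E] : f' y \in (h @: limg f)%VS by rewrite hf.
rewrite -[y](subrK (psi x)) addrC memv_add ?memv_img ?memvf //.
by rewrite memv_ker linearB /= psiE -E subrr.
Qed.

Lemma surj_bij (P Q : rmod A) (f : 'Hom(P, Q)) (g : 'Hom(Q, P)) :
  limg f = fullv -> limg g = fullv -> lbij f.
Proof.
move=> fs gs; split=> //; apply/eqP; rewrite -dimv_eq0.
have := limg_ker_dim f fullv; rewrite fs capfv => E.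
have := limg_ker_dim g fullv; rewrite gs capfv => E'.
lia.
Qed.

(** Uniqueness of minimal presentations, in the form of surjections. Applied in both directions it
    forces equal dimensions, which makes the surjections bijective. *)
Lemma min_pres_surj U V (p : min_presentation U) (q : min_presentation V) : riso U V ->
  (exists2 f : 'Hom(pres0 p, pres0 q), rhom f & limg f = fullv) /\
  (exists2 f : 'Hom(pres1 p, pres1 q), rhom f & limg f = fullv).
Proof.
move=> [h hh [hk hs]].
have he : (h @: limg (pres_e p))%VS = limg (pres_e q) by rewrite !pres_e_surj.
have [psi [psih psiE psis]] := cover_lift (@pres0_proj _ _ _ p)
  (@pres_e_hom _ _ _ p) (@pres_e_hom _ _ _ q) hh (@pres_e_min _ _ _ q) he.
split; first by exists psi.
have {}psiE x : pres_e q (psi x) = h (pres_e p x) by rewrite -!comp_lfunE psiE.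
have hd : (psi @: limg (pres_d p))%VS = limg (pres_d q).
  rewrite !pres_exact; apply/vspaceP => y; apply/memv_imgP/idP => [[x]|].
    by rewrite !memv_ker => /eqP xk ->; rewrite psiE xk linear0.
  have /limg_fullP/(_ y)[x ->] := psis; rewrite memv_ker psiE => /eqP/(proj2 (lker_trivP
    h) hk) xk.
  by exists x => //; rewrite memv_ker xk.
have [chi [chih _ chis]] := cover_lift (@pres1_proj _ _ _ p)
  (@pres_d_hom _ _ _ p) (@pres_d_hom _ _ _ q) psih (@pres_d_min _ _ _ q) hd.
by exists chi.
Qed.

Lemma gvec_riso U V (p : min_presentation U) (q : min_presentation V) W :
  riso U V -> gvec p W = gvec q W.
Proof.
move=> UV; have [[f fh fs] [g gh gs]] := min_pres_surj p q UV.
have [[f' fh' fs'] [g' gh' gs']] := min_pres_surj q p (riso_sym UV).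
have fb := surj_bij fs fs'; have gb := surj_bij gs gs'.
by rewrite /gvec /hom_dimq (hom_dim_riso W (ex_intro2 _ _ f fh fb)) (hom_dim_riso W
  (ex_intro2 _ _ g gh gb)).
Qed.
End GVectors.

(** * Corners and induction *)

Section CornerModules.
Variables (k : fieldType) (A L : falgType k) (i : A -> L).
Hypotheses (i_lin : linear i) (iM : {morph i : x y / x * y}).
Local Notation corner := (corner i_lin iM).

(* As i need not be unital, such an f takes its values in W (i 1). *)
Definition ihom (X : rmod A) (W : rmod L) (f : 'Hom(X, W)) :=
  forall x a, f (ract x a) = ract (f x) (i a).

Lemma ihom_fix (X : rmod A) (W : rmod L) (f : 'Hom(X, W)) x :
  ihom f -> ract (f x) (i 1) = f x.
Proof. by move=> fh; rewrite -fh ract1. Qed.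

Lemma ihom_rhom (X Y : rmod A) (W : rmod L) (g : 'Hom(Y, W)) (f : 'Hom(X, Y)) :
  ihom g -> rhom f -> ihom (g \o f)%VF.
Proof. by move=> gh fh x a; rewrite !comp_lfunE fh gh. Qed.

Lemma rhom_ihom (X : rmod A) (V W : rmod L) (g : 'Hom(V, W)) (f : 'Hom(X, V)) :
  rhom g -> ihom f -> ihom (g \o f)%VF.
Proof. by move=> gh fh x a; rewrite !comp_lfunE fh gh. Qed.

Definition corner_in (W : rmod L) : 'Hom(corner W, W) := linfun (vsval : corner W -> W).
Lemma corner_inE W x : corner_in W x = vsval x.
Proof. by apply: linfunE => a y z; rewrite linearP. Qed.
Lemma corner_in_hom W : ihom (corner_in W).
Proof. by move=> x a; rewrite !corner_inE /= vsprojK // corner_mem_ract. Qed.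
Lemma corner_in_inj W : injective (corner_in W).
Proof. by move=> x y; rewrite !corner_inE; exact: val_inj. Qed.
Lemma corner_in_ker W : lker (corner_in W) = 0%VS.
Proof. by apply/lker_trivP => x x0; apply: corner_in_inj; rewrite x0 linear0. Qed.

Lemma corner_onto W w : ract w (i 1) = w -> exists x, w = corner_in W x.
Proof.
move=> we; exists (vsproj (corner_space i W) w).
by rewrite corner_inE vsprojK //; apply/(corner_mem iM).
Qed.

Lemma to_corner (X : rmod A) (W : rmod L) (f : 'Hom(X, W)) : ihom f ->
  exists2 g : 'Hom(X, corner W), rhom g & (corner_in W \o g)%VF = f.
Proof.
move=> fh; have gK x : corner_in W ((corner_in W)^-1%VF (f x)) = f x.
  apply: limg_lfunVK; have [y ->] := corner_onto (ihom_fix x fh).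
  by rewrite memv_img ?memvf.
exists ((corner_in W)^-1 \o f)%VF; last by apply/lfunP => x; rewrite !comp_lfunE gK.
by move=> x a; rewrite !comp_lfunE; apply: corner_in_inj; rewrite corner_in_hom !gK fh.
Qed.

Lemma corner_map (V W : rmod L) (f : 'Hom(V, W)) : rhom f ->
  exists2 g : 'Hom(corner V, corner W), rhom g & forall x, corner_in W (g x) = f
    (corner_in V x).
Proof.
move=> fh; have [g gh gE] := to_corner (rhom_ihom fh (@corner_in_hom V)).
by exists g => // x; rewrite -comp_lfunE gE comp_lfunE.
Qed.

Lemma corner_fix (W : rmod L) x : ract (corner_in W x) (i 1) = corner_in W x.
Proof. exact: ihom_fix (@corner_in_hom W). Qed.

Lemma corner_lift (V W : rmod L) (f : 'Hom(V, W)) x v : rhom f -> f v = corner_in W x ->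
  exists y, f (corner_in V y) = corner_in W x.
Proof.
move=> fh fv; have [|y yE] := @corner_onto V (ract v (i 1)).
  by rewrite -ractM -iM mulr1.
by exists y; rewrite -yE fh fv corner_fix.
Qed.

(** Let e = [i 1]. A preimage t of w = we in a power of [T] can be replaced by te, whose components
    lie in the corner of [T]. *)
Lemma Fac_corner (T W : rmod L) : Fac T W -> Fac (corner T) (corner W).
Proof.
move=> [n [g gh /limg_fullP gs]]; apply/FacP => S HS; apply/vspaceP => w; rewrite memvf.
have [t tE] := gs (corner_in W w).
have wE : corner_in W w = \sum_l g (dpow_in T l (ract (t l) (i 1))).
  rewrite -[LHS]corner_fix tE -gh {1}(dpow_split t) (linS _ _ _ (ract_linl _)) linear_sum.
  by apply: eq_bigr => l _; rewrite /= dpow_in_hom.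
have /choice[m mE] l : exists y, corner_in W y = g (dpow_in T l (ract (t l) (i 1))) /\ y
  \in S.
  have gl : rhom (g \o dpow_in T l)%VF by apply: rhom_comp => //; exact: dpow_in_hom.
  have [h hh hE] := corner_map gl.
  have [|z zE] := @corner_onto T (ract (t l) (i 1)); first by rewrite -ractM -iM mulr1.
  exists (h z); rewrite hE -zE comp_lfunE; split=> //.
  by apply: (subvP (HS _ hh)); rewrite memv_img ?memvf.
have -> : w = \sum_l m l.
  by apply: corner_in_inj; rewrite wE linear_sum; apply: eq_bigr => l _; case: (mE l).
by apply: rpred_sum => l _; case: (mE l).
Qed.

Section Induction.
(** Through [ij] and [ji], [j] compresses l to e l e with e = [i 1] and identifies e L e with A. *)
Variable j : L -> A.
Hypotheses (j_lin : linear j) (ij : forall l, i (j l) = i 1 * l * i 1)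
  (ji : cancel i j).

Local Notation E := (corner_ideal i_lin iM).
Definition ind (X : rmod A) : rmod L := tens_rmod X E.

Definition ideal_one : E := vsproj (ideal_space i) (i 1).
Lemma ideal_oneE : vsval ideal_one = i 1.
Proof. by rewrite /ideal_one vsprojK //; apply/(ideal_mem iM); rewrite -iM mulr1. Qed.

Lemma ideal_one_act (l : E) : bract ideal_one (vsval l) = l.
Proof.
apply: val_inj; rewrite /= ideal_oneE.
have /(ideal_mem iM) E1 : vsval l \in ideal_space i by exact: subvsP.
by rewrite E1 vsprojK // subvsP.
Qed.

Section Unit.
Variable X : rmod A.

(** The unit of the adjunction between [ind] and [corner], followed by the inclusion of the
    corner. *)
Definition eta : 'Hom(X, ind X) := linfun (fun x => pure x ideal_one : ind X).
Lemma etaE x : eta x = pure x ideal_one.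
Proof. by apply: (linfunE (W := ind X)); have [] := pure_bilin X (bimod_l E). Qed.

Lemma pure_eta x (l : E) : pure x l = ract (eta x) (vsval l) :> ind X.
Proof. by rewrite etaE -{1}[l]ideal_one_act; apply/esym/tens_ractE. Qed.

Lemma eta_hom : ihom eta.
Proof.
move=> x a; rewrite [RHS](_ : _ = pure x (bract ideal_one (i a) : E)); last first.
  by rewrite etaE; exact: tens_ractE.
rewrite etaE (proj2 (pure_balanced X (bimod_l E))); congr pure.
by apply: val_inj; rewrite /= ideal_oneE -!iM mul1r mulr1.
Qed.

Lemma ind_ext (W : rmod L) (f g : 'Hom(ind X, W)) : rhom f -> rhom g ->
  (forall x, f (eta x) = g (eta x)) -> f = g.
Proof.
move=> fh gh fg; apply/lfunP; apply: tens_ext => [c u v|c u v|x l].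
- exact: linearP.
- exact: linearP.
by rewrite pure_eta fh gh fg.
Qed.

Lemma ind_gen (S : {vspace ind X}) : submodule S -> (forall x, eta x \in S) -> S = fullv.
Proof.
move=> HS eS; apply/eqP; rewrite eqEsubv subvf; apply/subvP => w _.
rewrite -(quot_pr_eq0 HS); apply/eqP.
suff -> : quot_pr HS = 0 by rewrite zero_lfunE.
apply: ind_ext => [||x]; [exact: quot_pr_hom|exact: rhom0|].
by rewrite zero_lfunE; apply/eqP; rewrite quot_pr_eq0.
Qed.

(** The extension is x (x) l |-> b(x) l. With [ind_ext] and [to_corner] this is the adjunction. *)
Lemma ind_lift (W : rmod L) (b : 'Hom(X, W)) : ihom b ->
  exists2 g : 'Hom(ind X, W), rhom g & (g \o eta)%VF = b.
Proof.
move=> bh; pose be (x : X) (l : E) : W := ract (b x) (vsval l).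
have beb : balanced (X := X) (N := bimod_l E) be.
  split; first split=> [l|x] c u v.
  - by rewrite /be linearP ract_linl.
  - by rewrite /be linearP ract_linr.
  move=> x a l; rewrite /be bh -ractM; congr ract.
  by rewrite /= vsprojK // ideal_memL.
have gl := tlift_linear (X := X) (N := bimod_l E) be.
exists (linfun (tlift be : ind X -> W)); last first.
  apply/lfunP => x; rewrite comp_lfunE (linfunE gl) etaE (tliftE _ _ beb) /be ideal_oneE.
  exact: ihom_fix.
move=> w l; rewrite !(linfunE gl).
move: w; apply: (tens_ext (X := X) (N := bimod_l E)) => [c u v|c u v|x m].
- by rewrite [in LHS]ract_linl gl.
- by rewrite gl ract_linl.
rewrite [ract _ _](tens_ractE x m l) !(tliftE _ _ beb) /be -ractM; congr ract.
by rewrite /= vsprojK //; apply: (ideal_memR iM); exact: subvsP.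
Qed.

(** The map x (x) l |-> x j(l) inverts the unit on the corner: (X (x) eL)e = X (x) eLe = X. *)
Lemma ind_corner : exists2 rho : ind X -> X, cancel eta rho & forall w, ract w (i 1) =
  eta (rho w).
Proof.
pose be (x : X) (l : E) : X := ract x (j (vsval l)).
have jM a l : j (i a * l) = a * j l.
  apply: (can_inj ji); rewrite iM !ij !mulrA -!iM mul1r mulr1 //.
have beb : balanced (X := X) (N := bimod_l E) be.
  split; first split=> [l|x] c u v.
  - by rewrite /be ract_linl.
  - by rewrite /be linearP j_lin ract_linr.
  move=> x a l; rewrite /be -ractM; congr ract.
  by rewrite /= vsprojK ?ideal_memL // jM.
have gl := tlift_linear (X := X) (N := bimod_l E) be.
exists (tlift be) => [x|].
  by rewrite etaE (tliftE _ _ beb) /be ideal_oneE ji ract1.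
apply: (tens_ext (X := X) (N := bimod_l E)) => [c u v|c u v|x m].
- exact: (ract_linl (V := ind X)).
- by rewrite gl linearP.
rewrite (tliftE _ _ beb) /be eta_hom pure_eta -ractM; congr ract.
have /(ideal_mem iM) E1 : vsval m \in ideal_space i by exact: subvsP.
by rewrite ij E1.
Qed.

Lemma eta_inj : injective eta.
Proof. by have [rho rK _] := ind_corner; exact: can_inj rK. Qed.

(** Full faithfulness of [ind]: by [ind_corner], a semilinear map into [ind X] takes its values in
    the image of [eta]. *)
Lemma eta_fact (Y : rmod A) (f : 'Hom(Y, ind X)) : ihom f ->
  exists2 g : 'Hom(Y, X), rhom g & (eta \o g)%VF = f.
Proof.
move=> fh; have [rho rK rE] := ind_corner.
have ke : lker eta = 0%VS by apply/lker_trivP => x x0; apply: eta_inj; rewrite x0 linear0.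
have gK y : eta (eta^-1%VF (f y)) = f y.
  by apply: limg_lfunVK; rewrite -(ihom_fix y fh) rE memv_img ?memvf.
exists (eta^-1 \o f)%VF; last by apply/lfunP => y; rewrite !comp_lfunE gK.
by move=> y a; rewrite !comp_lfunE; apply: eta_inj; rewrite eta_hom !gK fh.
Qed.

Lemma Fac_corner_ind : Fac X (corner (ind X)).
Proof.
have [g gh gE] := to_corner eta_hom.
apply: (Fac_surj (Fac_retract (retract_refl X)) gh); apply/limg_fullP => w.
have [rho _ rE] := ind_corner; exists (rho (corner_in _ w)).
by apply: corner_in_inj; rewrite -[in RHS]comp_lfunE gE -rE corner_fix.
Qed.
End Unit.

End Induction.
End CornerModules.

(** * What induction preserves *)

Section InductionTheory.
Variables (k : fieldType) (A L : falgType k) (i : A -> L).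
Hypotheses (i_lin : linear i) (iM : {morph i : x y / x * y}).
Variable j : L -> A.
Hypotheses (j_lin : linear j) (ij : forall l, i (j l) = i 1 * l * i 1)
  (ji : cancel i j).
Local Notation corner := (corner i_lin iM).
Local Notation ind := (ind i_lin iM).
Local Notation eta := (eta i_lin iM).
Implicit Types X Y U V P : rmod A.

Lemma ind_map X Y (f : 'Hom(X, Y)) : rhom f ->
  exists2 g : 'Hom(ind X, ind Y), rhom g & forall x, g (eta X x) = eta Y (f x).
Proof.
move=> fh; have [g gh gE] := ind_lift i_lin iM (ihom_rhom (@eta_hom _ _ _ _ i_lin iM Y) fh).
by exists g => // x; rewrite -comp_lfunE gE comp_lfunE.
Qed.

Lemma ind_comp_id X Y (f : 'Hom(ind X, ind Y)) (g : 'Hom(ind Y, ind X)) :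
  rhom f -> rhom g -> (forall x, g (f (eta X x)) = eta X x) -> cancel f g.
Proof.
move=> fh gh gf w; rewrite -comp_lfunE -[RHS]id_lfunE; congr fun_of_lfun.
apply: ind_ext => [||x]; [exact: rhom_comp|exact: rhom_id|].
by rewrite comp_lfunE id_lfunE.
Qed.

Lemma ind_retract X Y : retract X Y -> retract (ind X) (ind Y).
Proof.
move=> [f [g [fh gh] gf]]; have [F Fh FE] := ind_map fh; have [G Gh GE] := ind_map gh.
by exists F, G => //; apply: ind_comp_id => // x; rewrite FE GE gf.
Qed.

Lemma ind_dsum X Y : retract (ind (dsum X Y)) (dsum (ind X) (ind Y)).
Proof.
have [F1 F1h F1E] := ind_map (@pr1_hom _ _ X Y); have [F2 F2h F2E] := ind_map (@pr2_hom _
  _ X Y).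
have [G1 G1h G1E] := ind_map (@in1_hom _ _ X Y); have [G2 G2h G2E] := ind_map (@in2_hom _
  _ X Y).
have Fh := dsum_pair_hom F1h F2h; have Gh := copair_hom G1h G2h.
exists (dsum_pair F1 F2), (copair G1 G2) => // w.
rewrite -comp_lfunE -[RHS]id_lfunE; congr fun_of_lfun.
apply: ind_ext => [||x]; [exact: rhom_comp|exact: rhom_id|].
rewrite comp_lfunE id_lfunE dsum_pairE copairE /= F1E F2E G1E G2E -linearD.
by rewrite pr1E pr2E -dsum_split.
Qed.

(** The right adjoint [corner] preserves surjections. *)
Lemma ind_projective P : projective P -> projective (ind P).
Proof.
move=> Pp U V g h gh hh /limg_fullP gs.
have [u uh uE] := to_corner i_lin iM (rhom_ihom hh (@eta_hom _ _ _ _ i_lin iM P)).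
have [gc gch gcE] := corner_map i_lin iM gh.
have gcs : limg gc = fullv.
  apply/limg_fullP => y; have [v /esym/(corner_lift gh)[z zE]] := gs (corner_in i_lin iM
    _ y).
  by exists z; apply: (@corner_in_inj _ _ _ _ i_lin iM); rewrite gcE zE.
have [h' h'h h'E] := Pp _ _ gc u gch uh gcs.
have [H Hh HE] := ind_lift i_lin iM (ihom_rhom (@corner_in_hom _ _ _ _ i_lin iM U) h'h).
exists H => //; apply: ind_ext => [|//|x]; first exact: rhom_comp.
rewrite comp_lfunE -[H _]comp_lfunE HE comp_lfunE -gcE -[gc _]comp_lfunE h'E.
by rewrite -comp_lfunE uE comp_lfunE.
Qed.

(** By full faithfulness, idempotents of [ind U] come from idempotents of [U]. *)
Lemma ind_indecomposable U : indecomposable U -> indecomposable (ind U).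
Proof.
move=> Ui; apply: idem_indecomposable => [U0|p ph pp].
  have [x []] := indecomposable_nz Ui; apply: (eta_inj j_lin ij ji).
  by rewrite (U0 (eta U x)) linear0.
have [q qh qE] := eta_fact j_lin ij ji (rhom_ihom ph (@eta_hom _ _ _ _ i_lin iM U)).
have {}qE x : eta U (q x) = p (eta U x) by rewrite -comp_lfunE qE comp_lfunE.
have [|q0|q1] := indecomposable_idem Ui qh.
- by move=> x; apply: (eta_inj j_lin ij ji); rewrite !qE pp.
- left=> x; suff -> : p = 0 by rewrite zero_lfunE.
  apply: ind_ext => [//||y]; first exact: rhom0.
  by rewrite -qE q0 linear0 zero_lfunE.
right=> x; suff -> : p = \1%VF by rewrite id_lfunE.
apply: ind_ext => [//||y]; first exact: rhom_id.
by rewrite -qE q1 id_lfunE.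
Qed.

Lemma hom_dim_ind X (W : rmod L) : hom_dim (ind X) W = hom_dim X (corner W).
Proof.
pose c := corner_in i_lin iM W.
have cK : cancel c (c^-1)%VF by apply: lker0_lfunK; rewrite corner_in_ker.
pose Phi := linfun (fun f : 'Hom(ind X, W) => (c^-1 \o (f \o eta X))%VF).
have PhiE f : Phi f = (c^-1 \o (f \o eta X))%VF.
  apply: (linfunE (W := 'Hom(X, corner W))) => a u v.
  by apply/lfunP => x; rewrite !(add_lfunE, scale_lfunE, comp_lfunE) linearP.
have hE f : rhom f -> exists2 g : 'Hom(X, corner W), rhom g & (c \o g)%VF = (f \o eta X)%VF.
  by move=> fh; apply: (to_corner i_lin iM); apply: rhom_ihom fh _; exact: eta_hom.
have PhiG f (g : 'Hom(X, corner W)) : (c \o g)%VF = (f \o eta X)%VF -> Phi f = g.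
  by move=> E; rewrite PhiE -E; apply/lfunP => x; rewrite !comp_lfunE cK.
rewrite /hom_dim -(@limg_dim_eq _ _ _ Phi (hom_space (ind X) W)).
  congr (\dim _); apply/vspaceP => g; apply/memv_imgP/idP => [[f /hom_spaceP fh
    ->]|/hom_spaceP gh].
    by have [g' g'h /PhiG->] := hE f fh; apply/hom_spaceP.
  have [f fh fE] := ind_lift i_lin iM (ihom_rhom (@corner_in_hom _ _ _ _ i_lin iM W) gh).
  by exists f; [apply/hom_spaceP | rewrite (PhiG f g)].
apply/eqP; rewrite -subv0; apply/subvP => f; rewrite memv_cap memv_ker memv0.
case/andP=> /hom_spaceP fh /eqP f0; have [g _ gE] := hE f fh.
have g0 : g = 0 by rewrite -(PhiG f g gE).
apply/eqP/ind_ext => [//||x]; first exact: rhom0.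
by rewrite -comp_lfunE -gE g0 comp_lfun0r !zero_lfunE.
Qed.

(** If S + ker F is everything, projectivity gives an endomorphism of [ind P] over [ind V] with
    values in [S]. By full faithfulness it comes from some [q] with f q = f. Superfluity of ker [f]
    makes [q] surjective, so [S] contains the generators [eta P x]. *)
Lemma ind_superfluous P V (f : 'Hom(P, V)) (F : 'Hom(ind P, ind V)) :
  projective P -> rhom f -> rhom F -> (forall x, F (eta P x) = eta V (f x)) ->
  superfluous (lker f) -> superfluous (lker F).
Proof.
move=> Pp fh Fh FE fmin S HS SK.
have Hs := submodule_limg Fh.
have Fm w : F w \in limg F by rewrite memv_img ?memvf.
have Gh : rhom (F \o sub_in HS)%VF by apply: rhom_comp => //; exact: sub_in_hom.
have Gm w : (F \o sub_in HS)%VF w \in limg F by rewrite comp_lfunE.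
have Gs : limg (to_sub Hs (F \o sub_in HS)%VF) = fullv.
  apply/limg_fullP => y; have := sub_in_mem y => /memv_imgP[z _ yE].
  have : z \in (S + lker F)%VS by rewrite SK memvf.
  case/memv_addP => s sS [t]; rewrite memv_ker => /eqP Ft zE.
  exists (to_sub HS \1%VF s); apply: sub_in_eq.
  by rewrite to_subE // comp_lfunE to_subE id_lfunE // yE zE linearD /= Ft addr0.
have [h hh hE] := ind_projective Pp (@to_sub_hom _ _ _ _ Hs _ _ Gh Gm)
  (@to_sub_hom _ _ _ _ Hs _ _ Fh Fm) Gs.
have {}hE w : F (sub_in HS (h w)) = F w.
  have /lfunP/(_ w)/(congr1 (sub_in Hs)) := hE.
  by rewrite comp_lfunE !to_subE // comp_lfunE.
have ph : rhom (sub_in HS \o h)%VF by apply: rhom_comp => //; exact: sub_in_hom.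
have [q qh qE] := eta_fact j_lin ij ji (rhom_ihom ph (@eta_hom _ _ _ _ i_lin iM P)).
have {}qE x : eta P (q x) = sub_in HS (h (eta P x)) by rewrite -comp_lfunE qE !comp_lfunE.
have fq x : f (q x) = f x.
  by apply: (eta_inj j_lin ij ji); rewrite -!FE qE hE.
have /limg_fullP qs : limg q = fullv.
  apply: fmin; first exact: submodule_limg.
  apply/vspaceP => x; rewrite memvf -[x](subrK (q x)) addrC memv_add ?memv_img ?memvf //.
  by rewrite memv_ker linearB /= fq subrr.
apply: ind_gen => // x; have [y ->] := qs x.
by rewrite qE sub_in_mem.
Qed.

Lemma ind_min_presentation X (p : min_presentation X) :
  exists p' : min_presentation (ind X), forall W, gvec p' W = gvec p (corner W).
Proof.
have [D Dh DE] := ind_map (@pres_d_hom _ _ _ p).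
have [F Fh FE] := ind_map (@pres_e_hom _ _ _ p).
have Fs : limg F = fullv.
  apply: ind_gen => [|x]; first exact: submodule_limg.
  by have /limg_fullP/(_ x)[y ->] := pres_e_surj p; rewrite -FE memv_img ?memvf.
have FD w : F (D w) = 0.
  rewrite -comp_lfunE; suff -> : (F \o D)%VF = 0 by rewrite zero_lfunE.
  apply: ind_ext => [||x]; [exact: rhom_comp|exact: rhom0|].
  by rewrite comp_lfunE DE FE pres_de linear0 zero_lfunE.
have ex : limg D = lker F.
  apply/eqP; rewrite eqEsubv; apply/andP; split.
    by apply/subvP => _ /memv_imgP[w _ ->]; rewrite memv_ker FD.
  (* Right exactness is tested on the projection [q] modulo the image of [D]: by adjunction [q]
     factors through [F], so ker [F] lies in this image. *)
  pose HD := submodule_limg Dh; pose q := quot_pr HD.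
  have qh : rhom q := @quot_pr_hom _ _ _ _ HD.
  have [u uh uE] := to_corner i_lin iM (rhom_ihom qh (@eta_hom _ _ _ _ i_lin iM (pres0 p))).
  have [|v vh vE] := factor_surj (@pres_e_hom _ _ _ p) uh (pres_e_surj p).
    move=> x /eqP; rewrite -memv_ker -pres_exact => /memv_imgP[y _ ->].
    apply: (@corner_in_inj _ _ _ _ i_lin iM); rewrite -comp_lfunE uE comp_lfunE linear0.
    by apply/eqP; rewrite quot_pr_eq0 -DE memv_img ?memvf.
  have [G Gh GE] := ind_lift i_lin iM (ihom_rhom (@corner_in_hom _ _ _ _ i_lin iM
    (quotmod HD)) vh).
  have GF : (G \o F)%VF = q.
    apply: ind_ext => [|//|x]; first exact: rhom_comp.
    by rewrite comp_lfunE FE -comp_lfunE GE comp_lfunE -[v _]comp_lfunE vE -comp_lfunE uE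
      comp_lfunE.
  apply/subvP => w; rewrite memv_ker => /eqP Fw.
  by rewrite -(quot_pr_eq0 HD) -[quot_pr HD]GF comp_lfunE Fw linear0.
exists (MinPresentation (ind_projective (@pres1_proj _ _ _ p)) (ind_projective
  (@pres0_proj _ _ _ p))
  Dh Fh Fs ex (ind_superfluous (@pres0_proj _ _ _ p) (@pres_e_hom _ _ _ p) Fh FE
    (@pres_e_min _ _ _ p))
  (ind_superfluous (@pres1_proj _ _ _ p) (@pres_d_hom _ _ _ p) Dh DE (@pres_d_min _ _ _
    p))).
by move=> W; rewrite /gvec /hom_dimq /= !hom_dim_ind.
Qed.

(** Serves to recognise indecomposable projectives over [L] as induced modules. *)
Lemma ind_indec_summand (R : rmod L) V : indecomposable R -> retract R (ind V) ->
  exists U, [/\ indecomposable U, retract U V & riso R (ind U)].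
Proof.
move=> Ri; move: V; apply: krull_schmidt_ind => [U V UV IH RV|U U0 [f [g _ gf]]|U Ui RU|V
  W IHV IHW].
- have [|S [Si SU RS]] := IH.
    exact: retract_trans RV (ind_retract (retract_riso (riso_sym UV))).
  by exists S; split=> //; exact: retract_trans SU (retract_riso UV).
- have [x []] := indecomposable_nz Ri; rewrite -[x]gf -[f x]id_lfunE.
  suff -> : (\1%VF : 'Hom(ind U, ind U)) = 0 by rewrite zero_lfunE linear0.
  apply: ind_ext => [||y]; [exact: rhom_id|exact: rhom0|].
  by rewrite (U0 y) !linear0.
- exists U; split=> //; first exact: retract_refl.
  by apply: retract_indec_riso => //; [case: Ri | exact: ind_indecomposable].
move=> /retract_trans/(_ (ind_dsum V W))/(retract_exchange Ri)[/IHV|/IHW] [U [Ui UV RU]].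
  by exists U; split=> //; exact: retract_trans UV (retract_dsum1 _ _).
by exists U; split=> //; exact: retract_trans UV (retract_dsum2 _ _).
Qed.

(** Taking corners keeps the sequence exact and puts its kernel in Fac Y; the lift found there is
    transposed back. *)
Lemma ext_projective_ind X Y (T : rmod L) : ext_projective X Y -> Fac Y (corner T) ->
  ext_projective (ind X) T.
Proof.
move=> XY YT K E V m q f mh qh fh km mq qs TK.
have YK : Fac Y (corner K) by apply: Fac_trans YT (Fac_corner i_lin iM TK).
have [u uh uE] := to_corner i_lin iM (rhom_ihom fh (@eta_hom _ _ _ _ i_lin iM X)).
have [qc qch qcE] := corner_map i_lin iM qh.
have [mc mch mcE] := corner_map i_lin iM mh.
have cinj := @corner_in_inj _ _ _ _ i_lin iM.
have [|||g gh gE] := XY _ _ _ mc qc u mch qch uh _ _ _ YK.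
- apply/lker_trivP => x x0; apply: cinj; rewrite linear0.
  by apply: (proj2 (lker_trivP m) km); rewrite -mcE x0 linear0.
- apply/vspaceP => y; rewrite memv_ker; apply/memv_imgP/eqP => [[x _ ->]|y0].
    by apply: cinj; rewrite qcE mcE linear0; apply/eqP; rewrite -memv_ker -mq memv_img
      ?memvf.
  have /memv_imgP[z _ zE] : corner_in i_lin iM _ y \in limg m.
    by rewrite mq memv_ker -qcE y0 linear0.
  have [x xE] := corner_lift mh (esym zE).
  by exists x; rewrite ?memvf //; apply: cinj; rewrite mcE xE.
- apply/limg_fullP => y; have /limg_fullP/(_ (corner_in i_lin iM _ y))[z
  /esym/(corner_lift qh)[x xE]] := qs.
  by exists x; apply: cinj; rewrite qcE xE.
have [G Gh GE] := ind_lift i_lin iM (ihom_rhom (@corner_in_hom _ _ _ _ i_lin iM E) gh).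
exists G => //; apply: ind_ext => [|//|x]; first exact: rhom_comp.
rewrite comp_lfunE -[G _]comp_lfunE GE comp_lfunE -qcE -[qc _]comp_lfunE gE.
by rewrite -comp_lfunE uE comp_lfunE.
Qed.

Lemma ind_hom0 P X (T : rmod L) : projective P -> (forall f : 'Hom(P, X), rhom f -> f =
  0) ->
  Fac X (corner T) -> forall f : 'Hom(ind P, T), rhom f -> f = 0.
Proof.
move=> Pp PX XT f /hom_spaceP; have /eqP := hom_dimq_proj0 Pp PX XT.
by rewrite /hom_dimq pnatr_eq0 -hom_dim_ind dimv_eq0 => /eqP->; rewrite memv0 => /eqP.
Qed.

End InductionTheory.

(** * Basic versions *)

Section BasicVersion.
Variables (k : fieldType) (A : falgType k).
Implicit Types T U V W P Q : rmod A.

Definition splits_off V U (f : 'Hom(U, U)) :=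
  exists (a : 'Hom(V, U)) (b : 'Hom(U, V)), [/\ rhom a, rhom b, cancel a b & f = (a \o
    b)%VF].

(** The direct sum of the modules [s l] is recorded by writing the identity of [U] as a sum of
    projections. *)
Definition decomposes n (s : 'I_n -> rmod A) U :=
  exists2 f : 'I_n -> 'Hom(U, U), forall l, splits_off (s l) (f l) & \sum_l f l = \1%VF.

(** The second clause carries over to [U] every property closed under direct sums, such as lying in
    Fac T or Ext-projectivity. *)
Lemma decomposes_ex n (s : 'I_n -> rmod A) : exists2 U, decomposes s U &
  forall Phi : rmod A -> Prop, (forall Z, zero_module Z -> Phi Z) ->
    (forall V W, Phi V -> Phi W -> Phi (dsum V W)) -> (forall l, Phi (s l)) -> Phi U.
Proof.
elim: n s => [|n IH] s.
  exists (dpow (regular_r A) 0) => [|Phi Phi0 _ _]; last first.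
    by apply: Phi0 => x; apply/ffunP; case=> ? ?.
  exists (fun=> 0); [by case | by apply/lfunP => x; apply/ffunP; case=> ? ?].
have [U [f fs fE] UPhi] := IH (fun l => s (lift ord0 l)).
exists (dsum (s ord0) U) => [|Phi Phi0 PhiD Phis]; last by apply: (PhiD); [exact: Phis |
  exact: UPhi].
exists (fun l => if unlift ord0 l is Some m then (in2 (s ord0) U \o (f m \o pr2 (s ord0)
  U))%VF
  else (in1 (s ord0) U \o pr1 (s ord0) U)%VF) => [l|].
  case: (unliftP ord0 l) => [m ->|->].
    have [a [b [ah bh ab ->]]] := fs m.
    exists (in2 (s ord0) U \o a)%VF, (b \o pr2 (s ord0) U)%VF; split.
    - by apply: rhom_comp => //; exact: in2_hom.
    - by apply: rhom_comp => //; exact: pr2_hom.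
    - by move=> x; rewrite !comp_lfunE pr2E in2E ab.
    by rewrite !comp_lfunA.
  exists (in1 (s ord0) U), (pr1 (s ord0) U); split=> //.
  - exact: in1_hom.
  - exact: pr1_hom.
  by move=> x; rewrite pr1E in1E.
rewrite big_ord_recl unlift_none; under eq_bigr do rewrite liftK.
apply/lfunP => x; rewrite add_lfunE sum_lfunE comp_lfunE id_lfunE pr1E [RHS](dsum_split x).
congr (_ + _); have /lfunP/(_ x.2) := fE; rewrite id_lfunE => xE.
rewrite -[in RHS]xE sum_lfunE linear_sum; apply: eq_bigr => m _.
by rewrite !comp_lfunE pr2E.
Qed.

Lemma decomposes_retract n (s : 'I_n -> rmod A) U l : decomposes s U -> retract (s l) U.
Proof. by case=> f fs _; have [a [b [ah bh ab _]]] := fs l; exists a, b. Qed.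

(** [p \o q] is the sum of its components through the [s l]; by locality one of them is
    bijective. *)
Lemma decomposes_indec n (s : 'I_n -> rmod A) U V (q : 'Hom(V, U)) (p : 'Hom(U, V)) :
  (forall l, indecomposable (s l)) -> decomposes s U -> indecomposable V ->
  rhom q -> rhom p -> lbij (p \o q)%VF -> exists l, riso V (s l).
Proof.
move=> si [f fs fE] Vi qh ph pqb; pose F l := (p \o (f l \o q))%VF.
have fh l : rhom (f l) by have [a [b [ah bh _ ->]]] := fs l; exact: rhom_comp.
have [||l Fb] := @indec_local_sum _ _ _ (index_enum 'I_n) _ _ F Vi.
- by move=> l; apply: rhom_comp => //; exact: rhom_comp.
- suff -> : \sum_l F l = (p \o q)%VF by [].
  apply/lfunP => x; rewrite sum_lfunE comp_lfunE -[q x in RHS]id_lfunE -fE sum_lfunE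
    linear_sum.
  by apply: eq_bigr => l _; rewrite !comp_lfunE.
have [a [b [ah bh ab fl]]] := fs l.
have E : F l = ((p \o a) \o (b \o q))%VF by rewrite /F fl !comp_lfunA.
rewrite E in Fb.
have [_ bqb] := indec_comp (si l) (proj1 Vi) (rhom_comp ph ah) (rhom_comp bh qh) Fb.
by exists l, (b \o q)%VF => //; exact: rhom_comp.
Qed.

Lemma decomposes_cover n (s : 'I_n -> rmod A) U V :
  (forall l, indecomposable (s l)) -> decomposes s U -> indecomposable V ->
  retract V U -> exists l, riso V (s l).
Proof.
move=> si sU Vi [q [p [qh ph] pq]]; apply: decomposes_indec si sU Vi qh ph _.
suff -> : (p \o q)%VF = \1%VF by exact: lbij_id.
by apply/lfunP => x; rewrite comp_lfunE id_lfunE pq.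
Qed.

(* If V (+) V were a summand, then modulo radical maps both copies of V would sit
   in the unique s_l isomorphic to V, but their mutual components vanish. *)
Lemma decomposes_basic n (s : 'I_n -> rmod A) U :
  (forall l, indecomposable (s l)) -> (forall l m, riso (s l) (s m) -> l = m) ->
  decomposes s U -> basic U.
Proof.
move=> si sinj sU V W Vi /riso_sym/retract_riso/(retract_trans (retract_dsum1 _ _)) [i [r
  [ih rh] ir]].
have [f fs fE] := sU.
pose q1 := (i \o in1 V V)%VF; pose q2 := (i \o in2 V V)%VF.
pose p1 := (pr1 V V \o r)%VF; pose p2 := (pr2 V V \o r)%VF.
have q1h : rhom q1 by apply: rhom_comp => //; exact: in1_hom.
have q2h : rhom q2 by apply: rhom_comp => //; exact: in2_hom.
have p1h : rhom p1 by apply: rhom_comp => //; exact: pr1_hom.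
have p2h : rhom p2 by apply: rhom_comp => //; exact: pr2_hom.
have p11 : (p1 \o q1)%VF = \1%VF.
  by apply/lfunP => x; rewrite !comp_lfunE ir pr1E in1E id_lfunE.
have p22 : (p2 \o q2)%VF = \1%VF.
  by apply/lfunP => x; rewrite !comp_lfunE ir pr2E in2E id_lfunE.
have p12 : (p1 \o q2)%VF = 0.
  by apply/lfunP => x; rewrite !comp_lfunE ir pr1E in2E zero_lfunE.
have sumE (p : 'Hom(U, V)) (q : 'Hom(V, U)) : \sum_l (p \o (f l \o q))%VF = (p \o q)%VF.
  apply/lfunP => x; rewrite sum_lfunE comp_lfunE -[q x in RHS]id_lfunE -fE.
  by rewrite sum_lfunE linear_sum; apply: eq_bigr => l _; rewrite !comp_lfunE.
have fact (p : 'Hom(U, V)) (q : 'Hom(V, U)) : rhom p -> rhom q -> (p \o q)%VF = \1%VF ->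
    exists l, lbij (p \o (f l \o q))%VF.
  move=> ph qh pq; pose F l := (p \o (f l \o q))%VF.
  have [||l Fb] := @indec_local_sum _ _ _ (index_enum 'I_n) _ _ F Vi; last by exists l.
    move=> l; have [a [b [ah bh _ fab]]] := fs l; rewrite /F fab.
    by apply: rhom_comp => //; apply: rhom_comp => //; exact: rhom_comp.
  by rewrite sumE pq; exact: lbij_id.
have part (p : 'Hom(U, V)) (q : 'Hom(V, U)) l : rhom p -> rhom q -> lbij (p \o (f l \o
  q))%VF ->
    forall (a : 'Hom(s l, U)) (b : 'Hom(U, s l)), rhom a -> rhom b -> f l = (a \o b)%VF
      -> lbij (p \o a)%VF /\ lbij (b \o q)%VF.
  move=> ph qh pb a b ah bh E; move: pb; rewrite E.
  have -> : (p \o ((a \o b) \o q))%VF = ((p \o a) \o (b \o q))%VF by rewrite !comp_lfunA.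
  move=> pab; exact: (indec_comp (si l) (proj1 Vi) (rhom_comp ph ah) (rhom_comp bh qh) pab).
have [l lb] := fact _ _ p1h q1h p11; have [m mb] := fact _ _ p2h q2h p22.
have [a [b [ah bh _ fab]]] := fs l.
have [pab bqb] := part _ _ _ p1h q1h lb a b ah bh fab.
have lm : l = m.
  have [a' [b' [ah' bh' _ fab']]] := fs m.
  have [_ bqb'] := part _ _ _ p2h q2h mb a' b' ah' bh' fab'.
  apply: sinj; apply: (@riso_trans _ _ V).
    by apply: riso_sym; exists (b \o q1)%VF => //; exact: rhom_comp.
  by exists (b' \o q2)%VF => //; exact: rhom_comp.
subst m; have [_ bq2] := part _ _ _ p2h q2h mb a b ah bh fab.
(* The components of [p1 \o q2] = 0 sum to zero and the one through [s l] is bijective. So the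
   others have a bijective sum, and [V] also occurs as some [s m] with m different from l. *)
pose G m := if m == l then 0 else (p1 \o (f m \o q2))%VF.
have Gb : lbij (\sum_m G m).
  have -> : \sum_m G m = - ((p1 \o a) \o (b \o q2))%VF.
    apply/eqP; rewrite -addr_eq0; apply/eqP; rewrite -[RHS]p12 -sumE.
    rewrite (bigD1 l) //= [RHS](bigD1 l) //= {1}/G eqxx add0r addrC fab !comp_lfunA.
    by congr (_ + _); apply: eq_bigr => m /negPf nml; rewrite /G nml.
  have cb := lbij_comp pab bq2; have [K VK] := lbij_inv cb.
  apply: (@lbij_of_cancel _ _ _ _ (fun y => (((p1 \o a) \o (b \o q2))^-1)%VF (- y))) => x.
    by rewrite opp_lfunE opprK K.
  by rewrite opp_lfunE VK opprK.
have [|m mlb] := @indec_local_sum _ _ _ (index_enum 'I_n) _ _ G Vi _ Gb.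
- move=> m; rewrite /G; case: eqP => _; first exact: rhom0.
  have [c [d [ch dh _ ->]]] := fs m.
  by apply: rhom_comp => //; apply: rhom_comp => //; exact: rhom_comp.
move: mlb; rewrite /G; case: eqP => [_ [k0 _]|ml mlb].
  have [x []] := indecomposable_nz Vi.
  by apply: (proj2 (lker_trivP _) k0); rewrite zero_lfunE.
apply: ml; have [c [d [ch dh _ fcd]]] := fs m.
have [_ dqb] := part _ _ _ p1h q2h mlb c d ch dh fcd.
apply: sinj; apply: (@riso_trans _ _ V).
  by apply: riso_sym; exists (d \o q2)%VF => //; exact: rhom_comp.
by exists (b \o q1)%VF => //; exact: rhom_comp.
Qed.

(** [U] is the sum of one copy of each indecomposable summand of [T]. It lies in Fac T and inherits
    Ext-projectivity, so the same [P] and the same list of summands serve for it. *)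
Lemma support_tau_tilting_basic T : support_tau_tilting T ->
  exists2 U, basic_version T U & support_tau_tilting U.
Proof.
case=> /tau_rigidP TT [P [Pp PT [t [p [[s [si sinj sc]] cP cA]]]]].
have [U sU UPhi] := decomposes_ex s.
have s1 l : indecomposable (s l) by case: (si l).
have sT l : retract (s l) T by apply/summandP; case: (si l).
have Ucover V : indecomposable V -> retract V U -> exists l, riso V (s l).
  exact: decomposes_cover sU.
have TU : Fac T U.
  apply: UPhi => [Z Z0|V W|l]; [|exact: Fac_dsum|exact: Fac_retract].
  by apply/FacP => S _; apply/vspaceP => x; rewrite (Z0 x) mem0v memvf.
exists U.
  split; first exact: decomposes_basic sU.
  move=> V Vi; split=> /summandP VU; apply/summandP.
    have [l Vs] := Ucover V Vi VU.
    exact: retract_trans (retract_riso Vs) (sT l).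
  have [l Vs] := sc V Vi (proj2 (summandP _ _) VU).
  exact: retract_trans (retract_riso Vs) (decomposes_retract l sU).
have UT : ext_projective U T.
  exact (UPhi (fun V => ext_projective V T) (fun Z => @ext_projective_zero _ _ Z T)
    (fun V W => @ext_projective_dsum _ _ V W T) (fun l => ext_projective_retract (sT l)
      TT)).
split.
  by apply/tau_rigidP; apply: ext_projective_sub UT => V; exact: Fac_trans.
exists P; split=> // [f /hom_spaceP|].
  have /eqP := hom_dimq_proj0 Pp PT TU.
  by rewrite /hom_dimq pnatr_eq0 dimv_eq0 => /eqP->; rewrite memv0 => /eqP.
exists t, p; split=> //; exists s; split=> // [l|V Vi /summandP VU]; last exact: Ucover.
by split=> //; apply/summandP; exact: decomposes_retract sU.
Qed.

End BasicVersion.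

(** * Counting summands *)

Section Spanning.
Variables (k : fieldType) (A : falgType k).
Implicit Types T U V W P Q : rmod A.

Definition repeat_free n (s : 'I_n -> rmod A) := forall l m, riso (s l) (s m) -> l = m.

Lemma dsum_hom0 U V W (f : 'Hom(dsum U V, W)) :
  (f \o in1 U V)%VF = 0 -> (f \o in2 U V)%VF = 0 -> f = 0.
Proof.
move=> f1 f2; apply/lfunP => x; rewrite (dsum_split x) linearD /=.
have /lfunP/(_ x.1) := f1; rewrite comp_lfunE !zero_lfunE => ->.
by have /lfunP/(_ x.2) := f2; rewrite comp_lfunE !zero_lfunE => ->; rewrite addr0.
Qed.

Lemma regular_projective : projective (regular_r A).
Proof.
apply: (projective_retract _ (@free_projective _ A 1)).
exists (dpow_in _ ord0), (dpow_pr _ ord0) => [|x].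
  by split; [exact: dpow_in_hom|exact: dpow_pr_hom].
by rewrite dpow_prE dpow_inE ffunE eqxx.
Qed.

Lemma card_indecP T n : card_indec T n <->
  exists s : 'I_n -> rmod A, covers T s /\ repeat_free s.
Proof.
split=> [[s [si sinj sc]]|[s [[si sc] sinj]]]; exists s.
  split=> //; split=> [l|U Ui /summandP]; last exact: sc.
  by have [Si /summandP] := si l.
split=> // [l|U Ui /summandP]; last exact: sc.
by have [Si /summandP] := si l.
Qed.

(** The g-vectors of a pair, with the projective part taken with sign plus; the sign affects neither
    independence nor span. *)
Definition gvecs n m (s : 'I_n -> rmod A) (q : 'I_m -> rmod A) :=
  fam_cat (fun l => gvec (minpres (s l))) (fun l => hom_dimq (q l)).

Lemma gvecs_indep T P n m (s : 'I_n -> rmod A) (q : 'I_m -> rmod A) :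
  ext_projective T T -> projective P -> (forall f : 'Hom(P, T), rhom f -> f = 0) ->
  covers T s -> repeat_free s -> covers P q -> repeat_free q -> lin_indep (gvecs s q).
Proof.
move=> TT Pp PT [si _] sinj [qi _] qinj.
have qp l : indecomposable (q l) /\ projective (q l).
  by have [Qi QP] := qi l; split=> //; exact: projective_retract QP Pp.
have qT l (f : 'Hom(q l, T)) : rhom f -> f = 0.
  move=> fh; have [_ [a [b [ah bh] ab]]] := qi l; apply/lfunP => x.
  by rewrite zero_lfunE -[x]ab -comp_lfunE (PT (f \o b)%VF) ?zero_lfunE //; exact:
    rhom_comp.
exact: (@gvec_indep _ _ _ _ _ _ _ (fun l => minpres (s l)) TT si sinj qp qinj qT).
Qed.

Lemma gvecs_in_span P n m r (s : 'I_n -> rmod A) (q : 'I_m -> rmod A) (v : 'I_r -> rmod A) :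
  projective P -> covers P q -> covers (regular_r A) v ->
  forall l, in_span (fun i => hom_dimq (v i)) (gvecs s q l).
Proof.
move=> Pp [qi _] [_ vc]; rewrite /gvecs.
apply: (fam_cat_all (Q := in_span (fun i => hom_dimq (v i)))) => l; first exact: gvec_span.
by apply: hom_dimq_proj_span => //; have [_ QP] := qi l; exact: projective_retract QP Pp.
Qed.

(** The equality |T| + |P| = |A| enters as the common length n + m of the two families: an
    independent family of that length in the span of [v] spans it. *)
Lemma gvecs_span T P n m (s : 'I_n -> rmod A) (q : 'I_m -> rmod A) (v : 'I_(n + m) ->
  rmod A) V :
  ext_projective T T -> projective P -> (forall f : 'Hom(P, T), rhom f -> f = 0) ->
  covers T s -> repeat_free s -> covers P q -> repeat_free q ->
  covers (regular_r A) v -> projective V -> in_span (gvecs s q) (hom_dimq V).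
Proof.
move=> TT Pp PT sT sinj qP qinj vA Vp.
apply: in_span_trans (hom_dimq_proj_span (proj2 vA) Vp) _; apply: indep_span_full.
  exact: gvecs_indep TT Pp PT sT sinj qP qinj.
exact: gvecs_in_span Pp qP vA.
Qed.
End Spanning.

(** * Spanning and generation under induction *)

Section CornerSpanning.
Variables (k : fieldType) (A L : falgType k) (i : A -> L).
Hypotheses (i_lin : linear i) (iM : {morph i : x y / x * y}).
Variable j : L -> A.
Hypotheses (j_lin : linear j) (ij : forall l, i (j l) = i 1 * l * i 1)
  (ji : cancel i j).
Local Notation corner := (corner i_lin iM).
Local Notation ind := (ind i_lin iM).

(** Composed with [corner], the g-vectors of (X, P) become those of the induced summands, which are
    indecomposable and so occur, up to isomorphism, in [s'] and [q']. A linear expression over A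
    thus becomes one over [L]. *)
Lemma gvecs_ind_span X P (T Q : rmod L) n m n' m' (s : 'I_n -> rmod A) (q : 'I_m -> rmod A)
    (v : 'I_(n + m) -> rmod A) (s' : 'I_n' -> rmod L) (q' : 'I_m' -> rmod L) V :
  ext_projective X X -> projective P -> (forall f : 'Hom(P, X), rhom f -> f = 0) ->
  covers X s -> repeat_free s -> covers P q -> repeat_free q ->
  covers (regular_r A) v -> retract (ind X) T -> retract (ind P) Q ->
  covers T s' -> covers Q q' -> projective V -> in_span (gvecs s' q') (hom_dimq (ind V)).
Proof.
move=> XX Pp PX sX sinj qP qinj vA XT PQ [_ sT] [_ qQ] Vp.
have [c cE] := gvecs_span XX Pp PX sX sinj qP qinj vA Vp.
apply: (@in_span_ext _ _ _ (fun W => \sum_l c l * gvecs s q l (corner W))) => [W|].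
  by rewrite -cE /hom_dimq hom_dim_ind.
apply: (in_span_sum (v := fun l W => gvecs s q l (corner W))); rewrite /gvecs.
apply: (fam_cat_all (Q := fun g => in_span _ (fun W => g (corner W)))) => l.
  have [Si SX] := proj1 sX l; have [p' p'E] := ind_min_presentation i_lin iM j_lin ij ji
    (minpres (s l)).
  have [||a Sa] := sT (ind (s l)); first exact: (ind_indecomposable i_lin iM j_lin ij ji).
    exact: retract_trans (ind_retract i_lin iM SX) XT.
  apply: in_span_ext (in_span_mem _ (lshift m' a)) => W.
  by rewrite fam_cat_l -p'E; apply/esym/gvec_riso.
have [Qi QP] := proj1 qP l.
have [||b Qb] := qQ (ind (q l)); first exact: (ind_indecomposable i_lin iM j_lin ij ji).
  exact: retract_trans (ind_retract i_lin iM QP) PQ.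
apply: in_span_ext (in_span_mem _ (rshift n' b)) => W.
by rewrite fam_cat_r /hom_dimq -hom_dim_ind; congr _%:R; apply/esym/hom_dim_riso.
Qed.

Lemma indec_proj_ind (R : rmod L) : indecomposable R -> retract R (ind (regular_r A)) ->
  exists2 V, projective V & riso R (ind V).
Proof.
move=> Ri /(ind_indec_summand j_lin ij ji Ri)[V [_ VA RV]]; exists V => //.
exact: projective_retract VA (@regular_projective _ A).
Qed.

(** Maps X -> We transpose to maps [ind X] -> W, whose images lie in [S]. *)
Lemma Fac_ind_corner X (W : rmod L) (S : {vspace W}) : Fac X (corner W) ->
  (forall g : 'Hom(ind X, W), rhom g -> (limg g <= S)%VS) ->
  forall w, ract w (i 1) \in S.
Proof.
move=> /FacP XW HS w; have E : (corner_in i_lin iM W @^-1: S)%VS = fullv.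
  apply: XW => f fh; apply/subvP => _ /memv_imgP[x _ ->]; rewrite -memv_preim.
  have [g gh gE] := ind_lift i_lin iM (ihom_rhom (@corner_in_hom _ _ _ _ i_lin iM W) fh).
  rewrite -[corner_in _ _ _ _]comp_lfunE -gE comp_lfunE; apply: (subvP (HS g gh)).
  by rewrite memv_img ?memvf.
have [|x ->] := @corner_onto _ _ _ _ i_lin iM W (ract w (i 1)).
  by rewrite -ractM -iM mulr1.
by rewrite memv_preim E memvf.
Qed.

Section OtherCorner.
Variables (B : falgType k) (i' : B -> L).
Hypotheses (i'_lin : linear i') (i'M : {morph i' : x y / x * y}).
(** [nu] presents the corner e L f as a bimodule image of [N], where e = [i 1] and f = [i' 1]. *)
Variables (N : bimod A B) (nu : N -> L).
Hypotheses (nu_lin : linear nu) (nuL : forall a n, nu (blact a n) = i a * nu n)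
  (nuR : forall n b, nu (bract n b) = nu n * i' b)
  (nuS : forall l, exists n, i 1 * l * i' 1 = nu n).

(** The map x (x) n |-> eta(x) nu(n) sends X (x) N onto (X (x) eL)f, because x (x) l times f equals
    eta(x) e l f and e l f is some nu(n). *)
Lemma Fac_other_corner X (Y : rmod B) : Fac Y (tens_rmod X N) ->
  Fac Y (Defs.corner i'_lin i'M (ind X)).
Proof.
move=> YN; pose be (x : X) (n : N) : ind X := ract (eta i_lin iM X x) (nu n).
have beb : balanced (X := X) (N := bimod_l N) be.
  split; first split=> [n|x] c u v.
  - by rewrite /be linearP ract_linl.
  - by rewrite /be nu_lin ract_linr.
  by move=> x a n; rewrite /be eta_hom -ractM nuL.
have bel := tlift_linear (X := X) (N := bimod_l N) be.
pose zeta := linfun (tlift be : tens_rmod X N -> ind X).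
have zetaE t : zeta t = tlift be t by exact: (linfunE (V := tens_rmod X N) bel).
have zh : ihom i' zeta.
  move=> t b; rewrite !zetaE; move: t.
  apply: (tens_ext (X := X) (N := bimod_l N)) => [c u v|c u v|x n].
  - by rewrite [in LHS](ract_linl (V := tens_rmod X N)) bel.
  - by rewrite bel ract_linl.
  by rewrite [ract _ _](tens_ractE x n b) !(tliftE _ _ beb) /be nuR ractM.
have [g gh gE] := to_corner i'_lin i'M zh.
apply: Fac_surj YN gh _; apply/limg_fullP => y.
have zS w : ract w (i' 1) \in limg zeta.
  rewrite -qproj_eq0; apply/eqP; move: w.
  apply: (tens_ext (X := X) (N := bimod_l (corner_ideal i_lin iM))) => [c u v|c u v|x l].
  - by rewrite (ract_linl (V := ind X)) qproj_linear.
  - by rewrite scaler0 addr0.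
  apply/eqP; rewrite qproj_eq0 pure_eta -ractM.
  have /(ideal_mem iM) <- : vsval l \in ideal_space i by exact: subvsP.
  have [n ->] := nuS (vsval l).
  rewrite -[ract _ _]/(be x n) -(tliftE _ _ beb) -zetaE memv_img ?memvf //.
have /memv_imgP[t _ tE] := zS (corner_in i'_lin i'M _ y).
by exists t; apply: (@corner_in_inj _ _ _ _ i'_lin i'M); rewrite -[in RHS]comp_lfunE gE
  -tE corner_fix.
Qed.
End OtherCorner.
End CornerSpanning.

(** * Gluing *)

Section Gluing.
Variables (k : fieldType) (A B L : falgType k).
Variables (iA : A -> L) (jA : L -> A) (iB : B -> L) (jB : L -> B).
Hypotheses (iA_lin : linear iA) (iAM : {morph iA : x y / x * y})
  (jA_lin : linear jA) (ijA : forall l, iA (jA l) = iA 1 * l * iA 1) (jiA : cancel iA jA).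
Hypotheses (iB_lin : linear iB) (iBM : {morph iB : x y / x * y})
  (jB_lin : linear jB) (ijB : forall l, iB (jB l) = iB 1 * l * iB 1) (jiB : cancel iB jB).
Hypothesis iAB1 : iA 1 + iB 1 = 1.
Local Notation FA := (ind iA_lin iAM).
Local Notation FB := (ind iB_lin iBM).
Local Notation eA := (corner iA_lin iAM).
Local Notation eB := (corner iB_lin iBM).
Variables (X : rmod A) (Y : rmod B).
Let T := dsum (FA X) (FB Y).
Hypotheses (XT : Fac X (eA T)) (YT : Fac Y (eB T)).

Lemma Fac_glued W : Fac T W <-> Fac X (eA W) /\ Fac Y (eB W).
Proof.
split=> [TW|[XW YW]].
  by split; [apply: Fac_trans XT _ | apply: Fac_trans YT _]; exact: Fac_corner.
(* Every w is we + wf, and each term is reached from one of the two summands of [T]. *)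
apply/FacP => S HS; apply/vspaceP => w; rewrite memvf -[w]ract1 -iAB1.
rewrite (linD (ract_linr w)) rpredD //.
  apply: (Fac_ind_corner XW) => g gh; apply: Fac_limg gh HS.
  exact: Fac_retract (retract_dsum1 _ _).
apply: (Fac_ind_corner YW) => g gh; apply: Fac_limg gh HS.
exact: Fac_retract (retract_dsum2 _ _).
Qed.

Lemma regular_ihom (D : falgType k) (i : D -> L) : linear i -> {morph i : x y / x * y} ->
  exists2 f : 'Hom(regular_r D, regular_r L), ihom i f & f =1 i.
Proof.
move=> il iM; exists (linfun (i : regular_r D -> regular_r L)) => [x a|x].
  by rewrite !(linfunE (V := regular_r D) (W := regular_r L)) //; exact: iM.
exact: (linfunE (V := regular_r D) (W := regular_r L)).
Qed.

(** Sending the two generators to e and f gives a surjection onto Lambda, which splits by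
    projectivity. *)
Lemma regular_retract : retract (regular_r L) (dsum (FA (regular_r A)) (FB (regular_r B))).
Proof.
have [fA fAh fAE] := regular_ihom iA_lin iAM; have [fB fBh fBE] := regular_ihom iB_lin iBM.
have [gA gAh gAE] := ind_lift iA_lin iAM fAh; have [gB gBh gBE] := ind_lift iB_lin iBM fBh.
have gh := copair_hom gAh gBh.
have gs : limg (copair gA gB) = fullv.
  apply/limg_fullP => l.
  exists (ract (eta iA_lin iAM (regular_r A) 1) l, ract (eta iB_lin iBM (regular_r B) 1) l).
  rewrite copairE /= gAh gBh -[gA _]comp_lfunE gAE -[gB _]comp_lfunE gBE fAE fBE.
  by rewrite -[LHS]mul1r -iAB1 mulrDl.
have [h hh hE] := regular_projective gh (@rhom_id _ _ (regular_r L)) gs.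
exists h, (copair gA gB) => // l.
by rewrite -comp_lfunE hE id_lfunE.
Qed.

Theorem glued_support_tau_tilting :
  support_tau_tilting X -> support_tau_tilting Y -> support_tau_tilting T.
Proof.
case=> /tau_rigidP XX [P [Pp PX [a [p [/card_indecP[sX [sXc sXr]] /card_indecP[qP [qPc
  qPr]] /card_indecP[vA [vAc _]]]]]]].
case=> /tau_rigidP YY [R [Rp RY [b [r [/card_indecP[sY [sYc sYr]] /card_indecP[qR [qRc
  qRr]] /card_indecP[vB [vBc _]]]]]]].
have TT : ext_projective T T.
  by apply: ext_projective_dsum; [exact: ext_projective_ind XT | exact:
    ext_projective_ind YT].
pose Q := dsum (FA P) (FB R).
have Qp : projective Q by apply: projective_dsum; exact: ind_projective.
have QT (f : 'Hom(Q, T)) : rhom f -> f = 0.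
  move=> fh; have f1 := ind_hom0 Pp PX XT (rhom_comp fh (@in1_hom _ _ (FA P) (FB R))).
  have f2 := ind_hom0 Rp RY YT (rhom_comp fh (@in2_hom _ _ (FA P) (FB R))).
  exact: dsum_hom0 f1 f2.
have [t cT] := card_indec_ex T; have [m cQ] := card_indec_ex Q.
have [n cL] := card_indec_ex (regular_r L).
split; first exact/tau_rigidP.
exists Q; split=> //; exists t, m; split=> //; suff -> : (t + m)%N = n by [].
have [s [sc sr]] := proj1 (card_indecP _ _) cT.
have [q [qc qr]] := proj1 (card_indecP _ _) cQ.
have [v [vc vr]] := proj1 (card_indecP _ _) cL.
(* The t + m g-vectors are independent in the span of the n functions of [v]; conversely these n
   functions are independent in the span of the g-vectors. *)
apply/eqP; rewrite eqn_leq; apply/andP; split.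
  apply: (indep_span_leq (gvecs_indep TT Qp QT sc sr qc qr)).
  exact: gvecs_in_span Qp qc vc.
have vi l : indecomposable (v l) by have [] := proj1 vc l.
apply: (indep_span_leq (v := gvecs s q) (hom_dimq_indep vi vr)) => l.
have [_ /retract_trans/(_ regular_retract)] := proj1 vc l.
case/(retract_exchange (vi l)) => [/(indec_proj_ind jA_lin ijA jiA (vi
  l))|/(indec_proj_ind jB_lin ijB jiB (vi l))] [V Vp lV].
  apply: (in_span_ext (g := hom_dimq (FA V))) => [W|].
    by rewrite /hom_dimq (hom_dim_riso W lV).
  exact: (gvecs_ind_span jA_lin ijA jiA XX Pp PX sXc sXr qPc qPr vAc (retract_dsum1 _ _)
    (retract_dsum1 _ _) sc qc Vp).
apply: (in_span_ext (g := hom_dimq (FB V))) => [W|].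
  by rewrite /hom_dimq (hom_dim_riso W lV).
exact: (gvecs_ind_span jB_lin ijB jiB YY Rp RY sYc sYr qRc qRr vBc (retract_dsum2 _ _)
  (retract_dsum2 _ _) sc qc Vp).
Qed.

End Gluing.

Lemma Fac_corner_dsum (k : fieldType) (A L : falgType k) (i : A -> L) (i_lin : linear i)
    (iM : {morph i : x y / x * y}) (X : rmod A) (V W : rmod L) :
  Fac X (corner i_lin iM V) -> Fac X (corner i_lin iM W) ->
  Fac X (corner i_lin iM (dsum V W)).
Proof.
move=> XV XW; have [f fh fE] := corner_map i_lin iM (@in1_hom _ _ V W).
have [g gh gE] := corner_map i_lin iM (@in2_hom _ _ V W).
apply/FacP => S HS; apply/vspaceP => w; rewrite memvf.
have [E1 E2] : ract (corner_in i_lin iM _ w).1 (i 1) = (corner_in i_lin iM _ w).1 /\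
    ract (corner_in i_lin iM _ w).2 (i 1) = (corner_in i_lin iM _ w).2.
  by split; have := corner_fix w; [move/(congr1 fst) | move/(congr1 snd)].
have [x xE] := corner_onto i_lin iM E1; have [y yE] := corner_onto i_lin iM E2.
have -> : w = f x + g y.
  apply: (@corner_in_inj _ _ _ _ i_lin iM).
  by rewrite linearD /= fE gE -xE -yE -dsum_split.
by apply: rpredD; [apply: (subvP (Fac_limg XV fh HS)) | apply: (subvP (Fac_limg XW gh HS))];
  rewrite memv_img ?memvf.
Qed.

(** * Morita contexts *)

Section Morita.
Variables (k : fieldType) (A B : falgType k) (C : morita_context A B).
Local Notation L := (morita_alg C).

Lemma morita_mulE (a a' : A) (n n' : mcN C) (m m' : mcM C) (b b' : B) :
  (((a, n), (m, b)) : L) * (((a', n'), (m', b')) : L) =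
  ((a * a' + mc_phi C (pure n m'), blact a n' + bract n b'),
   (bract m a' + blact b m', mc_psi C (pure m n') + b * b')) :> L.
Proof. by []. Qed.

Lemma pure0l (D : falgType k) (X : rmod D) (N : lmod D) (n : N) : pure 0 n = 0 :> tens X N.
Proof. by have [pl _] := pure_bilin X N; exact: lin0 (pl n). Qed.
Lemma pure0r (D : falgType k) (X : rmod D) (N : lmod D) (x : X) : pure x 0 = 0 :> tens X N.
Proof. by have [_ pr] := pure_bilin X N; exact: lin0 (pr x). Qed.

Let mc0 := (pure0l, pure0r, linear0, bact0, bact1, mul1r, mulr1, mul0r, mulr0, addr0,
  add0r).

(** The compression to e Lambda e, in the role of [j]. *)
Definition outA (x : L) : A := x.1.1.
Definition outB (x : L) : B := x.2.2.

Lemma outA_lin : linear outA. Proof. by []. Qed.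
Lemma outB_lin : linear outB. Proof. by []. Qed.

Lemma outAK (l : L) : morita_inA C (outA l) = morita_inA C 1 * l * morita_inA C 1.
Proof.
case: l => [[a n] [m b]]; rewrite /morita_inA /outA !morita_mulE.
by apply: morita_eq => /=; rewrite !mc0.
Qed.
Lemma outBK (l : L) : morita_inB C (outB l) = morita_inB C 1 * l * morita_inB C 1.
Proof.
case: l => [[a n] [m b]]; rewrite /morita_inB /outB !morita_mulE.
by apply: morita_eq => /=; rewrite !mc0.
Qed.

Lemma morita_in1 : morita_inA C 1 + morita_inB C 1 = 1.
Proof. by apply: morita_eq => /=; rewrite !mc0. Qed.

(** The embedding of N as e Lambda f, in the role of [nu]. *)
Definition inN (n : mcN C) : L := ((0, n), (0, 0)).
Definition inM (m : mcM C) : L := ((0, 0), (m, 0)).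

Lemma Fac_f_ideal (X : rmod A) (Y : rmod B) :
  Fac Y (tens_rmod X (mcN C)) -> Fac Y (corner_f (F_A C X)).
Proof.
apply: (@Fac_other_corner _ _ _ _ (morita_inA_lin C) (morita_inAM C) _ _ (morita_inB_lin
  C) (morita_inBM C) _ inN).
- by move=> c n n'; apply: morita_eq => //=; rewrite scaler0 addr0.
- by move=> a n; rewrite morita_mulE; apply: morita_eq => /=; rewrite !mc0.
- by move=> n b; rewrite morita_mulE; apply: morita_eq => /=; rewrite !mc0.
case=> [[a n] [m b]]; exists n; rewrite !morita_mulE.
by apply: morita_eq => /=; rewrite !mc0.
Qed.

Lemma Fac_e_ideal (X : rmod A) (Y : rmod B) :
  Fac X (tens_rmod Y (mcM C)) -> Fac X (corner_e (F_B C Y)).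
Proof.
apply: (@Fac_other_corner _ _ _ _ (morita_inB_lin C) (morita_inBM C) _ _ (morita_inA_lin
  C) (morita_inAM C) _ inM).
- by move=> c m m'; apply: morita_eq => //=; rewrite scaler0 addr0.
- by move=> b m; rewrite morita_mulE; apply: morita_eq => /=; rewrite !mc0.
- by move=> m a; rewrite morita_mulE; apply: morita_eq => /=; rewrite !mc0.
case=> [[a n] [m b]]; exists m; rewrite !morita_mulE.
by apply: morita_eq => /=; rewrite !mc0.
Qed.

End Morita.

(** A summand of [F_A C X] may be isomorphic to one of [F_B C Y], so the conclusion is given both
    for the displayed sum and for a basic version of it. *)
Theorem corollary5p1 (k : fieldType) (A B : falgType k) (C : morita_context A B)
    (X : rmod A) (Y : rmod B)
    (basicX : basic X) (basicY : basic Y)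
    (sttX : support_tau_tilting X) (sttY : support_tau_tilting Y)
    (facX : Fac X (tens_rmod Y (mcM C))) (facY : Fac Y (tens_rmod X (mcN C))) :
  let T := dsum (F_A C X) (F_B C Y) in
  [/\ support_tau_tilting T,
      exists2 U : rmod (morita_alg C), basic_version T U & support_tau_tilting U
    & forall W : rmod (morita_alg C), Fac T W <-> glued_class X Y W].
Proof.
move=> T.
have outAi : cancel (@morita_inA k A B C) (@outA k A B C) by [].
have outBi : cancel (@morita_inB k A B C) (@outB k A B C) by [].
have XT : Fac X (corner_e T).
  apply: Fac_corner_dsum; last exact: Fac_e_ideal.
  exact: (Fac_corner_ind _ _ (@outA_lin _ _ _ C) (@outAK _ _ _ C) outAi).
have YT : Fac Y (corner_f T).
  apply: Fac_corner_dsum; first exact: Fac_f_ideal.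
  exact: (Fac_corner_ind _ _ (@outB_lin _ _ _ C) (@outBK _ _ _ C) outBi).
have TT : support_tau_tilting T.
  exact: (glued_support_tau_tilting (@outA_lin _ _ _ C) (@outAK _ _ _ C) outAi
    (@outB_lin _ _ _ C) (@outBK _ _ _ C) outBi (morita_in1 C) XT YT sttX sttY).
split=> //; first exact: support_tau_tilting_basic.
by move=> W; exact: (Fac_glued (morita_in1 C) XT YT).
Qed.
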